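(* For $d,n\in\mathbb{N}$ and $\varepsilon\in(0,1)$, there is a linear sketching algorithm using $O(1/\varepsilon)\cdot\mathrm{polylog}(n,d)$ space that, given multisets $A,B\subset\{0,1\}^d$ with $|A|=|B|=n$, outputs a number $\eta$ such that \[\mathsf{EMD}(A,B)\le\eta\le\tilde O(\log n)\cdot\mathsf{EMD}(A,B)+\varepsilon nd\] with probability at least $2/3$.
   Context: $\mathsf{EMD}(A,B)=\min_M\sum_{(a,b)\in M}\|a-b\|_1$ over perfect matchings $M$ between $A$ and $B$. The pair $(A,B)$ is encoded as the vector $f_{A,B}\in\mathbb{R}^{2\cdot2^d}$ whose coordinates count the multiplicities of each point of $\{0,1\}^d$ in $A$ and in $B$. A (one-pass) linear sketch draws a random matrix $\mathbf{S}$, stores only $\mathbf{S}f_{A,B}$ (and $\mathbf{S}$), and computes its output from $\mathbf{S}f_{A,B}$ and $\mathbf{S}$; its space is that needed to store $\mathbf{S}f_{A,B}$ (random-oracle model: storing $\mathbf{S}$ is free). $\tilde O(\log n)$ denotes at most $\log n\cdot\mathrm{poly}(\log\log n)$ up to absolute constants, independent of $d$. *)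

(* Defs.v *)
From HB Require Import structures.
From mathcomp Require Import all_boot all_order all_algebra.
From mathcomp Require Import finmap multiset.
From mathcomp Require Import all_classical all_reals all_analysis.

Set Implicit Arguments.
Unset Strict Implicit.
Unset Printing Implicit Defensive.

Import Order.TTheory GRing.Theory Num.Theory.
Local Open Scope classical_set_scope.
Local Open Scope mset_scope.
Local Open Scope ring_scope.

Definition cube (d : nat) : finType := {ffun 'I_d -> bool}.

Lemma card_cube (d : nat) : #|cube d| = (2 ^ d)%N.
Proof. by rewrite card_ffun card_bool card_ord. Qed.

Definition l1dist (R : realType) (d : nat) (a b : cube d) : R :=
  \sum_(i < d) `|(a i)%:R - (b i)%:R|.

(* For lists s and t of the same length, zip s t is the perfect matching that
   pairs the i-th point of s with the i-th point of t. *)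
Definition matching_cost (R : realType) (d : nat) (s t : seq (cube d)) : R :=
  \sum_(p <- zip s t) l1dist R p.1 p.2.

(* For size A = size B, the perfect matchings between A and B are the zip A t
   with t a rearrangement of B; t = B itself is one of them, so the default
   value of the iterated minimum is attained. *)
Definition EMD (R : realType) (d : nat) (A B : {mset cube d}) : R :=
  \big[Num.min/matching_cost R A B]_(t <- permutations B) matching_cost R A t.

(* 2 * 2^d by card_cube *)
Definition freq_dim (d : nat) : nat := (#|cube d| + #|cube d|)%N.

Definition freq_vec (d : nat) (A B : {mset cube d}) : 'cV[int]_(freq_dim d) :=
  col_mx (\col_i (A (enum_val i))%:Z) (\col_i (B (enum_val i))%:Z).

(* Entries are integers (finite-precision reals, up to rescaling): an entry of
   unbounded precision would make storing the product S f meaningless as a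
   space measure. As matrices over int are countable, measurability of the
   fibres is measurability for the discrete sigma-algebra. The output depends
   on the randomness only through S, and on the input only through S f. *)
Record linear_sketch (R : realType) (d : nat) := LinearSketch {
  sk_disp : measure_display ;
  sk_space : measurableType sk_disp ;
  sk_prob : probability sk_space R ;
  sk_rows : nat ;
  sk_mx : sk_space -> 'M[int]_(sk_rows, freq_dim d) ;
  sk_mx_measurable : forall S, measurable (sk_mx @^-1` [set S]) ;
  sk_decode : 'M[int]_(sk_rows, freq_dim d) -> 'cV[int]_sk_rows -> R
}.

Definition sk_state (R : realType) (d : nat) (sk : linear_sketch R d)
    (w : sk_space sk) (A B : {mset cube d}) : 'cV[int]_(sk_rows sk) :=
  sk_mx w *m freq_vec A B.

Definition sk_output (R : realType) (d : nat) (sk : linear_sketch R d)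
    (w : sk_space sk) (A B : {mset cube d}) : R :=
  sk_decode (sk_mx w) (sk_state w A B).

(* A sign bit plus the binary digits of the absolute value. A zero entry still
   costs one bit, so positions of nonzero entries carry no free information. *)
Definition int_bits (z : int) : nat := (up_log 2 (absz z).+1).+1.

Definition vec_bits (k : nat) (v : 'cV[int]_k) : nat :=
  (\sum_(i < k) int_bits (v i ord0))%N.

(* The natural logarithm, replaced by 1 where it is smaller than 1 or undefined,
   so that asymptotic expressions in log n make sense for every n. *)
Definition plog (R : realType) (x : R) : R := Num.max 1 (ln x).

(* Main.v *)
(** A random quadtree is obtained by giving each coordinate an independent level:
    the cells of level k group the points that agree on a random set of
    coordinates of density 2^-k. Each edge from a cell to its parent gets a
    data-dependent weight, the mean distance between a point of A + B in the
    cell and a point of A + B in the parent cell. Moving the surplus of every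
    cell up the tree bounds EMD(A, B) from above by the weighted sum of the
    surpluses |z_v|. In expectation this sum exceeds EMD(A, B) by a factor
    O(log n log log n) only: an edge weight at level k is controlled by ln of the
    ratio of the populations of two balls of radii about 2^k around a point, and
    these logarithms telescope over k.

    The weighted sum is estimated by linear counters. Parent cells and cells are
    subsampled at all pairs of dyadic rates; when a single cell dominates the
    sample, its surplus and the populations of the cell and its parent can be
    read off. The distance of two points is replaced by the event that a random
    bit, a function of a random set of coordinates of density about 2^-k / log n,
    differs; its probability is a constant multiple of the rescaled distance
    except for pairs too far apart, whose contribution is small. So counting
    also the points with bit 1 gives the edge weight. An average of O~(1 / eps)
    independent copies concentrates by Chebyshev's inequality up to the additive
    error eps n d, because the range of one copy is n d up to logarithms. *)

Require Import Defs.
From mathcomp Require Import all_boot all_order all_algebra.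
From mathcomp Require Import finmap multiset.
From mathcomp Require Import all_classical all_reals all_analysis.
From mathcomp Require Import ring lra zify.

Set Implicit Arguments.
Unset Strict Implicit.
Unset Printing Implicit Defensive.

Import Order.TTheory GRing.Theory Num.Theory.
Local Open Scope classical_set_scope.
Local Open Scope mset_scope.
Local Open Scope ring_scope.

(** * Uniform expectations *)

(** The edge weights depend on the same labels that decide which pairs are separated. A matched pair
    is therefore charged to a coordinate [j] on which it differs: given that [j] is sampled, the
    cell of [a] in [X] is its cell in [pinned X j a], which no longer depends on the label of [j],
    so a bound valid for all point sets applies. The log log n factor comes from distances between
    2^(k - b) and 2^(k + b) with 2^b of order log n: the populations compared are those of balls 2 b
    levels apart. Closer points are summed by rank, farther ones rarely survive. The bound for the
    middle range must vanish when both balls have the same population, since a constant per level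
    would cost a factor log d. The tree cost bounds EMD for each tree, but replacing distances by
    bits loses a far part that is small only in expectation, so everything is stated for the mean of
    one copy. The second moment is at most range times mean; with allowed deviation mean / 2 + tau,
    the number of copies is linear, not quadratic, in 1 / tau. *)

Section Expectation.
Variable R : realFieldType.

Definition Ex (T : finType) (f : T -> R) : R := (\sum_x f x) / #|T|%:R.

Section Basics.
Variable T : finType.
Implicit Types f g : T -> R.

Lemma eq_Ex f g : f =1 g -> Ex f = Ex g.
Proof. by move=> fg; rewrite /Ex (eq_bigr g). Qed.

Lemma ExD f g : Ex (fun x => f x + g x) = Ex f + Ex g.
Proof. by rewrite /Ex big_split mulrDl. Qed.

Lemma ExZ c f : Ex (fun x => c * f x) = c * Ex f.
Proof. by rewrite /Ex -mulr_sumr mulrA. Qed.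

Lemma ExZr c f : Ex (fun x => f x * c) = Ex f * c.
Proof. by rewrite /Ex -mulr_suml mulrAC. Qed.

Lemma ExN f : Ex (fun x => - f x) = - Ex f.
Proof. by rewrite /Ex sumrN mulNr. Qed.

Lemma ExB f g : Ex (fun x => f x - g x) = Ex f - Ex g.
Proof. by rewrite ExD ExN. Qed.

Lemma Ex_sum (I : Type) (r : seq I) (P : pred I) (F : I -> T -> R) :
  Ex (fun x => \sum_(i <- r | P i) F i x) = \sum_(i <- r | P i) Ex (F i).
Proof. by rewrite /Ex exchange_big mulr_suml. Qed.

Lemma le_Ex f g : (forall x, f x <= g x) -> Ex f <= Ex g.
Proof.
move=> fg; rewrite /Ex ler_wpM2r ?invr_ge0 ?ler0n//.
by apply: ler_sum => x _.
Qed.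

Lemma Ex_ge0 f : (forall x, 0 <= f x) -> 0 <= Ex f.
Proof. by move=> f0; rewrite divr_ge0 ?ler0n// sumr_ge0. Qed.

Lemma Ex_cst c : (0 < #|T|)%N -> Ex (fun _ : T => c) = c.
Proof.
move=> T0; rewrite /Ex sumr_const -[c *+ _]mulr_natr mulfK//.
by rewrite pnatr_eq0 -lt0n.
Qed.

End Basics.

Lemma Ex_pair (T U : finType) (f : T -> U -> R) :
  Ex (fun p : T * U => f p.1 p.2) = Ex (fun x => Ex (f x)).
Proof.
rewrite /Ex -mulr_suml pair_bigA card_prod natrM invfM -!mulrA.
by rewrite (mulrC (_^-1)).
Qed.

Definition upd (I T : finType) (w : {ffun I -> T}) (i : I) (t : T) :
    {ffun I -> T} :=
  [ffun k => if k == i then t else w k].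

Lemma updE (I T : finType) (w : {ffun I -> T}) i t : upd w i t i = t.
Proof. by rewrite ffunE eqxx. Qed.

Lemma upd_neq (I T : finType) (w : {ffun I -> T}) i t k :
  k != i -> upd w i t k = w k.
Proof. by rewrite ffunE => /negPf->. Qed.

(** Exchanging [w i] with the fresh value [t] is an involution of the pairs [(w, t)], hence
    preserves the uniform law. This is how one label is conditioned on while the others stay
    fixed. *)
Lemma Ex_upd (I T : finType) (i : I) (f : {ffun I -> T} -> R) :
  (0 < #|T|)%N ->
  Ex f = Ex (fun w => Ex (fun t => f (upd w i t))).
Proof.
move=> T0; rewrite -Ex_pair.
pose sw (p : {ffun I -> T} * T) := (upd p.1 i p.2, p.1 i).
have swK : involutive sw.
  move=> [w t]; rewrite /sw /= updE; congr (_, _).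
  by apply/ffunP => k; rewrite !ffunE; case: eqP => [->|].
transitivity (Ex (fun p : {ffun I -> T} * T => f p.1)).
  rewrite (Ex_pair (fun w (_ : T) => f w)); apply: eq_Ex => w.
  by rewrite Ex_cst.
rewrite /Ex (reindex_inj (inv_inj swK)).
by congr (_ / _).
Qed.

Lemma Ex_ffun1 (I T : finType) (i : I) (g : T -> R) :
  (0 < #|T|)%N -> Ex (fun w : {ffun I -> T} => g (w i)) = Ex g.
Proof.
move=> T0; rewrite (Ex_upd i)//.
rewrite -[RHS](@Ex_cst {ffun I -> T}) ?card_ffun ?expn_gt0 ?T0//.
by apply: eq_Ex => w; apply: eq_Ex => t; rewrite updE.
Qed.

Lemma Ex_ffun_prod (I T : finType) (i : I) (g : T -> R)
    (f : {ffun I -> T} -> R) :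
  (0 < #|T|)%N -> (forall w t, f (upd w i t) = f w) ->
  Ex (fun w : {ffun I -> T} => g (w i) * f w) = Ex g * Ex f.
Proof.
move=> T0 fi; rewrite (Ex_upd i)// -ExZ.
apply: eq_Ex => w; rewrite -ExZr; apply: eq_Ex => t.
by rewrite updE fi.
Qed.

Lemma Ex_ffun2 (I T : finType) (i j : I) (g h : T -> R) :
  (0 < #|T|)%N -> i != j ->
  Ex (fun w : {ffun I -> T} => g (w i) * h (w j)) = Ex g * Ex h.
Proof.
move=> T0 ij; rewrite (@Ex_ffun_prod _ _ i g (fun w => h (w j)))//.
  by rewrite Ex_ffun1.
by move=> w t; rewrite upd_neq// eq_sym.
Qed.

Lemma Ex_lt_ord (N a : nat) : (a <= N)%N ->
  Ex (fun t : 'I_N => (t < a)%:R) = a%:R / N%:R.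
Proof.
move=> aN; rewrite /Ex card_ord; congr (_ / _).
rewrite -[in RHS](card_ord a) -sum1_card (big_ord_widen _ (fun=> 1%N) aN).
by rewrite natr_sum [RHS]big_mkcond; apply: eq_bigr => t _; case: ltnP.
Qed.

End Expectation.

(** * Transport along a tree of partitions *)

(** [EMD] keeps the order of [A] and permutes only [B]. A matching built on a reordered first list
    is brought back by permuting its pairs as a whole. *)
Lemma perm_zip (S T : eqType) (s s2 : seq S) (t2 : seq T) :
  perm_eq s s2 -> size t2 = size s2 ->
  exists2 t, perm_eq t t2 & perm_eq (zip s t) (zip s2 t2).
Proof.
case: s2 => [|x0 s2]; first by move=> /perm_nilP-> /size0nil->; exists [::].
case: t2 => [//|y0 t2] ss2 size_t2.
have [Is pIs ->] := perm_iotaP x0 ss2.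
exists (map (nth y0 (y0 :: t2)) Is).
  by apply/(perm_iotaP y0); exists Is; rewrite ?size_t2.
apply/(perm_iotaP (x0, y0)); exists Is.
  by rewrite size_zip size_t2 minnn.
rewrite -[Is in RHS]map_id; elim: Is {pIs} => //= i Is IHs.
by rewrite IHs -nth_zip.
Qed.

Section CellAverage.
Variables (R : realFieldType) (K : finType).
Implicit Types (s t X : seq K) (key : K -> K).

Definition cellcnt key s (v : K) : R := (count (fun x => key x == v) s)%:R.

Definition disc key s t (v : K) : R := `|cellcnt key s v - cellcnt key t v|.

Definition cellavg X key (v : K) (g : K -> R) : R :=
  (\sum_(x <- X | key x == v) g x) / cellcnt key X v.

Lemma cellcnt_ge0 key s v : 0 <= cellcnt key s v.
Proof. exact: ler0n. Qed.

Lemma cellcnt_gt0 key s x : x \in s -> 0 < cellcnt key s (key x).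
Proof. by move=> xs; rewrite ltr0n -has_count; apply/hasP; exists x. Qed.

Lemma disc_ge0 key s t v : 0 <= disc key s t v.
Proof. exact: normr_ge0. Qed.

Lemma cellcntE key s v : cellcnt key s v = \sum_(x <- s | key x == v) 1.
Proof. by rewrite /cellcnt -sum1_count natr_sum. Qed.

Lemma sum_cell_cst key s v (c : R) :
  \sum_(x <- s | key x == v) c = cellcnt key s v * c.
Proof. by rewrite cellcntE mulr_suml; apply: eq_bigr => x _; rewrite mul1r. Qed.

Lemma cellcnt_eq0 key s v : {in s, forall x, key x != v} -> cellcnt key s v = 0.
Proof.
move=> sv; rewrite /cellcnt (_ : count _ _ = 0%N)//.
by apply/eqP; rewrite -leqn0 leqNgt -has_count; apply/hasPn => x /sv.
Qed.

Lemma disc_eq0 key s t X v : {subset s <= X} -> {subset t <= X} ->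
  {in X, forall x, key x != v} -> disc key s t v = 0.
Proof.
move=> sX tX Xv; rewrite /disc !cellcnt_eq0 ?subr0 ?normr0//.
  by move=> x /tX; exact: Xv.
by move=> x /sX; exact: Xv.
Qed.

Lemma sum_by_key key s (f : K -> R) :
  \sum_(x <- s) f (key x) = \sum_v cellcnt key s v * f v.
Proof.
under [RHS]eq_bigr => v _ do rewrite cellcntE mulr_suml.
rewrite (exchange_big_dep xpredT)//=; apply: eq_bigr => x _.
by rewrite (big_pred1 (key x)) ?mul1r// => v; rewrite eq_sym.
Qed.

Lemma cellavg_ge0 X key v g : (forall x, 0 <= g x) -> 0 <= cellavg X key v g.
Proof. by move=> g0; rewrite divr_ge0 ?cellcnt_ge0 ?sumr_ge0. Qed.

Lemma le_cellavg X key v g h : (forall x, g x <= h x) ->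
  cellavg X key v g <= cellavg X key v h.
Proof.
move=> gh; rewrite ler_wpM2r ?invr_ge0 ?cellcnt_ge0//.
by apply: ler_sum => x _.
Qed.

Lemma eq_cellavg X key v g h : (forall x, x \in X -> key x = v -> g x = h x) ->
  cellavg X key v g = cellavg X key v h.
Proof.
move=> gh; rewrite /cellavg big_seq_cond [in RHS]big_seq_cond.
by congr (_ / _); apply: eq_bigr => x /andP[xX /eqP]; exact: gh.
Qed.

Lemma cellavgD X key v g h :
  cellavg X key v (fun x => g x + h x) = cellavg X key v g + cellavg X key v h.
Proof. by rewrite /cellavg big_split mulrDl. Qed.

Lemma cellavgZ X key v c g :
  cellavg X key v (fun x => c * g x) = c * cellavg X key v g.
Proof. by rewrite /cellavg -mulr_sumr mulrA. Qed.

Lemma cellavg_sum (I : Type) (r : seq I) (P : pred I) (F : I -> K -> R) X key v :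
  cellavg X key v (fun x => \sum_(i <- r | P i) F i x) =
  \sum_(i <- r | P i) cellavg X key v (F i).
Proof. by rewrite /cellavg exchange_big mulr_suml. Qed.

Lemma cellavg_cst X key x c : x \in X -> cellavg X key (key x) (fun=> c) = c.
Proof.
move=> xX; have := cellcnt_gt0 key xX; rewrite /cellavg.
set k := cellcnt _ _ _ => k0.
by rewrite -[c]mulr1 -mulr_sumr -cellcntE mulr1 mulfK// gt_eqF.
Qed.

Lemma cellavg_le_cst X key v g c : 0 <= c -> {in X, forall x, g x <= c} ->
  cellavg X key v g <= c.
Proof.
move=> c0 gc; have [k0|k0] := ltP 0 (cellcnt key X v); last first.
  have /eqP : cellcnt key X v = 0 by apply/le_anti; rewrite k0 cellcnt_ge0.
  by move=> /eqP E; rewrite /cellavg E invr0 mulr0.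
rewrite /cellavg ler_pdivrMr// cellcntE mulr_sumr.
rewrite big_seq_cond [leRHS]big_seq_cond.
by apply: ler_sum => x /andP[xX _]; rewrite mulr1 gc.
Qed.

(* Minimum at most average; both sides vanish on an empty cell if g does. *)
Lemma exists_le_cellavg X key v g :
  ({in X, forall x, key x != v} -> forall c, g c = 0) ->
  (0 < #|K|)%N ->
  exists c, g c <= cellavg X key v g.
Proof.
move=> gempty K0.
have [/hasP[x0 x0X /eqP x0v]|/hasPn nX] := boolP (has (fun x => key x == v) X);
  last first.
  have /card_gt0P[c _] := K0.
  by exists c; rewrite gempty// cellavg_ge0// => y; rewrite gempty.
have k0 : 0 < cellcnt key X v by rewrite -x0v cellcnt_gt0.
have [/hasP[c _ gc]|/hasPn ng] :=
  boolP (has (fun c => g c <= cellavg X key v g) X); first by exists c.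
have /eqP : \sum_(x <- X | key x == v) (g x - cellavg X key v g) = 0.
  rewrite sumrB sum_cell_cst /cellavg [cellcnt _ _ _ * _]mulrC divfK ?subrr//.
  by rewrite gt_eqF.
rewrite (big_rem x0)//= x0v eqxx gt_eqF// ltr_wpDr//; last first.
  by rewrite subr_gt0 ltNge ng.
rewrite big_seq_cond sumr_ge0// => x /andP[/mem_rem xX _].
by rewrite subr_ge0 ltW// ltNge ng.
Qed.

Definition mcost (dist : K -> K -> R) s t : R :=
  \sum_(p <- zip s t) dist p.1 p.2.

(** Points in the same cell are paired off greedily. The paired points need no transport between
    cells; the remaining lists share no cell, so the surplus of a cell is its number of remaining
    points. *)
Lemma cancel_cells key s t : exists s' t' s0 t0,
  [/\ perm_eq s (s' ++ s0), perm_eq t (t' ++ t0), map key s0 = map key t0 &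
      forall x y, x \in s' -> y \in t' -> key x != key y].
Proof.
have [m] := ubnP (size s); elim: m s t => // m IHm s t.
have [/hasP[x xs /mapP[y yt xy]] sm|/hasPn nst _] :=
  boolP (has (fun x => key x \in map key t) s).
  have [|s' [t' [s0 [t0 [ps pt e0 d]]]]] := IHm (rem x s) (rem y t).
    by rewrite size_rem// -ltnS prednK//; case: (s) xs.
  exists s', t', (x :: s0), (y :: t0); split=> //=; last by rewrite xy e0.
    rewrite (perm_trans (perm_to_rem xs))// perm_sym.
    by rewrite -cat1s perm_catCA/= perm_cons perm_sym.
  rewrite (perm_trans (perm_to_rem yt))// perm_sym.
  by rewrite -cat1s perm_catCA/= perm_cons perm_sym.
exists s, t, [::], [::]; rewrite !cats0; split=> // x y xs yt.
by apply: contra (nst x xs) => /eqP->; exact: map_f.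
Qed.

Lemma cellcnt_perm key s t v : perm_eq s t -> cellcnt key s v = cellcnt key t v.
Proof. by move=> /permP st; rewrite /cellcnt st. Qed.

Lemma cellcnt_cat key s t v :
  cellcnt key (s ++ t) v = cellcnt key s v + cellcnt key t v.
Proof. by rewrite /cellcnt count_cat natrD. Qed.

Lemma cellcnt_map key s t v : map key s = map key t ->
  cellcnt key s v = cellcnt key t v.
Proof.
move=> st; rewrite /cellcnt -(count_map key (pred1 v)) st.
by rewrite (count_map key (pred1 v)).
Qed.

Lemma disc_cancel key s t s' t' s0 t0 v :
  perm_eq s (s' ++ s0) -> perm_eq t (t' ++ t0) -> map key s0 = map key t0 ->
  disc key s t v = disc key s' t' v.
Proof.
move=> ps pt /cellcnt_map e0; rewrite /disc (cellcnt_perm _ _ ps).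
by rewrite (cellcnt_perm _ _ pt) !cellcnt_cat e0 opprD addrACA subrr addr0.
Qed.

Lemma disc_disjoint key s t v :
  (forall x y, x \in s -> y \in t -> key x != key y) ->
  disc key s t v = cellcnt key s v + cellcnt key t v.
Proof.
move=> st; have [/hasP[x xs /eqP xv]|/hasPn ns] :=
  boolP (has (fun x => key x == v) s).
  rewrite /disc (@cellcnt_eq0 _ t) ?subr0 ?addr0 ?ger0_norm ?cellcnt_ge0//.
  by move=> y yt; rewrite -xv eq_sym st.
by rewrite /disc (@cellcnt_eq0 _ s)// sub0r add0r normrN ger0_norm ?cellcnt_ge0.
Qed.

End CellAverage.

Arguments cellcnt {R K}.
Arguments disc {R K}.

Section TreeTransport.
Variables (R : realFieldType) (K : finType) (dist : K -> K -> R).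
Hypothesis dist_ge0 : forall x y, 0 <= dist x y.
Hypothesis distxx : forall x, dist x x = 0.
Hypothesis distC : forall x y, dist x y = dist y x.
Hypothesis dist_triangle : forall y x z, dist x z <= dist x y + dist y z.
Variables (X : seq K) (T : nat) (key : nat -> K -> K).
Hypothesis keyK : forall k l x, (k <= l)%N -> key l (key k x) = key l x.
Hypothesis key_top : forall x y, key T x = key T y.

(* The mean cost of moving a point of the level-k cell v, placed at a uniformly
   random point of that cell, to a uniformly random point of the parent cell. *)
Definition edge_weight (F : K -> K -> R) k v : R :=
  cellavg X (key k) v (fun x => cellavg X (key k.+1) (key k.+1 v) (F x)).

Definition level_cost (F : K -> K -> R) (s t : seq K) k : R :=
  \sum_v disc (key k) s t v * edge_weight F k v.

Lemma mcost_cat s1 s2 t1 t2 : size s1 = size t1 ->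
  mcost dist (s1 ++ s2) (t1 ++ t2) = mcost dist s1 t1 + mcost dist s2 t2.
Proof. by move=> st; rewrite /mcost zip_cat// big_cat. Qed.

Lemma mcost_same s : mcost dist s s = 0.
Proof.
rewrite /mcost; elim: s => [|x s IHs]; first by rewrite big_nil.
by rewrite /= big_cons IHs distxx addr0.
Qed.

Lemma mcost_move (f g : K -> K) s t : size s = size t ->
  mcost dist (map f s) (map f t) <=
    \sum_(x <- s) dist (f x) (g x) + \sum_(y <- t) dist (f y) (g y)
    + mcost dist (map g s) (map g t).
Proof.
rewrite /mcost; elim: s t => [|x s IHs] [|y t]//=.
  by rewrite !big_nil !addr0.
move=> [st]; rewrite !big_cons /=.
have := IHs _ st; have := dist_triangle (g x) (f x) (f y).
have := dist_triangle (g y) (g x) (f y); rewrite (distC (g y)).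
lra.
Qed.

Lemma mcost_map (f : K -> K) s t : mcost dist (map f s) (map f t) =
  \sum_(p <- zip s t) dist (f p.1) (f p.2).
Proof.
rewrite /mcost; elim: s t => [|x s IHs] [|y t] /=; rewrite ?big_nil//.
by rewrite !big_cons IHs.
Qed.

Lemma mcost_perm (f : K -> K) s s2 t2 : perm_eq s s2 -> size t2 = size s2 ->
  exists2 t, perm_eq t t2 &
    mcost dist (map f s) (map f t) = mcost dist (map f s2) (map f t2).
Proof.
move=> ss2 st2; have [t tt2 z] := perm_zip ss2 st2.
exists t => //; rewrite !mcost_map; exact: perm_big.
Qed.

(** Method of conditional expectations, by induction on the number of levels left. The invariant
    lets all points of cell [v] sit at an arbitrary location [pi v], so the random locations behind
    [edge_weight] can be fixed one level at a time. *)
Lemma tree_transport_step (pi : K -> K) (s t : seq K) k j :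
  (k + j)%N = T -> {subset s <= X} -> {subset t <= X} -> size s = size t ->
  exists2 t', perm_eq t' t &
    mcost dist (map (pi \o key k) s) (map (pi \o key k) t') <=
    \sum_v disc (key k) s t v *
      cellavg X (key k.+1) (key k.+1 v) (dist (pi v))
    + \sum_(k.+1 <= l < T.+1) level_cost dist s t l.
Proof.
elim: j k pi s t => [|j IHj] k pi s t kj sX tX st.
  exists t => //; rewrite addn0 in kj; subst k.
  rewrite (_ : mcost _ _ _ = 0).
    rewrite addr_ge0 ?sumr_ge0// => v _; first by
      rewrite mulr_ge0 ?disc_ge0 ?cellavg_ge0.
    rewrite sumr_ge0// => l _.
    rewrite mulr_ge0 ?disc_ge0 ?cellavg_ge0// => x.
    by rewrite cellavg_ge0.
  rewrite (_ : map _ t = map (pi \o key T) s) ?mcost_same//.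
  elim: s t st {sX tX} => [|x s IHs] [|y t]//= [/IHs->].
  by rewrite (key_top y x).
have [s' [t' [s0 [t0 [ps pt e0 dst]]]]] := cancel_cells (key k) s t.
pose w v : R := disc (key k) s t v; pose w' u : R := disc (key k.+1) s t u.
(* Cost of choosing [c] as the location of the parent cell [u]: bring the surplus of its children
   there, then move the surplus of [u] on to a random point of the next cell. Some [c] does at most
   as badly as a random point of [u]. *)
pose f u c := \sum_(v | key k.+1 v == u) w v * dist (pi v) c
  + w' u * cellavg X (key k.+2) (key k.+2 u) (dist c).
have [pi' pi'P] : exists pi' : K -> K,
    forall u, f u (pi' u) <= cellavg X (key k.+1) u (f u).
  apply: (fin_all_exists (P := fun u c => f u c <= cellavg X (key k.+1) u (f u))).
  move=> u; apply: exists_le_cellavg; last by apply/card_gt0P; exists u.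
  move=> Xu c; rewrite /f /w' (disc_eq0 _ sX tX Xu) mul0r addr0.
  rewrite big1// => v /eqP vu; rewrite /w (disc_eq0 _ sX tX) ?mul0r// => x xX.
  by apply: contra (Xu x xX) => /eqP xv; rewrite -vu -xv keyK.
have s'X : {subset s' <= X}.
  by move=> x xs; apply: sX; rewrite (perm_mem ps) mem_cat xs.
have t'X : {subset t' <= X}.
  by move=> x xs; apply: tX; rewrite (perm_mem pt) mem_cat xs.
have s0t0 : size s0 = size t0 by rewrite -(size_map (key k) s0) e0 size_map.
have s't' : size s' = size t'.
  by move: st; rewrite (perm_size ps) (perm_size pt) !size_cat s0t0 => /addIn.
have kj' : (k.+1 + j)%N = T by rewrite addSnnS.
have [t2 pt2 t2le] := IHj _ pi' s' t' kj' s'X t'X s't'.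
have pt20 : perm_eq (t2 ++ t0) t.
  by rewrite perm_sym (perm_trans pt)// perm_cat2r perm_sym.
have szt2 : size t2 = size t' by exact: perm_size.
have szt20 : size (t2 ++ t0) = size (s' ++ s0).
  by rewrite !size_cat szt2 s0t0 s't'.
have [t3 pt3 t3E] := mcost_perm (pi \o key k) ps szt20.
exists t3; first exact: perm_trans pt3 _.
rewrite t3E !map_cat mcost_cat ?size_map ?szt2//.
have -> : map (pi \o key k) t0 = map (pi \o key k) s0.
  by rewrite (map_comp pi) -e0 -map_comp.
rewrite mcost_same addr0.
apply: le_trans (mcost_move (pi \o key k) (pi' \o key k.+1) _) _.
  by rewrite szt2.
have E2 : \sum_(y <- t2) dist ((pi \o key k) y) ((pi' \o key k.+1) y) =
    \sum_(y <- t') dist ((pi \o key k) y) ((pi' \o key k.+1) y).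
  exact: perm_big.
(* Cancelled pairs share a cell at level [k], hence at all coarser levels, so removing them changes
   no later surplus. *)
have discE l v : (k <= l)%N ->
    disc (key l) s' t' v = disc (key l) s t v :> R.
  move=> kl; rewrite (disc_cancel _ v ps pt)//.
  have Ekl : key l =1 key l \o key k by move=> x; rewrite /= keyK.
  by rewrite !(eq_map Ekl) (map_comp (key l)) e0 -map_comp.
have E1 : \sum_(x <- s') dist ((pi \o key k) x) ((pi' \o key k.+1) x)
    + \sum_(y <- t') dist ((pi \o key k) y) ((pi' \o key k.+1) y) =
    \sum_v w v * dist (pi v) (pi' (key k.+1 v)).
  have F (r : seq K) :
      \sum_(x <- r) dist ((pi \o key k) x) ((pi' \o key k.+1) x) =
      \sum_v cellcnt (key k) r v * dist (pi v) (pi' (key k.+1 v)).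
    rewrite -(sum_by_key _ _ (fun v => dist (pi v) (pi' (key k.+1 v)))).
    by apply: eq_bigr => x _; rewrite /= keyK.
  rewrite !F -big_split; apply: eq_bigr => v _ /=.
  by rewrite -mulrDl -disc_disjoint// discE.
rewrite E2 E1; move: t2le; rewrite [X in _ <= _ + X](_ : _ =
    \sum_(k.+2 <= l < T.+1) level_cost dist s t l); last first.
  apply: eq_big_nat => l /andP[kl _]; apply: eq_bigr => v _.
  by rewrite discE// ltnW// ltnW.
move=> /(lerD (lexx (\sum_v w v * dist (pi v) (pi' (key k.+1 v)))))/le_trans.
apply; rewrite addrA [\sum_(k.+1 <= l < T.+1) _]big_ltn; last first.
  by rewrite ltnS -kj' leq_addr.
rewrite addrA lerD2r.
have -> : \sum_v disc (key k.+1) s' t' v *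
    cellavg X (key k.+2) (key k.+2 v) (dist (pi' v)) =
    \sum_u w' u * cellavg X (key k.+2) (key k.+2 u) (dist (pi' u)).
  by apply: eq_bigr => u _; rewrite discE.
have -> : \sum_v w v * dist (pi v) (pi' (key k.+1 v)) =
    \sum_u \sum_(v | key k.+1 v == u) w v * dist (pi v) (pi' u).
  rewrite (partition_big (key k.+1) xpredT)//=; apply: eq_bigr => u _.
  by apply: eq_bigr => v /eqP->.
rewrite -big_split /=.
apply: le_trans (ler_sum _ (fun u _ => pi'P u)) _.
rewrite [leRHS](_ : _ = \sum_u cellavg X (key k.+1) u (f u))//.
under [RHS]eq_bigr => u _ do rewrite /f cellavgD cellavgZ cellavg_sum.
rewrite big_split; congr (_ + _).
rewrite [LHS](partition_big (key k.+1) xpredT)//=; apply: eq_bigr => u _.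
by apply: eq_bigr => v /eqP->; rewrite cellavgZ.
Qed.

Hypothesis key0 : forall x, key 0%N x = x.

Lemma tree_transport (s t : seq K) :
  {subset s <= X} -> {subset t <= X} -> size s = size t ->
  exists2 t', perm_eq t' t &
    mcost dist s t' <= \sum_(0 <= k < T) level_cost dist s t k.
Proof.
move=> sX tX st.
have [t' tt'] := @tree_transport_step id s t 0 T (add0n _) sX tX st.
have id_key0 : id \o key 0 =1 id by move=> x; exact: key0.
rewrite !(eq_map id_key0) !map_id => t'le.
exists t' => //; apply: le_trans t'le _.
have -> : \sum_v disc (key 0) s t v *
    cellavg X (key 1) (key 1 v) (dist (id v)) = level_cost dist s t 0.
  apply: eq_bigr => v _; have [vX|vX] := boolP (v \in X); last first.
    rewrite (disc_eq0 _ sX tX) ?mul0r// => x xX; rewrite key0.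
    by apply: contraNneq vX => <-.
  congr (_ * _); rewrite /edge_weight -[in cellavg X (key 0) v](key0 v).
  rewrite [RHS](@eq_cellavg _ _ _ _ _ _
    (fun=> cellavg X (key 1) (key 1 v) (dist v))); first by rewrite cellavg_cst.
  by move=> x _; rewrite !key0 => ->.
(* At the top there is a single cell and the lists have equal size, so the surplus vanishes and the
   sum stops before [T]. *)
rewrite -(big_ltn (n := T.+1))// big_nat_recr//= [X in _ + X](_ : _ = 0) ?addr0//.
rewrite /level_cost big1// => v _; rewrite /disc /cellcnt.
have E (r : seq K) : count (fun x => key T x == v) r = ((key T v == v) * size r)%N.
  by elim: r => [|x r IHr] /=; rewrite ?muln0// IHr mulnS (key_top x v).
by rewrite !E st subrr normr0 mul0r.
Qed.

End TreeTransport.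

Section DiscMatching.
Variables (R : realFieldType) (K : finType).

(** A matched pair inside one cell cancels in the surplus; a separated pair affects two cells, each
    by at most 1. Hence any matching, in particular an optimal one, bounds the surpluses. *)
Lemma sum_disc_le (key : K -> K) (s t : seq K) (f : K -> R) :
  size s = size t -> (forall v, 0 <= f v) ->
  \sum_v disc key s t v * f v <=
  \sum_(p <- zip s t | key p.1 != key p.2) (f (key p.1) + f (key p.2)) :> R.
Proof.
move=> st f0.
have dE v : disc key s t v <= \sum_(p <- zip s t | key p.1 != key p.2)
    ((key p.1 == v)%:R + (key p.2 == v)%:R) :> R.
  elim: s t st => [|x s IHs] [|y t]//=.
    by move=> _; rewrite /disc /cellcnt subrr normr0 big_nil.
  move=> [/IHs]; rewrite big_cons /= /disc /cellcnt /= !natrD.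
  set S := \sum_(_ <- _ | _) _; have [->|xy] := eqVneq (key x) (key y).
    by rewrite opprD addrACA subrr add0r.
  move=> le_S; apply: le_trans (lerD (lexx _) le_S).
  rewrite opprD addrACA (le_trans (ler_normD _ _))// lerD2r.
  by rewrite (le_trans (ler_normB _ _))// !ger0_norm.
apply: le_trans (ler_sum _ (fun v _ => ler_wpM2r (f0 v) (dE v))) _.
under eq_bigr => v _ do rewrite mulr_suml.
rewrite exchange_big /=; apply: ler_sum => p _.
under eq_bigr => v _ do rewrite mulrDl.
rewrite big_split /=; apply: lerD.
  by rewrite (bigD1 (key p.1))//= eqxx mul1r big1 ?addr0// => v;
    rewrite eq_sym => /negPf->; rewrite mul0r.
by rewrite (bigD1 (key p.2))//= eqxx mul1r big1 ?addr0// => v;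
  rewrite eq_sym => /negPf->; rewrite mul0r.
Qed.

End DiscMatching.

(** * Random coordinate masks *)

Lemma Ex_prod (R : realFieldType) (I T : finType) (phi : I -> T -> R) :
  Ex (fun w : {ffun I -> T} => \prod_i phi i (w i)) = \prod_i Ex (phi i).
Proof.
rewrite /Ex -[in LHS](bigA_distr_bigA (fun i t => phi i t)) card_ffun.
by rewrite big_split /= prodr_const exprVn natrX.
Qed.

Section Masks.
Variable d : nat.
Implicit Types (x y z p : cube d) (X : seq (cube d)).

Definition hamming x y : nat := \sum_i (x i != y i).

Lemma hammingC x y : hamming x y = hamming y x.
Proof. by apply: eq_bigr => i _; rewrite eq_sym. Qed.

Lemma hammingxx x : hamming x x = 0%N.
Proof. by rewrite /hamming big1// => i _; rewrite eqxx. Qed.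

Lemma hamming_triangle y x z :
  (hamming x z <= hamming x y + hamming y z)%N.
Proof.
rewrite -big_split /=; apply: leq_sum => i _.
by case: (x i) (y i) (z i) => [] [] [].
Qed.

Lemma hamming_le x y : (hamming x y <= d)%N.
Proof.
rewrite -[leqRHS](card_ord d) -sum1_card; apply: leq_sum => i _.
exact: leq_b1.
Qed.

Lemma l1distE (R : realType) x y : l1dist R x y = (hamming x y)%:R.
Proof.
rewrite /hamming natr_sum; apply: eq_bigr => i _.
by case: (x i) (y i) => [] []; rewrite ?subrr ?normr0 ?subr0 ?sub0r ?normrN ?normr1.
Qed.

Variable N : nat.
Implicit Type w : {ffun 'I_d -> 'I_N}.

(* A cell of the partition with threshold a is determined by the coordinates of
   label below a; its key is the point with all other coordinates cleared. *)
Definition msk w a x : cube d := [ffun i => (w i < a)%N && x i].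

Lemma mskK w a b x : (a <= b)%N -> msk w a (msk w b x) = msk w a x.
Proof.
move=> ab; apply/ffunP => i; rewrite !ffunE.
by case: ltnP => //= wa; rewrite (leq_trans wa ab).
Qed.

Lemma msk_full w x : msk w N x = x.
Proof. by apply/ffunP => i; rewrite !ffunE ltn_ord. Qed.

Lemma msk0 w x y : msk w 0 x = msk w 0 y.
Proof. by apply/ffunP => i; rewrite !ffunE. Qed.

Lemma mskP w a x y :
  (msk w a x == msk w a y) = [forall i, (w i < a)%N ==> (x i == y i)].
Proof.
apply/eqP/forallP => [/ffunP xy i|xy].
  by have := xy i; rewrite !ffunE; case: ltnP => //= _ ->.
by apply/ffunP => i; rewrite !ffunE; have := xy i; case: ltnP => //= _ /eqP.
Qed.

Section MaskExpectation.
Variable R : realType.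

Lemma Ex_msk_eq a x y : (a <= N)%N -> (0 < N)%N ->
  Ex (fun w => (msk w a x == msk w a y)%:R) =
  (1 - a%:R / N%:R) ^+ hamming x y :> R.
Proof.
move=> aN N0.
pose phi i (t : 'I_N) : R := if x i != y i then 1 - (t < a)%:R else 1.
transitivity (Ex (fun w => \prod_i phi i (w i))).
  apply: eq_Ex => w; rewrite mskP; case: forallP => [xy|/forallP].
    rewrite big1// => i _; rewrite /phi; have := xy i.
    by case: ltnP => //= _; case: eqP; rewrite ?subr0.
  rewrite negb_forall => /existsP[i]; rewrite negb_imply => /andP[wa xy].
  by rewrite (bigD1 i)//= /phi xy wa subrr mul0r.
rewrite Ex_prod /hamming.
rewrite [RHS](_ : _ = \prod_i (1 - a%:R / N%:R) ^+ (x i != y i)); last first.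
  by rewrite prodrXr.
apply: eq_bigr => i _; rewrite /phi; case: (x i != y i) => /=.
  by rewrite ExB Ex_cst ?card_ord// Ex_lt_ord// expr1.
by rewrite Ex_cst ?card_ord// expr0.
Qed.

(** When the label of [j] is below the threshold, only these points can share the cell of [p]. *)
Definition pinned X (j : 'I_d) p := [seq x : cube d <- X | x j == p j].

(** Key of the partition that results when [j] is not sampled. *)
Definition mskoff w j a x : cube d := [ffun i => (i != j) && (w i < a)%N && x i].

Lemma mskoffP w j a x y : (mskoff w j a x == mskoff w j a y) =
  [forall i, (i != j) && (w i < a)%N ==> (x i == y i)].
Proof.
apply/eqP/forallP => [/ffunP xy i|xy].
  by have := xy i; rewrite !ffunE; case: (_ && (w i < a)%N) => //= ->.
by apply/ffunP => i; rewrite !ffunE; have := xy i;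
  case: (_ && (w i < a)%N) => //= /eqP.
Qed.

Lemma msk_upd_lt w j (t : 'I_N) a x y : (t < a)%N ->
  (msk (upd w j t) a x == msk (upd w j t) a y) =
  (x j == y j) && (msk w a x == msk w a y).
Proof.
move=> ta; rewrite !mskP; apply/forallP/andP => [xy|[/eqP xyj /forallP xy] i].
  have /implyP := xy j; rewrite updE ta => /(_ isT) xyj; split=> //.
  apply/forallP => i; have [->|ij] := eqVneq i j; first by rewrite xyj implybT.
  by have := xy i; rewrite upd_neq.
have [->|ij] := eqVneq i j; first by rewrite xyj eqxx implybT.
by rewrite upd_neq.
Qed.

Lemma msk_upd_ge w j (t : 'I_N) a x y : (a <= t)%N ->
  (msk (upd w j t) a x == msk (upd w j t) a y) =
  (mskoff w j a x == mskoff w j a y).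
Proof.
move=> at_; rewrite mskP mskoffP; apply: eq_forallb => i.
have [->|ij] := eqVneq i j; first by rewrite updE ltnNge at_.
by rewrite upd_neq.
Qed.

Definition cavg X w a p (F : cube d -> R) := cellavg X (msk w a) (msk w a p) F.

Definition cavgoff X w j a p (F : cube d -> R) :=
  cellavg X (mskoff w j a) (mskoff w j a p) F.

Lemma cavg_upd_lt X w j (t : 'I_N) a p F : (t < a)%N ->
  cavg X (upd w j t) a p F = cavg (pinned X j p) w a p F.
Proof.
move=> ta; rewrite /cavg /cellavg /cellcnt big_filter_cond count_filter.
congr (_ / _%:R); first by apply: eq_bigl => x; rewrite msk_upd_lt.
by apply: eq_count => x /=; rewrite msk_upd_lt// andbC.
Qed.

Lemma cavg_upd_ge X w j (t : 'I_N) a p F : (a <= t)%N ->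
  cavg X (upd w j t) a p F = cavgoff X w j a p F.
Proof.
move=> at_; rewrite /cavg /cavgoff /cellavg /cellcnt.
congr (_ / _%:R); first by apply: eq_bigl => x; rewrite msk_upd_ge.
by apply: eq_count => x /=; rewrite msk_upd_ge.
Qed.

(** Given that [j] is sampled, the cell of [p] is its cell among the pinned points. These agree at
    [j], so their average does not depend on the label of [j], and the event contributes just its
    probability. *)
Lemma Ex_cavg_in X j a p F : (a <= N)%N -> (0 < N)%N ->
  Ex (fun w => (w j < a)%:R * cavg X w a p F) =
  a%:R / N%:R * Ex (fun w => cavg (pinned X j p) w a p F).
Proof.
move=> aN N0; rewrite (Ex_upd j) ?card_ord// -ExZ; apply: eq_Ex => w.
rewrite -(Ex_lt_ord _ aN) -ExZr; apply: eq_Ex => t; rewrite updE.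
by case: ltnP => [ta|_]; rewrite ?mul0r// cavg_upd_lt.
Qed.

(** Here [a'] is the threshold of the parent level, so [j] may be sampled for the child but not for
    the parent. The event [a' <= w j < a] is then traded for the likelier [a' <= w j], at the price
    [c]. *)
Lemma Ex_cavg_next X j a a' (c : R) p (F : cube d -> R) : (a' <= a <= N)%N -> (0 < N)%N ->
  (forall x, 0 <= F x) -> 0 <= c -> (a - a')%:R <= c * (N - a')%:R ->
  Ex (fun w => (w j < a)%:R * cavg X w a' p F) <=
  a'%:R / N%:R * Ex (fun w => cavg (pinned X j p) w a' p F)
  + c * Ex (fun w => cavg X w a' p F).
Proof.
move=> /andP[a'a aN] N0 F0 c0 ac; have a'N := leq_trans a'a aN.
rewrite (Ex_upd j) ?card_ord// [X in _ <= _ + c * X](Ex_upd j) ?card_ord//.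
rewrite -!ExZ -ExD; apply: le_Ex => w.
set Y := cavg (pinned X j p) w a' p F.
pose Z := cavgoff X w j a' p F.
have Z0 : 0 <= Z by exact: cellavg_ge0.
have Y0 : 0 <= Y by exact: cellavg_ge0.
have E t : cavg X (upd w j t) a' p F = (t < a')%:R * Y + (1 - (t < a')%:R) * Z.
  case: ltnP => ta; first by rewrite cavg_upd_lt// mul1r subrr mul0r addr0.
  by rewrite cavg_upd_ge// mul0r add0r subr0 mul1r.
have -> : Ex (fun t => (upd w j t j < a)%:R * cavg X (upd w j t) a' p F) =
    a'%:R / N%:R * Y + (a%:R / N%:R - a'%:R / N%:R) * Z.
  rewrite -(Ex_lt_ord _ aN) -(Ex_lt_ord _ a'N) -ExB -!ExZr -ExD.
  apply: eq_Ex => t; rewrite E updE; have [ta|ta] := ltnP t a'.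
    by rewrite (leq_trans ta a'a) !subrr !mul0r !mul1r.
  by rewrite !mul0r !add0r subr0 mul1r subr0.
have -> : Ex (fun t => cavg X (upd w j t) a' p F) =
    a'%:R / N%:R * Y + (1 - a'%:R / N%:R) * Z.
  rewrite -[X in (X - _) * Z](@Ex_cst _ 'I_N) ?card_ord//.
  by rewrite -(Ex_lt_ord _ a'N) -ExB -!ExZr -ExD; apply: eq_Ex => t; rewrite E.
rewrite lerD2l; have N0' : (0 : R) < N%:R by rewrite ltr0n.
rewrite -mulrBl -natrB// mulrDr.
apply: ler_wpDl; first by rewrite mulr_ge0// mulr_ge0// divr_ge0 ?ler0n.
rewrite [leRHS]mulrA ler_wpM2r// ler_pdivrMr// -mulrA mulrBl mul1r divfK ?gt_eqF//.
by rewrite -natrB.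
Qed.

Lemma Ex_cavg_root X j a p (F : cube d -> R) (c : R) : (a <= N)%N -> (0 < N)%N -> 0 <= c ->
  {in X, forall x, F x <= c} ->
  Ex (fun w => (w j < a)%:R * cavg X w 0 p F) <= a%:R / N%:R * c.
Proof.
move=> aN N0 c0 Fc; rewrite -(Ex_lt_ord _ aN).
rewrite -(@Ex_ffun1 _ 'I_d 'I_N j (fun t => (t < a)%:R)) ?card_ord//.
rewrite -ExZr; apply: le_Ex => w; rewrite ler_wpM2l ?ler0n//.
exact: cellavg_le_cst.
Qed.

End MaskExpectation.
End Masks.

(** * Mean distances in random cells *)

Section Elementary.
Variable R : realType.
Implicit Types x y z : R.

Lemma ln_sub1 x : 0 < x -> ln x <= x - 1.
Proof.
by move=> x0; have := @le_ln1Dx R (x - 1); rewrite subrKC; apply; lra.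
Qed.

Lemma ln_ge_1BV x : 0 < x -> 1 - x^-1 <= ln x.
Proof.
move=> x0; have := @ln_sub1 x^-1; rewrite invr_gt0 => /(_ x0).
by rewrite lnV ?posrE//; lra.
Qed.

Lemma expRN_lnV x : 0 < x -> expR (- ln x) = x^-1.
Proof. by move=> x0; rewrite expRN lnK. Qed.

Lemma pow1B_ge x n : 0 <= x <= 1 -> 1 - n%:R * x <= (1 - x) ^+ n.
Proof.
move=> /andP[x0 x1]; elim: n => [|n IHn]; first by rewrite expr0 mul0r subr0.
rewrite exprS -natr1 mulrDl mul1r.
have : 0 <= n%:R * x * x by rewrite !mulr_ge0.
have : (1 - x) * (1 - n%:R * x) <= (1 - x) * (1 - x) ^+ n.
  by rewrite ler_wpM2l// subr_ge0.
lra.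
Qed.

Lemma pow1B_le_expR x n : x <= 1 -> (1 - x) ^+ n <= expR (- (n%:R * x)).
Proof.
move=> x1; rewrite -mulrN expRM_natl lerXn2r ?nnegrE ?expR_ge0 ?subr_ge0//.
exact: expR_ge1Dx.
Qed.

Lemma le_expR_half x : x <= expR (x / 2).
Proof.
have [x0|/ltW x0] := leP x 0; first exact: le_trans x0 (expR_ge0 _).
have -> : x / 2 = x / 4 + x / 4 by lra.
rewrite expRD; have := expR_ge1Dx (x / 4); set e := expR _ => le_e.
have : (1 + x / 4) * (1 + x / 4) <= e * e by rewrite ler_pM//; lra.
have := sqr_ge0 (x / 4 - 1); rewrite expr2; lra.
Qed.

(** The exponent splits into x / 2, which absorbs the factor x, and two quarters: one supplies 4 /
    x, which makes sums over levels geometric, the other 1 / N, which pays for a sum over N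
    points. *)
Lemma mulexpRN_tail x N : 0 < x -> 1 <= N -> 4 * ln N <= x ->
  x * expR (- x) <= 4 / x / N.
Proof.
move=> x0 N1 xN; have N0 : 0 < N by lra.
have -> : - x = - (x / 2) - x / 4 - x / 4 by lra.
rewrite !expRD !mulrA -[leRHS]mul1r -[4 / x / N]mulrA mulrA -!mulrA.
have : x * expR (- (x / 2)) <= 1.
  by rewrite expRN ler_pdivrMr ?expR_gt0// mul1r le_expR_half.
have : expR (- (x / 4)) <= 4 / x.
  rewrite expRN -[4 / x]invf_div lef_pV2 ?posrE ?expR_gt0 ?divr_gt0//.
  by have := expR_ge1Dx (x / 4); lra.
have : expR (- (x / 4)) <= N^-1.
  by rewrite -(expRN_lnV N0) ler_expR; lra.
move=> h1 h2 h3; rewrite mulrA ler_pM ?mulr_ge0 ?expR_ge0 ?(ltW x0)//.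
by rewrite [leRHS]mulrA ler_pM ?expR_ge0.
Qed.

Lemma mulexpRN_decr x y : 1 <= y -> y <= x ->
  x * expR (- x) <= y * expR (- y).
Proof.
move=> y1 yx; rewrite !expRN ler_pdivrMr ?expR_gt0// mulrAC ler_pdivlMr ?expR_gt0//.
have {2}-> : x = y + (x - y) by lra.
rewrite expRD mulrCA [_ * expR y]mulrC ler_wpM2l ?expR_ge0//.
have := expR_ge1Dx (x - y); have : 0 <= (y - 1) * (x - y) by rewrite mulr_ge0//; lra.
move=> h1 h2; have : y * (1 + (x - y)) <= y * expR (x - y) by rewrite ler_wpM2l//; lra.
nra.
Qed.

(** At the cutoff [tau] the decay [expR (- tau)] compensates the population ratio [rho]. There is no
    additive constant: near rho = 1 both summands are small through rho - 1. *)
Lemma mid_bound (rho tau : R) : 1 <= rho -> tau = 1 + ln rho ->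
  tau * Num.min 1 (2 * (rho - 1)) + 2 * (rho - 1) * (tau * expR (- tau))
    <= 10 * ln rho.
Proof.
move=> rho1 tauE; have rho0 : 0 < rho by lra.
have L0 : 0 <= ln rho by rewrite ln_ge0.
have e2 : expR (- tau) <= rho^-1 / 2.
  rewrite tauE opprD expRD expRN_lnV// mulrC ler_wpM2l ?invr_ge0 ?(ltW rho0)//.
  by rewrite expRN lef_pV2 ?posrE ?expR_gt0//; have := expR_ge1Dx (1 : R); lra.
have Lge := ln_ge_1BV rho0; have Vle : rho^-1 <= 1 by rewrite invf_le1.
have V0 : 0 < rho^-1 by rewrite invr_gt0.
have rV : rho * rho^-1 = 1 by rewrite mulfV ?gt_eqF.
have tau0 : 0 <= tau by lra.
have second : 2 * (rho - 1) * (tau * expR (- tau)) <= tau * (1 - rho^-1).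
  apply: le_trans (_ : 2 * (rho - 1) * (tau * (rho^-1 / 2)) <= _).
    by rewrite !ler_wpM2l//; lra.
  by rewrite le_eqVlt; apply/orP; left; apply/eqP;
     rewrite -[X in _ = tau * (X - _)]rV; field; rewrite gt_eqF.
have second' : tau * (1 - rho^-1) <= 2 * ln rho.
  rewrite tauE; have [Ll|Lg] := leP (ln rho) 1.
    by have : (1 + ln rho) * (1 - rho^-1) <= 2 * ln rho; [rewrite ler_pM//; lra|].
  by have : (1 + ln rho) * (1 - rho^-1) <= (1 + ln rho) * 1;
    [rewrite ler_wpM2l//; lra|lra].
have first : tau * Num.min 1 (2 * (rho - 1)) <= 8 * ln rho.
  have [r2|r2] := leP rho 2.
    have Lle1 : ln rho <= 1 by have := ln_sub1 rho0; lra.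
    apply: le_trans (_ : 2 * (4 * ln rho) <= _); last by lra.
    rewrite ler_pM//; [by rewrite le_min; lra|by lra|].
    rewrite ge_min; apply/orP; right.
    have : rho * (1 - rho^-1) <= 2 * ln rho by rewrite ler_pM//; lra.
    by rewrite mulrBr rV; lra.
  apply: le_trans (_ : tau * 1 <= _); first by rewrite ler_wpM2l// ge_min lexx.
  have : rho^-1 <= 2^-1 by rewrite lef_pV2 ?posrE//; lra.
  lra.
lra.
Qed.

End Elementary.

Section ElementarySums.
Variable R : realType.

Lemma geometric_tail (c n : nat) :
  \sum_(k < n | (c <= 2 ^ k)%N) c%:R / 2%:R ^+ k <= 2 :> R.
Proof.
(* Keeping track of the unspent tail of the series makes the bound inductive. *)
suff : \sum_(k < n | (c <= 2 ^ k)%N) c%:R / 2%:R ^+ k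
    <= Num.max 0 (2 - 2 * (c%:R / 2%:R ^+ n)) :> R.
  move=> /le_trans; apply; rewrite ge_max ler0n/= gerBl.
  by rewrite mulr_ge0// divr_ge0.
elim: n => [|n IHn]; first by rewrite big_ord0 le_max lexx.
have p0 m : (0 : R) < 2%:R ^+ m by rewrite exprn_gt0.
have -> : c%:R / 2%:R ^+ n.+1 = c%:R / 2%:R ^+ n / 2 :> R.
  by rewrite exprS invfM; lra.
rewrite big_mkcond big_ord_recr -big_mkcond/=.
move: IHn; rewrite -natrX; case: leqP => [cn|nc].
  have : c%:R / (2 ^ n)%:R <= 1 :> R by rewrite ler_pdivrMr ?ltr0n ?expn_gt0// mul1r ler_nat.
  set y := c%:R / _ => y1; set S := \sum_(i < n | _) _.
  rewrite !le_max; have -> : (S <= 2 - 2 * y) = (S <= 2 - 2 * y) by [].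
  move=> /orP[S0|Sy]; apply/orP; right; lra.
move=> _; rewrite addr0 big1 ?le_max ?lexx// => k; rewrite leqNgt => /negP[].
by rewrite (leq_ltn_trans _ nc)// leq_exp2l// ltnW.
Qed.

Lemma geometric_head (F t n : nat) :
  \sum_(k < n | (2 ^ k * F < t)%N) 2%:R ^+ k * F%:R <= 2 * t%:R :> R.
Proof.
suff : \sum_(k < n | (2 ^ k * F < t)%N) 2%:R ^+ k * F%:R
    <= Num.min (2 * t%:R) (2%:R ^+ n * F%:R) :> R.
  by move=> /le_trans; apply; rewrite ge_min lexx.
elim: n => [|n]; first by rewrite big_ord0 le_min !mulr_ge0// ler0n.
rewrite !le_min => /andP[].
have -> : \sum_(k < n.+1 | (2 ^ k * F < t)%N) 2%:R ^+ k * F%:R =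
    \sum_(k < n | (2 ^ k * F < t)%N) 2%:R ^+ k * F%:R
    + (if (2 ^ n * F < t)%N then 2%:R ^+ n * F%:R else 0) :> R.
  by rewrite big_mkcond big_ord_recr -big_mkcond.
rewrite exprS.
have p0 : (0 : R) <= 2%:R ^+ n * F%:R by rewrite mulr_ge0// exprn_ge0.
set S := \sum_(i < n | _) _; case: ltnP => [tn h1 h2|_ h1 h2].
  have : (2 ^ n * F)%:R <= t%:R :> R by rewrite ler_nat ltnW.
  by rewrite natrM natrX => h; apply/andP; split; lra.
by rewrite addr0 h1; lra.
Qed.

(** Each unit of the shift gives one telescoping sum, worth at most [M]. *)
Lemma telescope_shift (g : nat -> R) (M : R) m n :
  (forall i, 0 <= g i <= M) -> \sum_(k < n) (g (k + m)%N - g k) <= m%:R * M.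
Proof.
move=> gM; elim: m => [|m IHm].
  by rewrite mul0r big1// => k _; rewrite addn0 subrr.
rewrite -natr1 mulrDl mul1r.
have -> : \sum_(k < n) (g (k + m.+1)%N - g k) =
    \sum_(k < n) (g (k + m)%N - g k) + (g (n + m)%N - g m).
  elim: n {IHm} => [|n IHn]; first by rewrite !big_ord0 add0n subrr addr0.
  by rewrite !big_ord_recr /= IHn addSn addnS; ring.
rewrite lerD//; have /andP[_] := gM (n + m)%N; have /andP[+ _] := gM m.
lra.
Qed.

(** In decreasing order the head has rank equal to the length of the list, and ties only increase
    ranks, so the sum is at most a harmonic sum. *)
Lemma harmonic_rank (s : seq nat) : (0 < size s)%N ->
  \sum_(x <- s) (count (fun y => (y <= x)%N) s)%:R^-1 <= 1 + ln (size s)%:R :> R.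
Proof.
have -> : \sum_(x <- s) (count (fun y => (y <= x)%N) s)%:R^-1 =
    \sum_(x <- sort geq s) (count (fun y => (y <= x)%N) (sort geq s))%:R^-1 :> R.
  rewrite (perm_big (sort geq s)) ?perm_sort 1?perm_sym ?perm_sort//=.
  by apply: eq_bigr => x _; congr (_%:R^-1); apply/esym/permP; rewrite perm_sort.
rewrite -(size_sort geq); have : sorted geq (sort geq s).
  by apply: sort_sorted => x y; exact: leq_total.
elim: (sort geq s) => {s} // m s IHs ms _.
have ss : sorted geq s := path_sorted ms.
have ge_m : {in s, forall x, (x <= m)%N}.
  by apply/allP; apply: order_path_min ms => x y z /= h1 h2; exact: leq_trans h2 h1.
rewrite big_cons /= leqnn.
have -> : count (fun y => (y <= m)%N) s = size s.
  by apply/eqP; rewrite -all_count; apply/allP.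
rewrite add1n; have [/size0nil->|s0] := posnP (size s).
  by rewrite big_nil ln1 invr1 !addr0.
have le1 : \sum_(x <- s) ((m <= x)%N + count (fun y => (y <= x)%N) s)%:R^-1 <=
    \sum_(x <- s) (count (fun y => (y <= x)%N) s)%:R^-1 :> R.
  rewrite big_seq [leRHS]big_seq; apply: ler_sum => x xs.
  have c0 : (0 < count (fun y => (y <= x)%N) s)%N.
    by rewrite -has_count; apply/hasP; exists x.
  by rewrite lef_pV2 ?posrE ?ltr0n ?addn_gt0 ?c0 ?orbT// ler_nat leq_addl.
apply: le_trans (lerD (lexx _) (le_trans le1 (IHs ss s0))) _.
have n0 : (0 : R) < (size s)%:R by rewrite ltr0n.
have lnS : ln (size s).+1%:R =
    ln (size s)%:R + ln ((size s).+1%:R / (size s)%:R) :> R.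
  by rewrite -lnM ?posrE ?divr_gt0// mulrC divfK// gt_eqF.
rewrite lnS.
have := @ln_ge_1BV R ((size s).+1%:R / (size s)%:R); rewrite divr_gt0//= => /(_ isT).
rewrite invf_div; have -> : 1 - (size s)%:R / (size s).+1%:R = (size s).+1%:R^-1 :> R.
  by rewrite -[X in X - _](@mulfV _ (size s).+1%:R) ?pnatr_eq0// -mulrBl -natrB// subSnn mul1r.
set a := _^-1; set l := ln (_ / _); set u := ln _; lra.
Qed.

End ElementarySums.

(** * Averages over a random subset, split by distance *)

Section AverageBound.
Variables (R : realType) (S : eqType) (X : seq S) (al : pred S) (p : S).
Variables (y : S -> R) (B tau : R).
Hypotheses (pX : p \in X) (alp : al p) (yp : y p = 0).
Hypotheses (y0 : forall x, 0 <= y x) (B1 : 1 <= B) (tau1 : 1 <= tau).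

Let near x := B * y x <= 1.
Let far x := B < y x.
Let a x : R := (al x)%:R.
Let n1 : R := (count near X)%:R.
Let n2 : R := (count (fun x => ~~ far x) X)%:R.

Let countE (P : pred S) : (count P X)%:R = \sum_(x <- X | P x) 1 :> R.
Proof. by rewrite -sum1_count natr_sum. Qed.

Let a01 x : 0 <= a x <= 1.
Proof. by rewrite /a; case: (al x); rewrite !lexx ler01. Qed.

Let sum_sub_ge0 (P : pred S) (f : S -> R) : (forall x, 0 <= f x) ->
  0 <= \sum_(x <- X | P x) f x.
Proof. by move=> f0; rewrite sumr_ge0. Qed.

Let le_sum_pred (P Q : pred S) (f : S -> R) : (forall x, 0 <= f x) ->
  (forall x, P x -> Q x) ->
  \sum_(x <- X | P x) f x <= \sum_(x <- X | Q x) f x.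
Proof.
move=> f0 PQ; rewrite big_mkcond [leRHS]big_mkcond; apply: ler_sum => x _.
by case: (boolP (P x)) => [/PQ->//|_]; case: ifP.
Qed.

Let recombine (f n h l f' n' h' l' e : R) :
  f <= f' -> n <= n' -> h <= h' -> l <= l' -> 0 <= e ->
  f + (n + (h + l)) <= f' + n' + e + l' + h'.
Proof. lra. Qed.

Let near_far x : near x -> ~~ far x.
Proof. rewrite /near /far -leNgt => h; have : y x <= B * y x by rewrite ler_peMl.
by move=> /le_trans-> //; rewrite (le_trans h). Qed.

(** The random set [al] also occurs in the denominator. If at least half of the near points survive,
    the denominator is at least n1 / 2; otherwise the points that are not far average to at most B,
    which is charged to the lost near points. The result is linear in the indicators of survival, so
    expectations can be taken termwise. *)
Lemma average_bound :
  (\sum_(x <- X | al x) y x) / (count al X)%:R <=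
  \sum_(x <- X | far x) y x * a x
  + 2 / n1 * \sum_(x <- X | near x) y x
  + B * (2 / n1 * \sum_(x <- X | near x) (1 - a x))
  + tau * Num.min 1 (2 * (n2 / n1 - 1))
  + 2 / n1 * \sum_(x <- X | [&& ~~ near x, ~~ far x & tau < y x]) y x * a x.
Proof.
have ya0 x : 0 <= y x * a x by rewrite mulr_ge0//; have /andP[] := a01 x.
have B0 : 0 <= B := le_trans ler01 B1.
have tau0 : 0 <= tau := le_trans ler01 tau1.
have a0 x : 0 <= a x by have /andP[] := a01 x.
have AE : (count al X)%:R = \sum_(x <- X) a x.
  by rewrite countE big_mkcond; apply: eq_bigr => x _; rewrite /a; case: (al x).
have A1 : 1 <= (count al X)%:R :> R.
  by rewrite (ler_nat _ 1) -has_count; apply/hasP; exists p.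
have n1_ge1 : 1 <= n1.
  rewrite (ler_nat _ 1) -has_count; apply/hasP; exists p => //.
  by rewrite /near yp mulr0.
have n12 : n1 <= n2.
  by rewrite /n1 /n2 !countE; apply: le_sum_pred => // x /near_far.
set A : R := (count al X)%:R in A1 AE *.
set Sf := \sum_(x <- X | far x) _; set Yn := \sum_(x <- X | near x) y x.
set Dn := \sum_(x <- X | near x) (1 - a x).
set Sh := \sum_(x <- X | [&& _, _ & _]) _.
pose Sn := \sum_(x <- X | near x) y x * a x.
pose low x := [&& ~~ near x, ~~ far x & ~~ (tau < y x)].
pose Sl := \sum_(x <- X | low x) y x * a x.
pose Na := \sum_(x <- X | near x) a x.
have sumE (f : S -> R) : \sum_(x <- X | ~~ far x) f x =
    \sum_(x <- X | near x) f x
    + (\sum_(x <- X | [&& ~~ near x, ~~ far x & tau < y x]) f x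
       + \sum_(x <- X | low x) f x).
  rewrite (bigID near) /=; congr (_ + _).
    by apply: eq_bigl => x; case: (boolP (near x)) => [/near_far->|]; rewrite ?andbF.
  rewrite (bigID (fun x => tau < y x)) /=; congr (_ + _).
    by apply: eq_bigl => x; rewrite andbA [_ && ~~ near x]andbC.
  by apply: eq_bigl => x; rewrite /low andbA [_ && ~~ near x]andbC.
have totE : \sum_(x <- X | al x) y x = Sf + (Sn + (Sh + Sl)).
  rewrite /Sn /Sh /Sl -sumE /Sf big_mkcond.
  transitivity (\sum_(x <- X) y x * a x); last by rewrite (bigID far).
  by apply: eq_bigr => x _; rewrite /a; case: (al x); rewrite ?mulr1 ?mulr0.
have Sf0 : 0 <= Sf by exact: sum_sub_ge0.
have Sn0 : 0 <= Sn by exact: sum_sub_ge0.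
have Sh0 : 0 <= Sh by exact: sum_sub_ge0.
have Sl0 : 0 <= Sl by exact: sum_sub_ge0.
have Yn0 : 0 <= Yn by exact: sum_sub_ge0.
have Dn0 : 0 <= Dn by apply: sum_sub_ge0 => x; have /andP[] := a01 x; rewrite subr_ge0.
have SnYn : Sn <= Yn.
  by apply: ler_sum => x _; have /andP[_ ax] := a01 x; rewrite ler_piMr.
have DnE : Dn = n1 - Na by rewrite /Dn sumrB /n1 countE.
have NaA : Na <= A by rewrite AE; apply: le_sum_pred.
have iA0 : 0 < A^-1 by rewrite invr_gt0; lra.
have iA1 : A^-1 <= 1 by rewrite invf_le1//; lra.
have AV : A * A^-1 = 1 by rewrite mulfV//; apply/eqP; lra.
have in0 : 0 < n1^-1 by rewrite invr_gt0; lra.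
have nV : n1 * n1^-1 = 1 by rewrite mulfV//; apply/eqP; lra.
have min0 : 0 <= Num.min 1 (2 * (n2 / n1 - 1)).
  rewrite le_min ler01 mulr_ge0// subr_ge0 -nV.
  by rewrite ler_wpM2r// ltW.
have Sf_le : Sf * A^-1 <= Sf by rewrite ler_piMr.
rewrite totE (mulrDl Sf (Sn + (Sh + Sl)) A^-1).
have [G|nG] := leP n1 (2 * Na).
  have iA_le : A^-1 <= 2 / n1.
    have An : n1 <= 2 * A by lra.
    have : n1 * (A^-1 * n1^-1) <= 2 * A * (A^-1 * n1^-1).
      by rewrite ler_wpM2r// mulr_ge0// ltW.
    have -> : n1 * (A^-1 * n1^-1) = A^-1 by rewrite mulrCA nV mulr1.
    by have -> : 2 * A * (A^-1 * n1^-1) = 2 / n1 by rewrite mulrA -(mulrA 2) AV mulr1.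
  have h1 : Sn * A^-1 <= 2 / n1 * Yn.
    by rewrite [leRHS]mulrC ler_pM// ltW.
  have h2 : Sh * A^-1 <= 2 / n1 * Sh by rewrite mulrC ler_wpM2r.
  (* Points of the middle range up to [tau] are counted in two ways: as a share of the surviving
     points, at most 1, and by number, at most n2 - n1. *)
  have h3 : Sl * A^-1 <= tau * Num.min 1 (2 * (n2 / n1 - 1)).
    pose M := \sum_(x <- X | low x) a x.
    have M0 : 0 <= M by exact: sum_sub_ge0.
    have SlM : Sl <= tau * M.
      rewrite /Sl /M mulr_sumr; apply: ler_sum => x /and3P[_ _]; rewrite -leNgt.
      by move=> yt; rewrite ler_wpM2r.
    have MA : M <= A by rewrite AE; apply: le_sum_pred.
    have Mn : M <= n2 - n1.
      have : M <= \sum_(x <- X | low x) 1.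
        by apply: ler_sum => x _; have /andP[] := a01 x.
      rewrite /n2 countE sumE /n1 countE.
      have := sum_sub_ge0 [pred x | [&& ~~ near x, ~~ far x & tau < y x]] (fun _ => ler01).
      by rewrite /=; lra.
    apply: le_trans (_ : tau * (M * A^-1) <= _).
      by rewrite mulrA ler_wpM2r// ltW.
    rewrite ler_wpM2l//.
    rewrite le_min; apply/andP; split.
      by rewrite -AV ler_wpM2r// ltW.
    apply: le_trans (_ : (n2 - n1) * (2 / n1) <= _).
      by rewrite ler_pM// ltW.
    by rewrite le_eqVlt; apply/orP; left; apply/eqP; field; lra.
  have h4 : 0 <= B * (2 / n1 * Dn).
    by rewrite mulr_ge0// mulr_ge0// divr_ge0//; lra.
  by rewrite (mulrDl Sn (Sh + Sl) A^-1) (mulrDl Sh Sl A^-1); apply: recombine.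
have rest : (Sn + (Sh + Sl)) * A^-1 <= B.
  rewrite /Sn /Sh /Sl -sumE.
  apply: le_trans (_ : B * A * A^-1 <= _); last by rewrite -mulrA AV mulr1.
  rewrite ler_wpM2r ?(ltW iA0)// AE mulr_sumr.
  apply: le_trans (_ : \sum_(x <- X | ~~ far x) B * a x <= _).
    by apply: ler_sum => x; rewrite /far -leNgt => yB; rewrite ler_wpM2r.
  by apply: le_sum_pred => // x; rewrite mulr_ge0.
have h4 : B <= B * (2 / n1 * Dn).
  rewrite ler_peMr//.
  by rewrite DnE mulrAC ler_pdivlMr; lra.
have h5 : 0 <= tau * Num.min 1 (2 * (n2 / n1 - 1)) by rewrite mulr_ge0.
have h6 : 0 <= 2 / n1 * Sh by rewrite !mulr_ge0// ltW.
have h7 : 0 <= 2 / n1 * Yn by rewrite !mulr_ge0// ltW.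
rewrite -!addrA lerD// -[leLHS]add0r lerD// -[leLHS]addr0.
by rewrite lerD ?addr_ge0// (le_trans rest).
Qed.

End AverageBound.

Section QuadtreeRadius.
Variables (R : realType) (d T : nat).
Implicit Types (X : seq (cube d)) (p x : cube d).

(** Truncated division gives 0 at level T + 1, which thus is the root, with no sampled
    coordinate. *)
Definition thr k : nat := (2 ^ T %/ 2 ^ k)%N.

Lemma thr_le k : (thr k <= 2 ^ T)%N. Proof. exact: leq_div. Qed.

Lemma thr_anti k l : (k <= l)%N -> (thr l <= thr k)%N.
Proof. by move=> kl; rewrite /thr leq_div2l ?expn_gt0// leq_exp2l. Qed.

Lemma thr0 : thr 0 = (2 ^ T)%N. Proof. by rewrite /thr divn1. Qed.

Lemma thr_top : thr T.+1 = 0%N.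
Proof. by rewrite /thr divn_small// ltn_exp2l. Qed.

Lemma thrE k : (k <= T)%N -> thr k = (2 ^ (T - k))%N.
Proof. by move=> kT; rewrite /thr -expnB. Qed.

Lemma thr_rate k : (k <= T)%N -> (thr k)%:R / (2 ^ T)%:R = (2%:R ^+ k)^-1 :> R.
Proof.
move=> kT; rewrite thrE// -[in (2 ^ T)%N](subnK kT) expnD natrM invfM mulrA.
by rewrite mulfV ?mul1r ?natrX// pnatr_eq0 expn_eq0.
Qed.

Let p2_gt0 k : (0 : R) < 2%:R ^+ k. Proof. by rewrite exprn_gt0. Qed.

Definition survival k x p : R := (1 - (2%:R ^+ k)^-1) ^+ hamming x p.

Let rate_le1 k : ((2%:R ^+ k)^-1 : R) <= 1.
Proof. by rewrite invf_le1// exprn_ege1// ler1n. Qed.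

Let rate_ge0 k : (0 : R) <= (2%:R ^+ k)^-1.
Proof. by rewrite invr_ge0 ltW. Qed.

Lemma Ex_survival k x p : (k <= T)%N ->
  Ex (fun w : {ffun 'I_d -> 'I_(2 ^ T)} =>
    (msk w (thr k) x == msk w (thr k) p)%:R) = survival k x p.
Proof. by move=> kT; rewrite Ex_msk_eq ?thr_le ?expn_gt0// thr_rate. Qed.

Let survival_le_exp k x p :
  survival k x p <= expR (- ((hamming x p)%:R / 2%:R ^+ k)).
Proof. exact: pow1B_le_expR. Qed.

(** At distance t the rescaled distance y = t / 2^k exceeds 2^f, so [mulexpRN_tail] gives 4 / (y N).
    Over the levels with 2^(k + f) < t this sums geometrically to at most 8 / (2^f N), and 1 / N
    pays for the sum over [X]. *)
Lemma far_sum X p f n : (0 < size X)%N -> 4 * ln (size X)%:R <= (2 ^+ f : R) ->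
  \sum_(k < n) \sum_(x <- X | (2 ^ k * 2 ^ f < hamming x p)%N)
    (hamming x p)%:R / 2%:R ^+ k * survival k x p <= 8 / 2 ^+ f :> R.
Proof.
move=> X0 lnX; set N : R := (size X)%:R in lnX *.
have N1 : 1 <= N by rewrite (ler_nat _ 1).
have F0 : (0 : R) < 2 ^+ f by rewrite exprn_gt0.
rewrite (exchange_big_dep xpredT)//=.
apply: le_trans (_ : \sum_(x <- X) 8 / 2 ^+ f / N <= _); last first.
  rewrite big_const_seq count_predT iter_addr_0 -[_ *+ _]mulr_natr divfK//.
  by rewrite gt_eqF//; lra.
apply: ler_sum => x _; set t := hamming x p.
have [t0|t0] := posnP t.
  rewrite big_pred0 ?divr_ge0 ?ltW//; first by lra.
  by move=> k; rewrite t0 ltn0.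
have t0' : (0 : R) < t%:R by rewrite ltr0n.
apply: le_trans (_ : \sum_(k < n | (2 ^ k * 2 ^ f < t)%N)
    (2%:R ^+ k * (2 ^ f)%:R) * (4 / (t%:R * 2 ^+ f) / N) <= _).
  apply: ler_sum => k kt; set y : R := t%:R / 2%:R ^+ k.
  have y0 : 0 < y by rewrite divr_gt0.
  have yF : 2 ^+ f <= y.
    rewrite ler_pdivlMr// mulrC -!natrX -natrM ler_nat.
    by rewrite ltnW.
  apply: le_trans (_ : 4 / y / N <= _).
    apply: le_trans (mulexpRN_tail y0 N1 _); last exact: le_trans lnX yF.
    by rewrite ler_wpM2l ?(ltW y0)// survival_le_exp.
  rewrite le_eqVlt; apply/orP; left; apply/eqP; rewrite /y natrX; field.
  by rewrite ?gt_eqF//; lra.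
rewrite -mulr_suml.
apply: le_trans (ler_wpM2r _ (geometric_head R (2 ^ f) t n)) _.
  by rewrite !divr_ge0 ?mulr_ge0 ?ltW//; lra.
rewrite le_eqVlt; apply/orP; left; apply/eqP; field.
by rewrite ?gt_eqF//; lra.
Qed.

Definition near_count X p b i : nat :=
  count (fun x => (hamming x p * 2 ^ b <= 2 ^ i)%N) X.

Lemma near_count_ge1 X p b i : p \in X -> (0 < near_count X p b i)%N.
Proof.
by move=> pX; rewrite -has_count; apply/hasP; exists p; rewrite ?hammingxx.
Qed.

Let nearE k b x p : (2 ^+ b * ((hamming x p)%:R / 2%:R ^+ k) <= 1 :> R) =
  (hamming x p * 2 ^ b <= 2 ^ k)%N.
Proof. by rewrite mulrA ler_pdivrMr// mul1r mulrC -!natrX -natrM ler_nat. Qed.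

Let farE k b x p : (2 ^+ b < (hamming x p)%:R / 2%:R ^+ k :> R) =
  (2 ^ k * 2 ^ b < hamming x p)%N.
Proof. by rewrite ltr_pdivlMr// mulrC -!natrX -natrM ltr_nat. Qed.

(** This is [average_bound] with distances in units of 2^k and B = 2^b. A point within 2^(k + b) is
    one that is near at level k + 2 b, so the ratio in [mid_bound] compares near populations 2 b
    levels apart. *)
Lemma level_radius X p b k : p \in X -> (k <= T)%N ->
  (2%:R ^+ k)^-1 * Ex (fun w : {ffun 'I_d -> 'I_(2 ^ T)} =>
     cavg X w (thr k) p (fun x => (hamming x p)%:R)) <=
  \sum_(x <- X | (2 ^ k * 2 ^ b < hamming x p)%N)
    (hamming x p)%:R / 2%:R ^+ k * survival k x p
  + 2 * (1 + 2 ^+ b) * \sum_(x <- X | (hamming x p * 2 ^ b <= 2 ^ k)%N)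
      (hamming x p)%:R / 2%:R ^+ k / (near_count X p b k)%:R
  + 10 * (ln (near_count X p b (k + 2 * b))%:R - ln (near_count X p b k)%:R)
  :> R.
Proof.
move=> pX kT.
pose y x : R := (hamming x p)%:R / 2%:R ^+ k.
pose B : R := 2 ^+ b.
have B1 : 1 <= B by rewrite exprn_ege1// ler1n.
have y0 x : 0 <= y x by rewrite divr_ge0 ?ler0n ?(ltW (p2_gt0 _)).
have yp : y p = 0 by rewrite /y hammingxx mul0r.
set n1 : R := (near_count X p b k)%:R.
set n2 : R := (near_count X p b (k + 2 * b))%:R.
have n1E : (count (fun x => B * y x <= 1) X)%:R = n1.
  by congr _%:R; apply: eq_count => x; rewrite nearE.
have n2E : (count (fun x => ~~ (B < y x)) X)%:R = n2.
  congr _%:R; apply: eq_count => x /=; rewrite farE -leqNgt.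
  by rewrite mul2n -addnn !expnD !mulnA leq_pmul2r ?expn_gt0.
have n1_ge1 : 1 <= n1 by rewrite (ler_nat _ 1) near_count_ge1.
have n12 : n1 <= n2.
  rewrite ler_nat; apply: sub_count => x /=; move/leq_trans; apply.
  by rewrite leq_exp2l// leq_addr.
have n1_gt0 : 0 < n1 by lra.
have rho1 : 1 <= n2 / n1 by rewrite ler_pdivlMr// mul1r.
pose tau : R := 1 + ln (n2 / n1).
have tau1 : 1 <= tau by rewrite lerDl ln_ge0.
pose al (w : {ffun 'I_d -> 'I_(2 ^ T)}) x := msk w (thr k) x == msk w (thr k) p.
have bound w := @average_bound R _ X (al w) p y B tau pX (eqxx _) yp y0 B1 tau1.
rewrite -ExZ.
apply: le_trans (le_Ex (_ : forall w, _ <= _)) _.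
- move=> w; rewrite [leLHS](_ : _ =
    (\sum_(x <- X | al w x) y x) / (count (al w) X)%:R); first exact: bound w.
  by rewrite /cavg /cellavg mulrA mulr_sumr; congr (_ / _);
     apply: eq_bigr => x _; rewrite mulrC.
rewrite n1E n2E !ExD !Ex_cst ?card_ffun ?card_ord ?expn_gt0//.
rewrite !ExZ !Ex_sum.
have sE c x : Ex (fun w => c * (al w x)%:R) = c * survival k x p.
  by rewrite ExZ Ex_survival.
under eq_bigr => x _ do rewrite sE.
under [X in _ + B * (_ * X) + _]eq_bigr => x _ do
  rewrite ExB Ex_cst ?card_ffun ?card_ord ?expn_gt0// Ex_survival//.
under [X in _ + _ / _ * X <= _]eq_bigr => x _ do rewrite sE.
have -> : \sum_(x <- X | B < y x) y x * survival k x p =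
    \sum_(x <- X | (2 ^ k * 2 ^ b < hamming x p)%N)
      (hamming x p)%:R / 2%:R ^+ k * survival k x p.
  by apply: eq_bigl => x; rewrite farE.
have -> : \sum_(x <- X | (hamming x p * 2 ^ b <= 2 ^ k)%N)
      (hamming x p)%:R / 2%:R ^+ k / n1 = (\sum_(x <- X | B * y x <= 1) y x) / n1.
  by rewrite mulr_suml; apply: eq_bigl => x; rewrite nearE.
set Sn := \sum_(x <- X | B * y x <= 1) y x.
have Dle : \sum_(x <- X | B * y x <= 1) (1 - survival k x p) <= Sn.
  apply: ler_sum => x _; rewrite lerBlDl -lerBlDr; apply: pow1B_ge.
  by rewrite rate_ge0 rate_le1.
have Hle : \sum_(x <- X | [&& ~~ (B * y x <= 1), ~~ (B < y x) & tau < y x])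
    y x * survival k x p <= (n2 - n1) * (tau * expR (- tau)).
  apply: le_trans (_ : \sum_(x <- X | ~~ (B * y x <= 1) && ~~ (B < y x))
    tau * expR (- tau) <= _).
    rewrite big_mkcond [leRHS]big_mkcond; apply: ler_sum => x _.
    have te0 : 0 <= tau * expR (- tau) by rewrite mulr_ge0 ?expR_ge0//; lra.
    case: (~~ _) => //=; case: (~~ _) => //=; case: ltP => // ty.
    apply: le_trans (mulexpRN_decr tau1 (ltW ty)).
    by rewrite ler_wpM2l// survival_le_exp.
  rewrite big_const_seq iter_addr_0 -[_ *+ _]mulr_natl ler_wpM2r//.
    by rewrite mulr_ge0 ?expR_ge0//; lra.
  rewrite -n1E -n2E lerBrDr -natrD ler_nat -count_predUI.
  rewrite [X in (_ + X)%N](_ : _ = 0%N) ?addn0; last first.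
    rewrite (eq_count (a2 := pred0)) ?count_pred0// => x /=.
    by case: (B * y x <= 1); rewrite ?andbF.
  apply: sub_count => x /= /orP[/andP[]//|yx]; rewrite -leNgt.
  have yB : y x <= B * y x by rewrite ler_peMl.
  by rewrite (le_trans yB)// (le_trans yx).
have mid := mid_bound rho1 (erefl tau).
rewrite -ln_div ?posrE ?(lt_le_trans n1_gt0 n12)//.
have in0 : 0 < 2 / n1 by rewrite divr_gt0.
have Dle' : B * (2 / n1 * \sum_(x <- X | B * y x <= 1) (1 - survival k x p))
    <= B * (2 / n1 * Sn).
  by rewrite !ler_wpM2l// ?(ltW in0)//; lra.
have Hle' := ler_wpM2l (ltW in0) Hle.
have HE : 2 / n1 * ((n2 - n1) * (tau * expR (- tau))) =
    2 * (n2 / n1 - 1) * (tau * expR (- tau)) by field; rewrite gt_eqF.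
have SE : 2 * (1 + B) * (Sn / n1) = 2 / n1 * Sn + B * (2 / n1 * Sn).
  by field; rewrite gt_eqF.
rewrite HE in Hle'; rewrite SE -!addrA lerD2l lerD2l lerD//.
by apply: le_trans (lerD (lexx _) Hle') mid.
Qed.

(** For fixed [x] the levels at which it is near give a geometric sum of order 1 / B, which cancels
    the factor 1 + B. The near population is at least the distance rank of [x], so the sum over [x]
    is harmonic. *)
Lemma near_sum X p b n : p \in X ->
  \sum_(k < n) 2 * (1 + 2 ^+ b) *
    (\sum_(x <- X | (hamming x p * 2 ^ b <= 2 ^ k)%N)
      (hamming x p)%:R / 2%:R ^+ k / (near_count X p b k)%:R)
  <= 8 * (1 + ln (size X)%:R) :> R.
Proof.
move=> pX; pose B : R := 2 ^+ b.
have B1 : 1 <= B by rewrite exprn_ege1// ler1n.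
pose rk x := count (fun z => (hamming z p <= hamming x p)%N) X.
have rk0 x : x \in X -> (0 < rk x)%N.
  by move=> xX; rewrite -has_count; apply/hasP; exists x.
have X0 : (0 < size X)%N by case: (X) pX.
rewrite -mulr_sumr (exchange_big_dep xpredT)//=.
apply: le_trans (_ : 2 * (1 + B) * (\sum_(x <- X) 2 / B * (rk x)%:R^-1) <= _).
  rewrite ler_wpM2l//.
  rewrite big_seq [leRHS]big_seq; apply: ler_sum => x xX.
  apply: le_trans (_ : (\sum_(k < n | (hamming x p * 2 ^ b <= 2 ^ k)%N)
     (hamming x p * 2 ^ b)%:R / 2%:R ^+ k) * (B^-1 * (rk x)%:R^-1) <= _).
    rewrite mulr_suml; apply: ler_sum => k hk.
    have -> : (hamming x p * 2 ^ b)%:R / 2%:R ^+ k * (B^-1 * (rk x)%:R^-1) =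
        (hamming x p)%:R / 2%:R ^+ k * (rk x)%:R^-1 :> R.
      rewrite natrM natrX mulrA; congr (_ * _).
      by rewrite -/B [_ * B / _]mulrAC mulfK// gt_eqF// (lt_le_trans ltr01 B1).
    rewrite ler_wpM2l//.
    rewrite lef_pV2 ?posrE ?ltr0n ?rk0 ?near_count_ge1//.
    rewrite ler_nat; apply: sub_count => z /= zx.
    by apply: leq_trans hk; rewrite leq_mul2r zx orbT.
  rewrite -[leRHS]mulrA ler_wpM2r ?geometric_tail// mulr_ge0 ?invr_ge0//.
  exact: le_trans ler01 B1.
rewrite -mulr_sumr.
pose hp x := hamming x p.
have -> : \sum_(x <- X) (rk x)%:R^-1 = \sum_(h <- map hp X)
    (count (fun h' => (h' <= h)%N) (map hp X))%:R^-1 :> R.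
  rewrite big_map; apply: eq_bigr => x _; rewrite count_map.
  by congr (_%:R^-1); apply: eq_count.
have := @harmonic_rank R (map hp X); rewrite size_map => /(_ X0).
set H := \sum_(x <- _) _ => Hle.
have L0 : (0 : R) <= 1 + ln (size X)%:R.
  by rewrite addr_ge0// ln_ge0// (ler_nat _ 1).
have -> : 2 * (1 + B) * (2 / B * H) = 4 * ((1 + B) / B) * H.
  by field; rewrite gt_eqF//; lra.
apply: le_trans (ler_wpM2l _ Hle) _.
  by rewrite mulr_ge0// divr_ge0//; lra.
rewrite ler_wpM2r//.
have : (1 + B) / B <= 2 by rewrite ler_pdivrMr; lra.
lra.
Qed.

Lemma near_count_le X p b i : (near_count X p b i <= size X)%N.
Proof. exact: count_size. Qed.

(* Up to summable terms, level k contributes the logarithm of the ratio of the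
   populations of the balls of radii 2^(k + b) and 2^(k - b) around p, and these
   logarithms telescope over k. *)
Lemma radius_sum X p b : p \in X -> 4 * ln (size X)%:R <= (2 ^+ b : R) ->
  \sum_(k < T.+1) (2%:R ^+ k)^-1 * Ex (fun w : {ffun 'I_d -> 'I_(2 ^ T)} =>
     cavg X w (thr k) p (fun x => (hamming x p)%:R)) <=
  16 + (8 + 20 * b%:R) * ln (size X)%:R :> R.
Proof.
move=> pX lnX; have X0 : (0 < size X)%N by case: (X) pX.
apply: le_trans.
  by apply: ler_sum => k _; apply: (level_radius b pX); rewrite -ltnS.
rewrite !big_split /= -!mulr_sumr.
have h1 : \sum_(k < T.+1) \sum_(x <- X | (2 ^ k * 2 ^ b < hamming x p)%N)
    (hamming x p)%:R / 2%:R ^+ k * survival k x p <= 8 :> R.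
  apply: le_trans (far_sum p T.+1 X0 lnX) _; rewrite ler_pdivrMr// ler_peMr//.
  by rewrite exprn_ege1// ler1n.
have h2 := near_sum b T.+1 pX; rewrite -mulr_sumr in h2.
pose g i : R := ln (near_count X p b i)%:R.
have gM i : 0 <= g i <= ln (size X)%:R.
  have c1 : (1 : R) <= (near_count X p b i)%:R.
    by rewrite (ler_nat _ 1) near_count_ge1.
  rewrite ln_ge0//= ler_ln ?posrE ?ltr0n//; last by rewrite near_count_ge1.
  by rewrite ler_nat near_count_le.
have h3 := telescope_shift (2 * b) T.+1 gM.
move: h1 h2 h3; rewrite /g natrM.
set S1 := \sum_(k < _) _; set S2 := \sum_(k < _) _; set S3 := \sum_(k < _) _.
move=> h1 h2 h3; have {}h3 : 10 * S3 <= 10 * (2 * b%:R * ln (size X)%:R).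
  by rewrite ler_wpM2l.
apply: le_trans (lerD (lerD h1 h2) h3) _.
by rewrite le_eqVlt; apply/orP; left; apply/eqP; ring.
Qed.

End QuadtreeRadius.

(** * Expected cost of the tree *)

Lemma mem_zip (S1 S2 : eqType) (s : seq S1) (t : seq S2) p :
  p \in zip s t -> (p.1 \in s) && (p.2 \in t).
Proof.
elim: s t => [|x s IHs] [|y t]//=; rewrite !in_cons => /orP[/eqP->|/IHs] /=.
  by rewrite !eqxx.
by case/andP=> -> ->; rewrite !orbT.
Qed.

Section TreeCost.
Variables (R : realType) (d T : nat).
Implicit Types (X s t : seq (cube d)) (a x y : cube d).
Implicit Type w : {ffun 'I_d -> 'I_(2 ^ T)}.

(* Each coordinate separates the cells of level k with probability 2^-k, by thr_rate. *)
Definition lkey w k : cube d -> cube d := msk w (thr T k).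

Lemma lkeyK w k l x : (k <= l)%N -> lkey w l (lkey w k x) = lkey w l x.
Proof. by move=> kl; apply: mskK; exact: thr_anti. Qed.

Lemma lkey0 w x : lkey w 0 x = x.
Proof. by rewrite /lkey thr0 msk_full. Qed.

Lemma lkey_top w x y : lkey w T.+1 x = lkey w T.+1 y.
Proof. by rewrite /lkey thr_top; exact: msk0. Qed.

Let tree_gt0 : (0 < #|{ffun 'I_d -> 'I_(2 ^ T)}|)%N.
Proof. by rewrite card_ffun card_ord expn_gt0 expn_gt0. Qed.

Definition sep w k j : R := (w j < thr T k)%N%:R.

Lemma Ex_sep k j : (k <= T)%N -> Ex (fun w => sep w k j) = (2%:R ^+ k)^-1.
Proof.
move=> kT; rewrite (Ex_ffun1 j (fun u : 'I_(2 ^ T) => (u < thr T k)%N%:R : R)).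
  by rewrite Ex_lt_ord ?thr_le// thr_rate.
by rewrite card_ord expn_gt0.
Qed.

Lemma lkey_neq w k a x :
  (lkey w k a != lkey w k x)%:R <= \sum_(j | a j != x j) sep w k j.
Proof.
rewrite mskP; case: forallP => [_|/forallP]; first by rewrite sumr_ge0.
rewrite negb_forall => /existsP[j]; rewrite negb_imply => /andP[wj aj].
by rewrite (bigD1 j)//= /sep wj lerDl sumr_ge0.
Qed.

Lemma hamming_sum a x (c : R) : \sum_(j | a j != x j) c = (hamming a x)%:R * c.
Proof.
rewrite sumr_const -[c *+ _]mulr_natl; congr (_%:R * _).
by rewrite -sum1_card big_mkcond; apply: eq_bigr => j _; rewrite -topredE/=; case: eqP.
Qed.

(* Sum over matched pairs, charging each separated pair to the coordinates on
   which its two points differ. *)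
Lemma level_sum_le w k s t (f : cube d -> R) :
  size s = size t -> (forall v, 0 <= f v) ->
  \sum_v disc (lkey w k) s t v * f v <=
  \sum_(p <- zip s t) \sum_(j | p.1 j != p.2 j)
    sep w k j * (f (lkey w k p.1) + f (lkey w k p.2)).
Proof.
move=> st f0; apply: le_trans (sum_disc_le _ st f0) _.
rewrite big_mkcond; apply: ler_sum => p _; rewrite -mulr_suml.
have : (lkey w k p.1 != lkey w k p.2)%:R *
    (f (lkey w k p.1) + f (lkey w k p.2)) <=
    (\sum_(j | p.1 j != p.2 j) sep w k j) *
    (f (lkey w k p.1) + f (lkey w k p.2)).
  by rewrite ler_wpM2r ?addr_ge0 ?lkey_neq.
by case: (_ != _); rewrite ?mul1r ?mul0r.
Qed.

Lemma Ex_disc k s t : (k <= T)%N -> size s = size t ->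
  2%:R ^+ k * Ex (fun w => \sum_v disc (lkey w k) s t v) <=
  2 * \sum_(p <- zip s t) (hamming p.1 p.2)%:R :> R.
Proof.
move=> kT st; have p2 : (0 : R) < 2%:R ^+ k by rewrite exprn_gt0.
rewrite -ler_pdivlMl//.
apply: le_trans (le_Ex (_ : forall w, _ <= _)) _.
- move=> w; have := @level_sum_le w k s t (fun=> 1) st (fun _ => ler01).
  by under eq_bigr => v _ do rewrite mulr1; apply.
rewrite Ex_sum mulrCA mulr_sumr mulr_sumr; apply: ler_sum => p _.
under eq_Ex => w do rewrite -mulr_suml.
rewrite ExZr Ex_sum; under eq_bigr => j _ do rewrite Ex_sep//.
by rewrite hamming_sum; lra.
Qed.

(** The cell contains [a], so its population is at least 1. Dropping it is affordable for far
    points, whose total contribution is small anyway. *)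
Lemma cavg_le_alive X w k a (g : cube d -> R) : a \in X -> (forall x, 0 <= g x) ->
  cavg X w (thr T k) a g <= \sum_(x <- X) (lkey w k x == lkey w k a)%:R * g x.
Proof.
move=> aX g0; rewrite /cavg /cellavg ler_pdivrMr ?cellcnt_gt0//.
have -> : \sum_(x <- X | msk w (thr T k) x == msk w (thr T k) a) g x =
    \sum_(x <- X) (lkey w k x == lkey w k a)%:R * g x.
  by rewrite big_mkcond; apply: eq_bigr => x _; rewrite /lkey;
     case: eqP; rewrite ?mul1r ?mul0r.
rewrite ler_peMr ?sumr_ge0// => [x _|]; first by rewrite mulr_ge0.
by rewrite (ler_nat _ 1) -has_count; apply/hasP; exists a; rewrite ?eqxx.
Qed.

(** The triangle inequality through [a] separates the average over the cell from that over its
    parent; only averages of distances to a fixed point remain. *)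
Lemma edge_weight_le X w k (F F1 : cube d -> cube d -> R) a : a \in X ->
  (forall x y, F x y <= F1 a x + F1 a y) ->
  edge_weight X (lkey w) F k (lkey w k a) <=
  cavg X w (thr T k) a (F1 a) + cavg X w (thr T k.+1) a (F1 a).
Proof.
move=> aX FF1; rewrite /edge_weight lkeyK ?leqnSn//.
rewrite -[X in _ <= _ + X](cellavg_cst (lkey w k) _ aX) -cellavgD.
apply: le_cellavg => x.
rewrite -[X in _ <= X + _](cellavg_cst (lkey w k.+1) _ aX) -cellavgD.
by apply: le_cellavg => y; exact: FF1.
Qed.

(** Two functions occur because a truncated distance [F] satisfies the triangle inequality only
    after relaxation to [F1]; for the Hamming distance they coincide. *)
Lemma Ex_tree_cost (F F1 : nat -> cube d -> cube d -> R) (N : nat) (Q c : R) X s t :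
  (forall k a x y, F k x y <= F1 k a x + F1 k a y) ->
  (forall k x y, 0 <= F k x y) ->
  (forall k a x, 0 <= F1 k a x) ->
  (forall X' a, a \in X' -> (size X' <= N)%N ->
    \sum_(k < T.+1) (2%:R ^+ k)^-1 *
      Ex (fun w => cavg X' w (thr T k) a (F1 k a)) <= Q) ->
  (forall X' a, a \in X' -> (size X' <= N)%N ->
    \sum_(k < T) (2%:R ^+ k.+1)^-1 *
      Ex (fun w => cavg X' w (thr T k.+1) a (F1 k a)) <= Q) ->
  0 <= c -> (forall a x, F1 T a x <= c * 2%:R ^+ T) ->
  {subset s <= X} -> {subset t <= X} -> size s = size t -> (size X <= N)%N ->
  Ex (fun w => \sum_(k < T.+1) level_cost X (lkey w) (F k) s t k) <=
  2 * (4 * Q + c) * \sum_(p <- zip s t) (hamming p.1 p.2)%:R.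
Proof.
move=> FF1 F0 F10 HQ HQ' c0 Hc sX tX st XN.
pose g w k a := cavg X w (thr T k) a (F1 k a) + cavg X w (thr T k.+1) a (F1 k a).
(* Charge of one endpoint to one coordinate: Q for its cells, Q + 2 Q for the parent cells by
   [Ex_cavg_next], and c for the root. *)
have one j a : a \in X ->
    \sum_(k < T.+1) Ex (fun w => sep w k j * g w k a) <= 4 * Q + c.
  move=> aX; have aXj : a \in pinned X j a by rewrite mem_filter eqxx.
  have XjN : (size (pinned X j a) <= N)%N.
    by rewrite size_filter (leq_trans (count_size _ _)).
  have T0 : (0 < 2 ^ T)%N by rewrite expn_gt0.
  have split k : Ex (fun w => sep w k j * g w k a) =
      Ex (fun w => sep w k j * cavg X w (thr T k) a (F1 k a)) +
      Ex (fun w => sep w k j * cavg X w (thr T k.+1) a (F1 k a)).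
    by rewrite -ExD; apply: eq_Ex => w; rewrite mulrDr.
  under eq_bigr => k _ do rewrite split.
  rewrite big_split /=.
  have h1 : \sum_(k < T.+1) Ex (fun w => sep w k j * cavg X w (thr T k) a (F1 k a))
      <= Q.
    rewrite (_ : \sum_(_ < _) _ = \sum_(k < T.+1) (2%:R ^+ k)^-1 *
      Ex (fun w => cavg (pinned X j a) w (thr T k) a (F1 k a))); first exact: HQ.
    apply: eq_bigr => k _; rewrite Ex_cavg_in ?thr_le//.
    by rewrite thr_rate// -ltnS.
  have h2 (k : 'I_T) : Ex (fun w => sep w k j * cavg X w (thr T k.+1) a (F1 k a))
      <= (2%:R ^+ k.+1)^-1 * Ex (fun w => cavg (pinned X j a) w (thr T k.+1) a (F1 k a))
       + 2 * ((2%:R ^+ k.+1)^-1 * Ex (fun w => cavg X w (thr T k.+1) a (F1 k a))).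
    rewrite mulrA -[X in X * Ex _ + _](@thr_rate R T)//.
    apply: Ex_cavg_next => //.
      by rewrite thr_le thr_anti// leqnSn.
    rewrite !thrE//; last by rewrite ltnW.
    (* With P = 2^(k + 1) the thresholds are 2 u and u out of P u labels. The price 2 / P suffices,
       as u <= 2 / P * (P u - u) for P >= 2. *)
    pose u := (2 ^ (T - k.+1))%N.
    have -> : (2 ^ (T - k) = 2 * u)%N by rewrite -expnS subnSK.
    have -> : (2 ^ T = 2 ^ k.+1 * u)%N by rewrite -expnD subnKC.
    rewrite mulrAC ler_pdivlMr ?exprn_gt0// -natrX -!natrM ler_nat -/u.
    have : (2 <= 2 ^ k.+1)%N by rewrite -[leqLHS]expn1 leq_exp2l.
    move: (2 ^ k.+1)%N => P P2; nia.
  have h3 : Ex (fun w => sep w T j * cavg X w (thr T T.+1) a (F1 T a)) <= c.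
    rewrite thr_top; apply: le_trans (@Ex_cavg_root _ _ R X j (thr T T) a _
      (c * 2%:R ^+ T) _ T0 _ _) _; rewrite ?thr_le//.
      by rewrite mulr_ge0// exprn_ge0.
    by rewrite thr_rate// mulrC mulfK// gt_eqF// exprn_gt0.
  rewrite [X in _ + X]big_ord_recr/=.
  have h4 := ler_sum (index_enum 'I_T) (fun k (_ : true) => h2 k).
  rewrite big_split -mulr_sumr /= in h4.
  have := HQ' _ _ aXj XjN; have := HQ' _ _ aX XN.
  move: h4; set S1 := \sum_(i < T) _; set S2 := \sum_(i < T) _.
  set S3 := \sum_(i < T) _; set S4 := \sum_(i < T.+1) _ in h1 *.
  lra.
rewrite mulr_sumr.
apply: le_trans (le_Ex (_ : forall w, _ <= \sum_(k < T.+1) \sum_(p <- zip s t)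
   \sum_(j | p.1 j != p.2 j) (sep w k j * g w k p.1 + sep w k j * g w k p.2))) _.
- move=> w; apply: ler_sum => k _.
  apply: le_trans (level_sum_le _ _ st _) _.
    by move=> v; rewrite cellavg_ge0// => x; rewrite cellavg_ge0.
  rewrite big_seq [leRHS]big_seq; apply: ler_sum => -[a x] /mem_zip/=/andP[sa tx].
  apply: ler_sum => j _; rewrite -mulrDr ler_wpM2l// lerD//.
    by apply: edge_weight_le; [exact: sX|exact: FF1].
  by apply: edge_weight_le; [exact: tX|exact: FF1].
rewrite Ex_sum; under eq_bigr => k _ do rewrite Ex_sum.
rewrite exchange_big /= big_seq [leRHS]big_seq.
apply: ler_sum => -[a x] /mem_zip/=/andP[sa tx].
under eq_bigr => k _ do rewrite Ex_sum.
rewrite exchange_big /=.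
rewrite [leRHS]mulrC -hamming_sum; apply: ler_sum => j _.
under eq_bigr => k _ do rewrite ExD.
rewrite big_split /=; have := one j a (sX a sa); have := one j x (tX x tx).
lra.
Qed.

End TreeCost.

Section LevelCost.
Variables (R : realType) (K : finType) (X : seq K) (key : nat -> K -> K).
Implicit Types (s t : seq K) (F G : K -> K -> R).

Lemma le_level_cost F G s t k : (forall x y, F x y <= G x y) ->
  level_cost X key F s t k <= level_cost X key G s t k.
Proof.
move=> FG; apply: ler_sum => v _; rewrite ler_wpM2l ?disc_ge0//.
by apply: le_cellavg => x; apply: le_cellavg.
Qed.

Lemma edge_weightD F G k v : edge_weight X key (fun x y => F x y + G x y) k v =
  edge_weight X key F k v + edge_weight X key G k v.
Proof.
rewrite /edge_weight -cellavgD; apply: eq_cellavg => x _ _.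
exact: cellavgD.
Qed.

Lemma edge_weightZ c F k v : edge_weight X key (fun x y => c * F x y) k v =
  c * edge_weight X key F k v.
Proof.
rewrite /edge_weight -cellavgZ; apply: eq_cellavg => x _ _; exact: cellavgZ.
Qed.

Lemma level_costD F G s t k : level_cost X key (fun x y => F x y + G x y) s t k =
  level_cost X key F s t k + level_cost X key G s t k.
Proof.
rewrite /level_cost -big_split; apply: eq_bigr => v _ /=.
by rewrite edge_weightD mulrDr.
Qed.

Lemma level_costZ c F s t k : level_cost X key (fun x y => c * F x y) s t k =
  c * level_cost X key F s t k.
Proof.
rewrite /level_cost mulr_sumr; apply: eq_bigr => v _.
by rewrite edge_weightZ mulrCA.
Qed.

Lemma Ex_edge_weight (O : finType) (F : O -> K -> K -> R) k v :
  Ex (fun o => edge_weight X key (F o) k v) =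
  edge_weight X key (fun x y => Ex (fun o => F o x y)) k v.
Proof.
rewrite /edge_weight /cellavg ExZr Ex_sum; congr (_ / _).
by apply: eq_bigr => x _; rewrite ExZr Ex_sum.
Qed.

End LevelCost.

(** * Replacing distances by probabilities of random bits *)

Section Surrogate.
Variables (R : realType) (d T : nat).
Implicit Types (X s t : seq (cube d)) (a x y : cube d).

Definition ham x y : R := (hamming x y)%:R.

Lemma ham_ge0 x y : 0 <= ham x y. Proof. exact: ler0n. Qed.

Hypothesis dT : (d <= 2 ^ T)%N.

Lemma ham_le x y : ham x y <= 2 ^+ T.
Proof. by rewrite -natrX ler_nat (leq_trans (hamming_le x y)). Qed.

Section Bounds.
Variables (N b f : nat).
Hypotheses (N0 : (0 < N)%N) (lnb : 4 * ln N%:R <= (2 ^+ b : R))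
  (lnf : 4 * ln N%:R <= (2 ^+ f : R)).

Let ln_size X a : a \in X -> (size X <= N)%N ->
  [/\ (0 < size X)%N, 0 <= ln (size X)%:R :> R & ln (size X)%:R <= ln N%:R :> R].
Proof.
move=> aX XN; have X0 : (0 < size X)%N by case: (X) aX.
by split=> //; rewrite ?ln_ge0 ?(ler_nat _ 1)// ler_ln ?posrE ?ltr0n// ler_nat.
Qed.

Let p2_gt0 k : (0 : R) < 2%:R ^+ k. Proof. by rewrite exprn_gt0. Qed.

Lemma Ex_tree_ham X s t :
  {subset s <= X} -> {subset t <= X} -> size s = size t -> (size X <= N)%N ->
  Ex (fun w => \sum_(k < T.+1) level_cost X (@lkey d T w) ham s t k) <=
  2 * (4 * (16 + (8 + 20 * b%:R) * ln N%:R) + 1) *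
  \sum_(p <- zip s t) ham p.1 p.2.
Proof.
move=> sX tX st XN.
have HQ X' a : a \in X' -> (size X' <= N)%N ->
    \sum_(k < T.+1) (2%:R ^+ k)^-1 * Ex (fun w : {ffun 'I_d -> 'I_(2 ^ T)} =>
      cavg X' w (thr T k) a (ham a)) <= 16 + (8 + 20 * b%:R) * ln N%:R.
  move=> aX X'N; have [X0 L0 LN] := ln_size aX X'N.
  have lnX : 4 * ln (size X')%:R <= (2 ^+ b : R).
    by apply: le_trans lnb; rewrite ler_wpM2l.
  have := @radius_sum R d T X' a b aX lnX.
  have -> : (fun x => (hamming x a)%:R) = ham a.
    by apply/funext => x; rewrite /ham hammingC.
  by move/le_trans; apply; rewrite lerD2l ler_wpM2l// addr_ge0// mulr_ge0.
apply: (@Ex_tree_cost R d T (fun=> ham) (fun=> ham) N) => //.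
- by move=> _ a x y; rewrite -natrD ler_nat [hamming a x]hammingC hamming_triangle.
- move=> X' a aX X'N; apply: le_trans (HQ X' a aX X'N).
  rewrite [leRHS]big_ord_recl lerDr mulr_ge0// ?invr_ge0 ?(ltW (p2_gt0 _))//.
  by apply: Ex_ge0 => w; rewrite cellavg_ge0.
- by move=> a x; rewrite mul1r ham_le.
Qed.

Definition far k x y : R :=
  if (2 ^ (k + f.+2) < hamming x y)%N then ham x y else 0.

(** The larger of the distances of [x] and [y] to a third point is at least half of their own
    distance: hence half the threshold of [far] and twice its weight. *)
Let far1 k x y : R :=
  if (2 ^ (k + f.+1) < hamming x y)%N then 2 * ham x y else 0.

Let far1_ge0 k x y : 0 <= far1 k x y.
Proof. by rewrite /far1; case: ifP => // _; rewrite mulr_ge0 ?ham_ge0. Qed.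

(** The weight belongs to level [l], the cell to level [k], which is [l] or its parent level l + 1.
    The threshold of [far1] is one factor 2 above 2^(l + f), which leaves room for the parent. *)
Let Ex_far1 X k l a : a \in X -> (k <= T)%N -> (k <= l.+1)%N ->
  (2%:R ^+ k)^-1 * Ex (fun w : {ffun 'I_d -> 'I_(2 ^ T)} =>
      cavg X w (thr T k) a (far1 l a)) <=
  2 * \sum_(x <- X | (2 ^ k * 2 ^ f < hamming x a)%N)
        (hamming x a)%:R / 2%:R ^+ k * survival R k x a.
Proof.
move=> aX kT kl; rewrite -ler_pdivlMl ?invr_gt0//.
apply: le_trans (le_Ex (fun w => cavg_le_alive w k aX (far1_ge0 l a))) _.
rewrite Ex_sum invrK !mulr_sumr [leRHS]big_mkcond; apply: ler_sum => x _.
rewrite ExZr Ex_survival// /far1 hammingC.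
have s0 : 0 <= survival R k x a.
  by rewrite exprn_ge0// subr_ge0 invf_le1// exprn_ege1// ler1n.
case: ltnP => far_x; last first.
  rewrite mulr0; case: ifP => // _.
  by rewrite mulr_ge0 ?(ltW (p2_gt0 _))// !mulr_ge0// invr_ge0 ltW.
rewrite -expnD (leq_ltn_trans _ far_x); last first.
  by rewrite leq_exp2l// addnS -addSn leq_add2r.
by rewrite le_eqVlt /ham hammingC; apply/orP; left; apply/eqP; field;
   rewrite gt_eqF.
Qed.

Lemma Ex_tree_far X s t :
  {subset s <= X} -> {subset t <= X} -> size s = size t -> (size X <= N)%N ->
  Ex (fun w => \sum_(k < T.+1) level_cost X (@lkey d T w) (far k) s t k) <=
  128 / 2 ^+ f * \sum_(p <- zip s t) ham p.1 p.2.
Proof.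
move=> sX tX st XN.
(* Q = 16 / 2^f is twice the bound of [far_sum], and c = 0 because no distance exceeds the threshold
   at level T. *)
have -> : 128 / 2 ^+ f = 2 * (4 * (16 / 2 ^+ f) + 0) :> R by lra.
have farS X' a : a \in X' -> (size X' <= N)%N ->
    2 * \sum_(k < T.+1) \sum_(x <- X' | (2 ^ k * 2 ^ f < hamming x a)%N)
      (hamming x a)%:R / 2%:R ^+ k * survival R k x a <= 16 / 2 ^+ f :> R.
  move=> aX X'N; have [X0 L0 LN] := ln_size aX X'N.
  have lnX : 4 * ln (size X')%:R <= (2 ^+ f : R).
    by apply: le_trans lnf; rewrite ler_wpM2l.
  by have := far_sum a T.+1 X0 lnX; lra.
apply: (@Ex_tree_cost R d T far far1 N) => //.
- move=> k a x y; rewrite /far; case: ifP => xy; last by rewrite addr_ge0.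
  have tri := hamming_triangle a x y.
  rewrite /far1 [hamming x a]hammingC in tri *.
  have [ax|ax] := leqP (hamming a y) (hamming a x).
    apply: le_trans (_ : 2 * ham a x + 0 <= _); last first.
      rewrite lerD//; last exact: far1_ge0.
      rewrite ifT//; move: xy; rewrite (addnS k) expnS; lia.
    by rewrite addr0 -natrM ler_nat mul2n -addnn (leq_trans tri)// leq_add2l.
  apply: le_trans (_ : 0 + 2 * ham a y <= _); last first.
    rewrite lerD//; first exact: far1_ge0.
    rewrite ifT//; move: xy; rewrite (addnS k) expnS; lia.
  rewrite add0r -natrM ler_nat mul2n -addnn (leq_trans tri)// leq_add2r.
  exact: ltnW.
- by move=> k x y; rewrite /far; case: ifP => // _; rewrite ham_ge0.
- move=> X' a aX X'N; apply: le_trans (farS X' a aX X'N).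
  rewrite mulr_sumr; apply: ler_sum => k _.
  by apply: Ex_far1 => //; rewrite -ltnS.
- move=> X' a aX X'N; apply: le_trans (farS X' a aX X'N).
  rewrite mulr_sumr [leRHS]big_ord_recl.
  apply: ler_wpDl; last by apply: ler_sum => k _; apply: Ex_far1.
  rewrite mulr_ge0// sumr_ge0// => x _; rewrite mulr_ge0 ?divr_ge0 ?(ltW (p2_gt0 _))//.
  by rewrite exprn_ge0// subr_ge0 invf_le1// exprn_ege1// ler1n.
- move=> a x; rewrite mul0r /far1 ifF//; apply/negbTE; rewrite -leqNgt.
  rewrite (leq_trans (hamming_le a x))// (leq_trans dT)// leq_exp2l//.
  exact: leq_addr.
Qed.

(* The distance seen by a random bit of the coordinates sampled at rate
   1 / 2^(k + f + 2), rescaled; it agrees with the Hamming distance up to a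
   constant as long as the latter is at most 2^(k + f + 2). *)
Definition surrogate k x y : R :=
  2%:R ^+ (k + f.+2) * ((1 - (1 - (2%:R ^+ (k + f.+2))^-1) ^+ hamming x y) / 2).

Lemma surrogate_ge0 k x y : 0 <= surrogate k x y.
Proof.
have r1 : (2%:R ^+ (k + f.+2))^-1 <= 1 :> R by rewrite invf_le1// exprn_ege1// ler1n.
rewrite mulr_ge0 ?(ltW (p2_gt0 _))// divr_ge0// subr_ge0 exprn_ile1 ?subr_ge0//.
Qed.

Lemma surrogate_le k x y : surrogate k x y <= ham x y.
Proof.
rewrite /surrogate; set r : R := 2%:R ^+ _; have r0 : 0 < r by exact: p2_gt0.
have r1 : 0 <= r^-1 <= 1.
  by rewrite invr_ge0 (ltW r0) invf_le1// exprn_ege1// ler1n.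
have := @pow1B_ge R r^-1 (hamming x y) r1; set u := _ ^+ _ => hu.
have : r * ((1 - u) / 2) <= r * ((hamming x y)%:R * r^-1 / 2).
  by rewrite ler_wpM2l ?(ltW r0)// ler_wpM2r//; lra.
move=> /le_trans; apply; rewrite mulrA mulrCA mulfV ?gt_eqF// mulr1.
by have := ham_ge0 x y; rewrite /ham; lra.
Qed.

(** For a pair that is not far, the expected number z of sampled differing coordinates is at most 1,
    and there 1 - expR (- z) >= z / 2. *)
Lemma ham_le_surrogate k x y : ham x y <= 4 * surrogate k x y + far k x y.
Proof.
rewrite /far; case: ltnP => [_|near_xy]; first by rewrite lerDr mulr_ge0 ?surrogate_ge0.
rewrite addr0 /surrogate; set r : R := 2%:R ^+ _; have r0 : 0 < r by exact: p2_gt0.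
have r1 : r^-1 <= 1 by rewrite invf_le1// exprn_ege1// ler1n.
pose z : R := (hamming x y)%:R * r^-1.
have z0 : 0 <= z by rewrite mulr_ge0// invr_ge0 ltW.
have z1 : z <= 1.
  by rewrite ler_pdivrMr// mul1r /r -natrX ler_nat.
have := @pow1B_le_expR R r^-1 (hamming x y) r1; rewrite -/z; set u := _ ^+ _ => hu.
have hz : expR (- z) <= 1 - z / 2.
  rewrite expRN -[leLHS]mul1r ler_pdivrMr ?expR_gt0//.
  have := expR_ge1Dx z; set E := expR z => hE.
  have : (1 - z / 2) * (1 + z) <= (1 - z / 2) * E by rewrite ler_wpM2l//; lra.
  have : 0 <= z * (1 - z) by rewrite mulr_ge0//; lra.
  lra.
have -> : ham x y = r * z by rewrite /z mulrC divfK// gt_eqF.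
have -> : 4 * (r * ((1 - u) / 2)) = r * (2 * (1 - u)) by lra.
by rewrite ler_wpM2l ?(ltW r0)//; lra.
Qed.

End Bounds.
End Surrogate.

Section RandomBit.
Variables (R : realType) (d T e : nat).
Implicit Types (x y : cube d).

(** Labels take 2^(T + e) values while the thresholds remain those of the tree, which lowers every
    sampling rate by 2^-e. The second component is a table with one random bit per masked point. *)
Definition bits_space : finType :=
  ({ffun 'I_d -> 'I_(2 ^ (T + e))} * {ffun cube d -> bool})%type.

Definition hbit (o : bits_space) k x : bool := o.2 (msk o.1 (thr T k) x).

Lemma Ex_bool (g : bool -> R) : Ex g = (g true + g false) / 2.
Proof. by rewrite /Ex card_bool big_bool. Qed.

(** Equal masks give equal bits; different masks read independent entries of the table, which differ
    with probability 1 / 2. *)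
Lemma Ex_hbit k x y : (k <= T)%N ->
  Ex (fun o : bits_space => (hbit o k x != hbit o k y)%:R) =
  (1 - (1 - (2%:R ^+ (k + e))^-1) ^+ hamming x y) / 2 :> R.
Proof.
move=> kT.
rewrite (Ex_pair (fun H (be : {ffun cube d -> bool}) =>
  (be (msk H (thr T k) x) != be (msk H (thr T k) y))%:R)).
have thr_le' : (thr T k <= 2 ^ (T + e))%N.
  by rewrite (leq_trans (thr_le T k))// leq_exp2l// leq_addr.
have rate : (thr T k)%:R / (2 ^ (T + e))%:R = (2%:R ^+ (k + e))^-1 :> R.
  rewrite expnD natrM invfM mulrA thr_rate// -invfM; congr (_^-1).
  by rewrite natrX exprD.
rewrite -rate -Ex_msk_eq ?expn_gt0//.
rewrite -[X in (X - _) / 2](@Ex_cst _ {ffun 'I_d -> 'I_(2 ^ (T + e))}); last first.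
  by rewrite card_ffun card_ord !expn_gt0.
rewrite -ExB -ExZr; apply: eq_Ex => H.
have [->|xy] := eqVneq (msk H (thr T k) x) (msk H (thr T k) y).
  rewrite subrr mul0r -[RHS](@Ex_cst _ {ffun cube d -> bool}).
    by apply: eq_Ex => be; rewrite eqxx.
  by rewrite card_ffun card_bool expn_gt0.
have bE (p q : bool) : (p != q)%:R = p%:R * (~~ q)%:R + (~~ p)%:R * q%:R :> R.
  by case: p q => [] []; rewrite /= ?mulr0 ?mul0r ?mulr1 ?addr0 ?add0r.
under eq_Ex => be do rewrite bE.
rewrite ExD (Ex_ffun2 (fun p : bool => p%:R) (fun p : bool => (~~ p)%:R)) ?card_bool//.
rewrite (Ex_ffun2 (fun p : bool => (~~ p)%:R) (fun p : bool => p%:R)) ?card_bool//.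
by rewrite !Ex_bool /=; lra.
Qed.

End RandomBit.

(** * Sampling cells at dyadic rates *)

Section Mix.
Variable R : realType.
Implicit Types a b : R.

(* The probability that two independent bits of means a and b differ. *)
Definition mix a b := a * (1 - b) + (1 - a) * b.

Lemma mix_ge0 a b : 0 <= a <= 1 -> 0 <= b <= 1 -> 0 <= mix a b.
Proof.
move=> /andP[a0 a1] /andP[b0 b1].
by rewrite addr_ge0// mulr_ge0// subr_ge0.
Qed.

Lemma mix_le1 a b : 0 <= a <= 1 -> 0 <= b <= 1 -> mix a b <= 1.
Proof.
move=> /andP[a0 a1] /andP[b0 b1]; rewrite /mix.
have : 0 <= a * b by rewrite mulr_ge0.
have : 0 <= (1 - a) * (1 - b) by rewrite mulr_ge0// subr_ge0.
lra.
Qed.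

Lemma mix_lip a b a' b' : 0 <= a <= 1 -> 0 <= b <= 1 -> 0 <= a' <= 1 ->
  0 <= b' <= 1 -> `|mix a b - mix a' b'| <= `|a - a'| + `|b - b'|.
Proof.
move=> /andP[a0 a1] /andP[b0 b1] /andP[a'0 a'1] /andP[b'0 b'1].
have -> : mix a b - mix a' b' = (a - a') * (1 - 2 * b) + (b - b') * (1 - 2 * a').
  by rewrite /mix; ring.
rewrite (le_trans (ler_normD _ _))// !normrM.
by rewrite lerD// ler_piMr// ler_norml; apply/andP; split; lra.
Qed.

(** The difference of the fractions is ((V1 - c1) - c1 / c * (V - c)) / V, and both parts of the
    numerator lie between 0 and V - c. For c = 0 the fraction c1 / c is 0 by convention. *)
Lemma frac_noise (c c1 V V1 : R) : 0 <= c1 <= c -> c <= V -> c1 <= V1 ->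
  V1 - c1 <= V - c -> 0 < V -> `|V1 / V - c1 / c| <= (V - c) / V.
Proof.
move=> /andP[c10 c1c] cV c1V1 h V0.
have [c0|c0] := eqVneq c 0.
  have c1_0 : c1 = 0 by apply/le_anti/andP; split; lra.
  rewrite c1_0 mul0r subr0 ger0_norm; last by rewrite divr_ge0//; lra.
  by rewrite ler_wpM2r ?invr_ge0 ?(ltW V0)//; lra.
have {}c0 : 0 < c by rewrite lt_neqAle eq_sym c0/=; lra.
have -> : V1 / V - c1 / c = ((V1 - c1) - c1 / c * (V - c)) / V.
  by field; rewrite !gt_eqF.
have f0 : 0 <= c1 / c by rewrite divr_ge0// ltW.
have f1 : c1 / c <= 1 by rewrite ler_pdivrMr// mul1r.
rewrite normrM (gtr0_norm (x := V^-1)) ?invr_gt0// ler_wpM2r ?invr_ge0 ?(ltW V0)//.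
have : 0 <= c1 / c * (V - c) by rewrite mulr_ge0//; lra.
have : c1 / c * (V - c) <= V - c by rewrite ler_piMl//; lra.
move=> h1 h2; rewrite ler_norml; apply/andP; split; lra.
Qed.

End Mix.

(* The index c v is the number of points of cell v, c1 v of those with bit 1, and
   z v is its signed surplus of A over B. Parent cells are kept at rate 2^-j1 and
   then their children at rate 2^-j2. *)
Section Sampling.
Variables (R : realType) (K : finType) (J : nat) (par : K -> K).
Variables (c c1 z : K -> R) (M : R).
Hypotheses (c1_bounds : forall v, 0 <= c1 v <= c v).
Hypotheses (z_le : forall v, `|z v| <= c v) (sumc : \sum_v c v <= M).

Definition labels : finType := ({ffun K -> 'I_(2 ^ J)} * {ffun K -> 'I_(2 ^ J)})%type.
Implicit Type o : labels.

Definition keep1 j1 o u : bool := (o.1 u < thr J j1)%N.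
Definition keep j1 j2 o v : bool := keep1 j1 o (par v) && (o.2 v < thr J j2)%N.

Definition pc (u : K) : R := \sum_(v | par v == u) c v.
Definition pc1 (u : K) : R := \sum_(v | par v == u) c1 v.

Definition Utot j1 o : R := \sum_u (keep1 j1 o u)%:R * pc u.
Definition Utot1 j1 o : R := \sum_u (keep1 j1 o u)%:R * pc1 u.
Definition Vtot j1 j2 o : R := \sum_v (keep j1 j2 o v)%:R * c v.
Definition Vtot1 j1 j2 o : R := \sum_v (keep j1 j2 o v)%:R * c1 v.
Definition Ztot j1 j2 o : R := \sum_v (keep j1 j2 o v)%:R * z v.

(** For fixed bits, the probability that a random point of the cell and a random point of its parent
    have different bits: the edge weight to be estimated. *)
Definition cellmix v : R := mix (c1 v / c v) (pc1 (par v) / pc (par v)).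

Let rho (j : nat) : R := (2%:R ^+ j)^-1.
Let rho_gt0 j : 0 < rho j. Proof. by rewrite invr_gt0 exprn_gt0. Qed.

Let c_ge0 v : 0 <= c v.
Proof. by have /andP[h1 h2] := c1_bounds v; exact: le_trans h2. Qed.

Let pc_ge0 u : 0 <= pc u. Proof. exact: sumr_ge0. Qed.

Let pc1_bounds u : 0 <= pc1 u <= pc u.
Proof.
rewrite sumr_ge0 => [|v _]; last by have /andP[] := c1_bounds v.
by apply: ler_sum => v _; have /andP[] := c1_bounds v.
Qed.

Let sum_pc : \sum_u pc u = \sum_v c v.
Proof. by rewrite [RHS](partition_big par xpredT). Qed.

Let frac01 (a b : R) : 0 <= a <= b -> 0 <= a / b <= 1.
Proof.
move=> /andP[a0 ab]; have b0 := le_trans a0 ab; rewrite divr_ge0//=.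
have [->|b_neq0] := eqVneq b 0; first by rewrite invr0 mulr0.
by rewrite ler_pdivrMr ?mul1r// lt_neqAle eq_sym b_neq0.
Qed.

Let cellmix01 v : 0 <= cellmix v <= 1.
Proof. by rewrite mix_ge0 ?mix_le1 ?frac01. Qed.

Let lab_gt0 : (0 < #|'I_(2 ^ J)|)%N. Proof. by rewrite card_ord expn_gt0. Qed.

Let lt_lab j (t : 'I_(2 ^ J)) : R := (t < thr J j)%N%:R.

Let Ex_lt j : (j <= J)%N -> Ex (lt_lab j) = rho j.
Proof. by move=> jJ; rewrite Ex_lt_ord ?thr_le// thr_rate. Qed.

Let Ex_lab (f g : {ffun K -> 'I_(2 ^ J)} -> R) :
  Ex (fun o : labels => f o.1 * g o.2) = Ex f * Ex g.
Proof.
rewrite (Ex_pair (fun l1 l2 => f l1 * g l2)) -ExZr.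
by apply: eq_Ex => l1; rewrite ExZ.
Qed.

Let keepE j1 j2 o v : (keep j1 j2 o v)%:R =
  lt_lab j1 (o.1 (par v)) * lt_lab j2 (o.2 v) :> R.
Proof. by rewrite /keep /keep1 /lt_lab -natrM mulnb. Qed.

Variables (j1 j2 : nat).
Hypotheses (j1J : (j1 <= J)%N) (j2J : (j2 <= J)%N).

Let Ex_keep v : Ex (fun o => (keep j1 j2 o v)%:R) = rho j1 * rho j2.
Proof.
under eq_Ex => o do rewrite keepE.
rewrite (Ex_lab (fun l => lt_lab j1 (l (par v))) (fun l => lt_lab j2 (l v))).
by rewrite !Ex_ffun1// !Ex_lt.
Qed.

Let Ex_keep_keep1 v u : u != par v ->
  Ex (fun o => (keep j1 j2 o v)%:R * (keep1 j1 o u)%:R) =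
  rho j1 * rho j2 * rho j1.
Proof.
move=> uv.
transitivity (Ex (fun o : labels =>
    (lt_lab j1 (o.1 u) * lt_lab j1 (o.1 (par v))) * lt_lab j2 (o.2 v))).
  by apply: eq_Ex => o; rewrite keepE mulrC mulrA.
rewrite (Ex_lab (fun l => lt_lab j1 (l u) * lt_lab j1 (l (par v)))
  (fun l => lt_lab j2 (l v))).
by rewrite Ex_ffun1// (Ex_ffun2 (lt_lab j1) (lt_lab j1))// !Ex_lt// mulrAC.
Qed.

(** Siblings share the label of their parent, so [rho j1] enters their joint probability only once.
    One bound covers siblings and all other pairs. *)
Let Ex_keep_keep v v' : v' != v ->
  Ex (fun o => (keep j1 j2 o v)%:R * (keep j1 j2 o v')%:R) <=
  rho j1 * rho j2 * (rho j2 * (par v' == par v)%:R + rho j1 * rho j2).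
Proof.
move=> vv; have [pv|pv] := eqVneq (par v') (par v).
  rewrite mulr1; apply: le_trans (_ : rho j1 * rho j2 * rho j2 <= _); last first.
    by rewrite ler_wpM2l ?mulr_ge0 ?(ltW (rho_gt0 _))// lerDl mulr_ge0// ltW.
  rewrite le_eqVlt; apply/orP; left; apply/eqP.
  transitivity (Ex (fun o : labels =>
      lt_lab j1 (o.1 (par v)) * (lt_lab j2 (o.2 v') * lt_lab j2 (o.2 v)))).
    apply: eq_Ex => o; rewrite !keepE pv /lt_lab.
    by case: (_ < thr J j1)%N; rewrite ?mul0r// !mul1r mulrC.
  rewrite (Ex_lab (fun l => lt_lab j1 (l (par v)))
    (fun l => lt_lab j2 (l v') * lt_lab j2 (l v))).
  by rewrite Ex_ffun1// (Ex_ffun2 (lt_lab j2) (lt_lab j2))// !Ex_lt// mulrA.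
rewrite mulr0 add0r le_eqVlt; apply/orP; left; apply/eqP.
transitivity (Ex (fun o : labels =>
    (lt_lab j1 (o.1 (par v')) * lt_lab j1 (o.1 (par v))) *
    (lt_lab j2 (o.2 v') * lt_lab j2 (o.2 v)))).
  by apply: eq_Ex => o; rewrite !keepE mulrC mulrACA.
rewrite (Ex_lab (fun l => lt_lab j1 (l (par v')) * lt_lab j1 (l (par v)))
  (fun l => lt_lab j2 (l v') * lt_lab j2 (l v))).
rewrite (Ex_ffun2 (lt_lab j1) (lt_lab j1))// (Ex_ffun2 (lt_lab j2) (lt_lab j2))//.
by rewrite !Ex_lt// mulrACA.
Qed.

(** Noise seen from a kept cell [v]: what the other kept parents, the other kept cells and their
    surpluses add to the counters. *)
Let nu o v := \sum_(u | u != par v) (keep1 j1 o u)%:R * pc u.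
Let mu o v := \sum_(v' | v' != v) (keep j1 j2 o v')%:R * c v'.
Let zeta o v := \sum_(v' | v' != v) (keep j1 j2 o v')%:R * `|z v'|.

Let nu_ge0 o v : 0 <= nu o v.
Proof. by rewrite sumr_ge0// => u _; rewrite mulr_ge0. Qed.

Let mu_ge0 o v : 0 <= mu o v.
Proof. by rewrite sumr_ge0// => u _; rewrite mulr_ge0. Qed.

Let zeta_ge0 o v : 0 <= zeta o v.
Proof. by rewrite sumr_ge0// => u _; rewrite mulr_ge0. Qed.

Let UtotE o v : keep j1 j2 o v -> Utot j1 o = pc (par v) + nu o v.
Proof.
by move=> /andP[kv _]; rewrite /Utot (bigD1 (par v))//= kv mul1r.
Qed.

Let VtotE o v : keep j1 j2 o v -> Vtot j1 j2 o = c v + mu o v.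
Proof. by move=> kv; rewrite /Vtot (bigD1 v)//= kv mul1r. Qed.

Let Utot1_bounds o v : keep j1 j2 o v ->
  pc1 (par v) <= Utot1 j1 o <= pc1 (par v) + nu o v.
Proof.
move=> /andP[kv _]; rewrite /Utot1 (bigD1 (par v))//= kv mul1r lerDl lerD2l.
rewrite sumr_ge0 => [|u _]; last first.
  by rewrite mulr_ge0//; have /andP[] := pc1_bounds u.
by apply: ler_sum => u _; rewrite ler_wpM2l//; have /andP[] := pc1_bounds u.
Qed.

Let Vtot1_bounds o v : keep j1 j2 o v ->
  c1 v <= Vtot1 j1 j2 o <= c1 v + mu o v.
Proof.
move=> kv; rewrite /Vtot1 (bigD1 v)//= kv mul1r lerDl lerD2l.
rewrite sumr_ge0 => [|u _]; last first.
  by rewrite mulr_ge0//; have /andP[] := c1_bounds u.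
by apply: ler_sum => u _; rewrite ler_wpM2l//; have /andP[] := c1_bounds u.
Qed.

Let Ex_keep_nu v : Ex (fun o => (keep j1 j2 o v)%:R * nu o v) <=
  rho j1 * rho j2 * (rho j1 * M).
Proof.
under eq_Ex => o do rewrite mulr_sumr.
rewrite Ex_sum; apply: le_trans (_ : \sum_(u | u != par v)
  rho j1 * rho j2 * rho j1 * pc u <= _).
  apply: ler_sum => u uv; under eq_Ex => o do rewrite mulrA.
  by rewrite ExZr Ex_keep_keep1.
rewrite -mulr_sumr mulrA ler_wpM2l ?mulr_ge0 ?(ltW (rho_gt0 _))//.
apply: le_trans sumc; rewrite -sum_pc big_mkcond; apply: ler_sum => u _.
by case: ifP.
Qed.

Let sum_near_c v : \sum_(v' | v' != v)
    (rho j2 * (par v' == par v)%:R + rho j1 * rho j2) * c v' <=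
  rho j2 * pc (par v) + rho j1 * rho j2 * M.
Proof.
apply: le_trans (_ : \sum_v' (rho j2 * (par v' == par v)%:R + rho j1 * rho j2) * c v'
  <= _).
  rewrite big_mkcond; apply: ler_sum => v' _; case: ifP => // _.
  by rewrite mulr_ge0// addr_ge0// mulr_ge0// ltW.
under eq_bigr => v' _ do rewrite mulrDl.
rewrite big_split /=; apply: lerD; last first.
  by rewrite -mulr_sumr ler_wpM2l// mulr_ge0// ltW.
rewrite le_eqVlt; apply/orP; left; apply/eqP; rewrite /pc mulr_sumr [RHS]big_mkcond.
by apply: eq_bigr => v' _; case: eqP; rewrite ?mulr1 ?mulr0 ?mul0r.
Qed.

Let Ex_keep_mu v : Ex (fun o => (keep j1 j2 o v)%:R * mu o v) <=
  rho j1 * rho j2 * (rho j2 * pc (par v) + rho j1 * rho j2 * M).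
Proof.
under eq_Ex => o do rewrite mulr_sumr.
rewrite Ex_sum; apply: le_trans (_ : \sum_(v' | v' != v) rho j1 * rho j2 *
  ((rho j2 * (par v' == par v)%:R + rho j1 * rho j2) * c v') <= _).
  apply: ler_sum => v' vv; under eq_Ex => o do rewrite mulrA.
  by rewrite ExZr mulrA ler_wpM2r// Ex_keep_keep.
by rewrite -mulr_sumr ler_wpM2l ?mulr_ge0 ?(ltW (rho_gt0 _))// sum_near_c.
Qed.

Variable gam : R.
Hypotheses (gam0 : 0 < gam) (gam1 : gam <= 1) (M0 : 0 < M).

(* In expectation the kept points number M 2^-j1 before and M 2^-(j1 + j2) after
   the second sampling: a counter in the window exceeds the expected noise by a
   factor 1 / gam, hence is dominated by a single cell of known dyadic size. *)
Definition lev1 : R := M * rho j1 / gam.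
Definition lev2 : R := M * rho j1 * rho j2 / gam ^+ 2.

Definition window o : bool :=
  (lev1 <= Utot j1 o < 4 * lev1) && (lev2 <= Vtot j1 j2 o < 4 * lev2).

Definition estimate o : R := (window o)%:R * (`|Ztot j1 j2 o| *
  mix (Vtot1 j1 j2 o / Vtot j1 j2 o) (Utot1 j1 o / Utot j1 o)).

Let lev1_gt0 : 0 < lev1. Proof. by rewrite divr_gt0// mulr_gt0. Qed.

Let lev2_gt0 : 0 < lev2.
Proof. by rewrite divr_gt0 ?exprn_gt0// !mulr_gt0. Qed.

Let lev1M : rho j1 * M = gam * lev1.
Proof. by rewrite [RHS]mulrC divfK ?gt_eqF// mulrC. Qed.

Let lev2M : rho j1 * rho j2 * M = gam ^+ 2 * lev2.
Proof.
by rewrite [RHS]mulrC divfK ?gt_eqF ?exprn_gt0// mulrC mulrA.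
Qed.

Let lev12 : rho j2 * lev1 = gam * lev2.
Proof. by rewrite /lev1 /lev2; field; rewrite gt_eqF. Qed.

Let gam2 : gam ^+ 2 <= gam.
Proof. by rewrite expr2 ler_piMl// ltW. Qed.

(** These two ranges bracket the window: a kept cell outside [wide] passes only with noise of at
    least half a level, and a kept [target] cell passes whenever both noises are below their
    levels. *)
Definition wide v : bool := (lev1 / 2 <= pc (par v) < 4 * lev1) &&
  (lev2 / 2 <= c v < 4 * lev2).

Definition target v : bool := (lev1 <= pc (par v) < 2 * lev1) &&
  (lev2 <= c v < 2 * lev2).

Let U1U o : 0 <= Utot1 j1 o <= Utot j1 o.
Proof.
rewrite sumr_ge0 => [|u _]; last by rewrite mulr_ge0//; have /andP[] := pc1_bounds u.
by apply: ler_sum => u _; rewrite ler_wpM2l//; have /andP[] := pc1_bounds u.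
Qed.

Let V1V o : 0 <= Vtot1 j1 j2 o <= Vtot j1 j2 o.
Proof.
rewrite sumr_ge0 => [|u _]; last by rewrite mulr_ge0//; have /andP[] := c1_bounds u.
by apply: ler_sum => u _; rewrite ler_wpM2l//; have /andP[] := c1_bounds u.
Qed.

Let D o := mix (Vtot1 j1 j2 o / Vtot j1 j2 o) (Utot1 j1 o / Utot j1 o).

Let D01 o : 0 <= D o <= 1.
Proof. by rewrite mix_ge0 ?mix_le1 ?frac01. Qed.

Let D_noise o v : keep j1 j2 o v -> lev1 <= Utot j1 o -> lev2 <= Vtot j1 j2 o ->
  `|D o - cellmix v| <= nu o v / lev1 + mu o v / lev2.
Proof.
move=> kv lU lV; have U0 := lt_le_trans lev1_gt0 lU.
have V0 := lt_le_trans lev2_gt0 lV.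
apply: le_trans (mix_lip _ _ _ _) _; rewrite ?frac01// addrC lerD//.
  have /andP[h1 h2] := Utot1_bounds kv.
  apply: le_trans (frac_noise (pc1_bounds _) _ h1 _ U0) _.
  - by rewrite (UtotE kv) lerDl.
  - by rewrite (UtotE kv); lra.
  have -> : Utot j1 o - pc (par v) = nu o v by rewrite (UtotE kv) addrC addKr.
  by rewrite ler_wpM2l// lef_pV2.
have /andP[h1 h2] := Vtot1_bounds kv.
apply: le_trans (frac_noise (c1_bounds _) _ h1 _ V0) _.
- by rewrite (VtotE kv) lerDl.
- by rewrite (VtotE kv); lra.
have -> : Vtot j1 j2 o - c v = mu o v by rewrite (VtotE kv) addrC addKr.
by rewrite ler_wpM2l// lef_pV2.
Qed.

Let absZ_le o : `|Ztot j1 j2 o| <= \sum_v (keep j1 j2 o v)%:R * `|z v|.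
Proof.
rewrite (le_trans (ler_norm_sum _ _ _))//; apply: ler_sum => v _.
by rewrite normrM ger0_norm.
Qed.

Lemma estimate_ge0 o : 0 <= estimate o.
Proof. by rewrite !mulr_ge0//; have /andP[] := D01 o. Qed.

Lemma estimate_le o : estimate o <= 4 * lev2.
Proof.
rewrite /estimate; case: (boolP (window o)) => [/andP[_ /andP[_ Vlt]]|_]; last first.
  by rewrite mul0r mulr_ge0// ltW.
rewrite mul1r; have /andP[d0 d1] := D01 o.
apply: le_trans (_ : `|Ztot j1 j2 o| <= _); first by rewrite ler_piMr.
apply: le_trans (absZ_le o) _; apply: le_trans (ltW Vlt).
by apply: ler_sum => v _; rewrite ler_wpM2l.
Qed.

(** The surplus counter is at most the sum over the kept cells. For a cell outside [wide] the
    trivial bound 1 on the mixture is paid by twice the relative noise, whose expectation gives 2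
    gam from parents and 10 gam from cells. *)
Lemma Ex_estimate_le : 2%:R ^+ (j1 + j2) * Ex estimate <=
  \sum_v `|z v| * ((wide v)%:R * cellmix v + 12 * gam).
Proof.
(* Kept as a factor because the expected noise from siblings is controlled only through the
   population of the parent. *)
pose small v : R := (pc (par v) < 4 * lev1)%R%:R.
have point o v : keep j1 j2 o v -> (window o)%:R * D o <=
    (wide v)%:R * cellmix v
    + small v * (2 / lev1 * nu o v + 2 / lev2 * mu o v).
  move=> kv; have /andP[m0 m1] := cellmix01 v; have /andP[d0 d1] := D01 o.
  have noise0 : 0 <= 2 / lev1 * nu o v + 2 / lev2 * mu o v.
    by rewrite addr_ge0// mulr_ge0// divr_ge0// ltW.
  have rhs0 : 0 <= (wide v)%:R * cellmix v
    + small v * (2 / lev1 * nu o v + 2 / lev2 * mu o v).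
    by rewrite addr_ge0// mulr_ge0.
  rewrite /window; case: (boolP (_ && _)) => [|_]; last by rewrite mul0r.
  move=> /andP[/andP[lU Ul] /andP[lV Vl]]; rewrite mul1r.
  have pcU : pc (par v) <= Utot j1 o by rewrite (UtotE kv) lerDl.
  have cV : c v <= Vtot j1 j2 o by rewrite (VtotE kv) lerDl.
  rewrite /small (le_lt_trans pcU Ul) mul1r.
  have nE : 2 / lev1 * nu o v = 2 * (nu o v / lev1) by rewrite mulrAC mulrA.
  have mE : 2 / lev2 * mu o v = 2 * (mu o v / lev2) by rewrite mulrAC mulrA.
  have n0 : 0 <= nu o v / lev1 by rewrite divr_ge0// ltW.
  have m0' : 0 <= mu o v / lev2 by rewrite divr_ge0// ltW.
  rewrite nE mE; have [w|nw] := boolP (wide v).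
    have := D_noise kv lU lV; rewrite ler_norml => /andP[_ h].
    rewrite mul1r; lra.
  rewrite mul0r add0r; apply: le_trans d1 _.
  move: nw; rewrite /wide (le_lt_trans pcU Ul) (le_lt_trans cV Vl) !andbT.
  rewrite negb_and -!ltNge => /orP[lt1|lt2].
    have : 1 / 2 <= nu o v / lev1.
      by rewrite ler_pdivlMr//; move: lU; rewrite (UtotE kv); lra.
    lra.
  have : 1 / 2 <= mu o v / lev2.
    by rewrite ler_pdivlMr//; move: lV; rewrite (VtotE kv); lra.
  lra.
have -> : 2%:R ^+ (j1 + j2) = (rho j1 * rho j2)^-1 :> R.
  by rewrite exprD invfM !invrK.
rewrite mulrC ler_pdivrMr ?mulr_gt0//.
apply: le_trans (_ : Ex (fun o => \sum_v `|z v| * ((keep j1 j2 o v)%:R *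
   ((wide v)%:R * cellmix v
    + small v * (2 / lev1 * nu o v + 2 / lev2 * mu o v)))) <= _).
  apply: le_Ex => o; rewrite /estimate mulrCA -/(D o).
  have wD0 : 0 <= (window o)%:R * D o by rewrite mulr_ge0//; have /andP[] := D01 o.
  apply: le_trans (ler_wpM2r wD0 (absZ_le o)) _.
  rewrite mulr_suml; apply: ler_sum => v _.
  rewrite -[leLHS]mulrA [leLHS]mulrCA ler_wpM2l//.
  by case: (boolP (keep j1 j2 o v)) => [kv|_]; rewrite ?mul0r// !mul1r point.
rewrite Ex_sum mulr_suml; apply: ler_sum => v _.
rewrite ExZ -mulrA ler_wpM2l//.
have -> : Ex (fun o => (keep j1 j2 o v)%:R * ((wide v)%:R * cellmix v
    + small v * (2 / lev1 * nu o v + 2 / lev2 * mu o v))) =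
    rho j1 * rho j2 * ((wide v)%:R * cellmix v) + small v * (
    2 / lev1 * Ex (fun o => (keep j1 j2 o v)%:R * nu o v)
    + 2 / lev2 * Ex (fun o => (keep j1 j2 o v)%:R * mu o v)).
  rewrite -(Ex_keep v) -ExZr -2!ExZ -ExD -ExZ -ExD; apply: eq_Ex => o; ring.
rewrite [leRHS]mulrC [leRHS]mulrDr lerD2l.
rewrite /small; case: ltP => [pcl|_]; last first.
  by rewrite mul0r !mulr_ge0// ltW.
rewrite mul1r.
have hn : 2 / lev1 * Ex (fun o => (keep j1 j2 o v)%:R * nu o v) <=
    rho j1 * rho j2 * (2 * gam).
  apply: le_trans (ler_wpM2l _ (Ex_keep_nu v)) _; first by rewrite divr_ge0// ltW.
  rewrite lev1M le_eqVlt; apply/orP; left; apply/eqP; field.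
  by rewrite gt_eqF.
have hm : 2 / lev2 * Ex (fun o => (keep j1 j2 o v)%:R * mu o v) <=
    rho j1 * rho j2 * (10 * gam).
  apply: le_trans (ler_wpM2l _ (Ex_keep_mu v)) _; first by rewrite divr_ge0// ltW.
  rewrite mulrCA ler_wpM2l ?mulr_ge0 ?(ltW (rho_gt0 _))//.
  rewrite mulrAC ler_pdivrMr// lev2M.
  have : rho j2 * pc (par v) <= rho j2 * (4 * lev1).
    by rewrite ler_wpM2l ?(ltW (rho_gt0 _))// ltW.
  have : gam ^+ 2 * lev2 <= gam * lev2 by rewrite ler_wpM2r// ltW.
  rewrite [rho j2 * (4 * _)]mulrCA lev12; lra.
by apply: le_trans (lerD hn hm) _; rewrite -mulrDr; lra.
Qed.

(** What a dominating cell [v] guarantees: its true contribution less the error of the two ratios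
    and the surplus of the other kept cells. *)
Let term o v : R := `|z v| * cellmix v
  - `|z v| * (nu o v / lev1 + mu o v / lev2) - zeta o v.

(* At most one target cell can be kept without much noise from the others, and
   then the window test succeeds; all other summands are nonpositive. *)
Let sum_term_le o :
  \sum_(v | target v) (keep j1 j2 o v)%:R * term o v <= estimate o.
Proof.
have term_le0 v : (lev1 <= nu o v) || (lev2 <= mu o v) -> term o v <= 0.
  move=> noisy; have /andP[m0 m1] := cellmix01 v.
  have n0 : 0 <= nu o v / lev1 by rewrite divr_ge0// ltW.
  have m0' : 0 <= mu o v / lev2 by rewrite divr_ge0// ltW.
  have : 1 <= nu o v / lev1 + mu o v / lev2.
    case/orP: noisy => h.
      have : 1 <= nu o v / lev1 by rewrite ler_pdivlMr// mul1r.
      lra.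
    have : 1 <= mu o v / lev2 by rewrite ler_pdivlMr// mul1r.
    lra.
  move=> noise1; have : `|z v| * cellmix v <= `|z v| * (nu o v / lev1 + mu o v / lev2).
    by rewrite ler_wpM2l// (le_trans m1).
  by have := zeta_ge0 o v; rewrite /term; lra.
pose good v := [&& target v, keep j1 j2 o v, nu o v < lev1 & mu o v < lev2].
have bad_le0 v : target v -> ~~ good v -> (keep j1 j2 o v)%:R * term o v <= 0.
  move=> tv; rewrite /good tv /=; case: (keep j1 j2 o v); last by rewrite mul0r.
  by rewrite /= negb_and -!leNgt => /term_le0; rewrite mul1r.
have [v0 /= gv0|nogood] := pickP good; last first.
  apply: le_trans (estimate_ge0 o); apply: sumr_le0 => v tv.
  by apply: bad_le0 => //; rewrite nogood.
have /and4P[tv0 kv0 nuv0 muv0] := gv0.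
have [/andP[pc1v pc2v] /andP[c1v c2v]] := andP tv0.
have other v : target v -> v != v0 -> (keep j1 j2 o v)%:R * term o v <= 0.
  move=> tv vv0; case: (boolP (keep j1 j2 o v)) => [kv|_]; last by rewrite mul0r.
  rewrite mul1r; apply: term_le0; apply/orP.
  have [/andP[lpc _] /andP[lc _]] := andP tv.
  have [pv|pv] := eqVneq (par v0) (par v).
    right; apply: le_trans c1v _; rewrite /mu (bigD1 v0)/= 1?eq_sym//.
    by rewrite kv0 mul1r lerDl sumr_ge0// => v' _; rewrite mulr_ge0.
  left; apply: le_trans pc1v _; rewrite /nu (bigD1 (par v0))//=.
  have /andP[-> _] := kv0.
  by rewrite mul1r lerDl sumr_ge0// => v' _; rewrite mulr_ge0.
rewrite (bigD1 v0)//= kv0 mul1r.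
apply: le_trans (_ : term o v0 + 0 <= _).
  by rewrite lerD2l; apply: sumr_le0 => v /andP[tv vv0]; exact: other.
rewrite addr0.
have wo : window o.
  rewrite /window (UtotE kv0) (VtotE kv0).
  have := nu_ge0 o v0; have := mu_ge0 o v0; move=> h1 h2.
  by apply/andP; split; apply/andP; split; lra.
rewrite /estimate wo mul1r -/(D o).
have [/andP[lU _] /andP[lV _]] := andP wo.
have := D_noise kv0 lU lV; rewrite ler_norml => /andP[hD _].
have /andP[d0 d1] := D01 o.
have hZ : `|z v0| - zeta o v0 <= `|Ztot j1 j2 o|.
  rewrite /Ztot (bigD1 v0)//= kv0 mul1r.
  set S := \sum_(i | _) _.
  have hS : `|S| <= zeta o v0.
    rewrite (le_trans (ler_norm_sum _ _ _))//; apply: ler_sum => v _.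
    by rewrite normrM ger0_norm.
  have := ler_normB (z v0 + S) S; rewrite addrK.
  lra.
have h1 : (`|z v0| - zeta o v0) * D o <= `|Ztot j1 j2 o| * D o by rewrite ler_wpM2r.
have h2 : zeta o v0 * D o <= zeta o v0 by rewrite ler_piMr.
have h3 : `|z v0| * (cellmix v0 - (nu o v0 / lev1 + mu o v0 / lev2)) <= `|z v0| * D o.
  by rewrite ler_wpM2l//; lra.
move: h1 h3; rewrite /term mulrBl mulrBr; lra.
Qed.

(** Each target child takes at least [lev2] of a parent population below 2 * lev1. This limits how
    often the surplus of one cell counts as noise for its siblings. *)
Let card_target_par u :
  lev2 * \sum_(v | target v && (par v == u)) 1 <= 2 * lev1.
Proof.
have [v0 /= /andP[tv0 /eqP pv0]|no] := pickP [pred v | target v && (par v == u)];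
  last first.
  by rewrite big_pred0// mulr0 mulr_ge0// ltW.
apply: le_trans (_ : pc u <= _); last first.
  by move: tv0; rewrite /target pv0 => /andP[/andP[_ /ltW]].
rewrite mulr_sumr /pc big_mkcond [leRHS]big_mkcond; apply: ler_sum => v _.
rewrite /target; case: (par v == u); rewrite ?andbT ?andbF//.
case: ifP => // /andP[_ /andP[h _]]; by rewrite mulr1.
Qed.

Let card_target : lev2 * \sum_(v | target v) 1 <= M.
Proof.
apply: le_trans sumc; rewrite mulr_sumr big_mkcond; apply: ler_sum => v _.
by rewrite /target; case: ifP => // /andP[_ /andP[h _]]; rewrite mulr1.
Qed.

Let Ex_keep_zeta v : Ex (fun o => (keep j1 j2 o v)%:R * zeta o v) <=
  rho j1 * rho j2 * \sum_v' `|z v'| * (rho j2 * (par v' == par v)%:R + rho j1 * rho j2).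
Proof.
under eq_Ex => o do rewrite mulr_sumr.
rewrite Ex_sum mulr_sumr big_mkcond; apply: ler_sum => v' _.
case: ifP => [vv|_]; last first.
  by rewrite !mulr_ge0// ?addr_ge0 ?mulr_ge0 ?(ltW (rho_gt0 _)).
under eq_Ex => o do rewrite mulrA.
rewrite ExZr mulrC [leRHS]mulrCA ler_wpM2l//; exact: Ex_keep_keep.
Qed.

(** Of the factor 7, 4 is the error of the ratios and 3 comes from foreign surpluses: after
    exchanging the sums, a cell disturbs its target siblings at cost 2 gam and target cells in
    general at cost gam. *)
Lemma Ex_estimate_ge :
  \sum_(v | target v) `|z v| * cellmix v - 7 * gam * \sum_v `|z v| <=
  2%:R ^+ (j1 + j2) * Ex estimate.
Proof.
have -> : 2%:R ^+ (j1 + j2) = (rho j1 * rho j2)^-1 :> R.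
  by rewrite exprD invfM !invrK.
rewrite [leRHS]mulrC ler_pdivlMr ?mulr_gt0//.
apply: le_trans (le_Ex sum_term_le); rewrite Ex_sum.
have rr0 : 0 < rho j1 * rho j2 by rewrite mulr_gt0.
have step v : target v -> (rho j1 * rho j2) * (`|z v| * cellmix v - 4 * gam * `|z v|
    - \sum_v' `|z v'| * (rho j2 * (par v' == par v)%:R + rho j1 * rho j2)) <=
    Ex (fun o => (keep j1 j2 o v)%:R * term o v).
  move=> /andP[/andP[_ pcl] _].
  have -> : Ex (fun o => (keep j1 j2 o v)%:R * term o v) =
      rho j1 * rho j2 * (`|z v| * cellmix v)
      - `|z v| * (Ex (fun o => (keep j1 j2 o v)%:R * nu o v) / lev1
                  + Ex (fun o => (keep j1 j2 o v)%:R * mu o v) / lev2)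
      - Ex (fun o => (keep j1 j2 o v)%:R * zeta o v).
    rewrite -(Ex_keep v) -!ExZr -ExD -ExZ -2!ExB; apply: eq_Ex => o.
    by rewrite /term; ring.
  have hn : Ex (fun o => (keep j1 j2 o v)%:R * nu o v) / lev1 <=
      rho j1 * rho j2 * gam.
    rewrite ler_pdivrMr//; apply: le_trans (Ex_keep_nu v) _.
    by rewrite lev1M mulrA.
  have hm : Ex (fun o => (keep j1 j2 o v)%:R * mu o v) / lev2 <=
      rho j1 * rho j2 * (3 * gam).
    rewrite ler_pdivrMr//; apply: le_trans (Ex_keep_mu v) _.
    rewrite -[leRHS]mulrA ler_wpM2l ?(ltW rr0)// lev2M.
    have : rho j2 * pc (par v) <= rho j2 * (2 * lev1).
      by rewrite ler_wpM2l ?(ltW (rho_gt0 _))// ltW.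
    have : gam ^+ 2 * lev2 <= gam * lev2 by rewrite ler_wpM2r// ltW.
    rewrite [rho j2 * (2 * _)]mulrCA lev12; lra.
  have hz := Ex_keep_zeta v.
  have hnm : `|z v| * (Ex (fun o => (keep j1 j2 o v)%:R * nu o v) / lev1
      + Ex (fun o => (keep j1 j2 o v)%:R * mu o v) / lev2) <=
      `|z v| * (rho j1 * rho j2 * (4 * gam)).
    by rewrite ler_wpM2l//; apply: le_trans (lerD hn hm) _; lra.
  rewrite !mulrBr; apply: lerB => //; apply: lerB => //.
  by apply: le_trans hnm _; rewrite le_eqVlt; apply/orP; left; apply/eqP; ring.
apply: le_trans (ler_sum _ step); rewrite -mulr_sumr mulrC ler_wpM2l ?(ltW rr0)//.
rewrite !sumrB -addrA lerD2l.
have h1 : \sum_(v | target v) 4 * gam * `|z v| <= 4 * gam * \sum_v `|z v|.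
  rewrite mulr_sumr big_mkcond; apply: ler_sum => v _.
  by case: ifP => // _; rewrite !mulr_ge0// ltW.
have h2 : \sum_(v | target v) \sum_v' `|z v'| *
    (rho j2 * (par v' == par v)%:R + rho j1 * rho j2) <= 3 * gam * \sum_v `|z v|.
  rewrite exchange_big /= mulr_sumr; apply: ler_sum => v' _.
  rewrite -mulr_sumr mulrC ler_wpM2r//.
  rewrite big_split /= -!mulr_sumr.
  have -> : \sum_(v | target v) (par v' == par v)%:R =
      \sum_(v | target v && (par v == par v')) 1 :> R.
    rewrite [RHS]big_mkcondr; apply: eq_bigr => v _.
    by rewrite eq_sym; case: eqP.
  have c1' : rho j2 * \sum_(v | target v && (par v == par v')) 1 <= 2 * gam.
    rewrite -(ler_pM2r lev2_gt0) -mulrA [_ * lev2]mulrC -(mulrA 2) -lev12.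
    by rewrite [leRHS]mulrCA ler_wpM2l ?(ltW (rho_gt0 _)).
  have c2' : rho j1 * rho j2 * \sum_(v | target v) 1 <= gam.
    apply: le_trans gam2; rewrite -(ler_pM2r lev2_gt0) -lev2M.
    by rewrite -[leLHS]mulrA ler_wpM2l ?(ltW rr0)// mulrC.
  have -> : rho j1 * \sum_(i | target i) rho j2 =
      rho j1 * rho j2 * \sum_(v | target v) 1 :> R.
    by rewrite -mulrA !mulr_sumr; apply: eq_bigr => i _; rewrite mulr1.
  lra.
move: h1 h2; set S1 := \sum_(v | target v) _; set S2 := \sum_(v | target v) _.
set S3 := \sum_v _; lra.
Qed.

End Sampling.

(** * Summation over all pairs of dyadic rates *)

Section Dyadic.
Variable R : realType.

(** The condition confines A / 2^j to the range from c / 4 to 2 c, whose ends have ratio 8 and of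
    which one is excluded: only the least admissible index and the next two qualify. *)
Lemma dyadic_count (A c : R) n : 0 < A ->
  \sum_(j < n) ((A / 2%:R ^+ j / 2 <= c) && (c < 4 * (A / 2%:R ^+ j)))%R%:R <= 3 :> R.
Proof.
move=> A0; pose P j := (A / 2%:R ^+ j / 2 <= c) && (c < 4 * (A / 2%:R ^+ j)).
have p2 j : (0 : R) < 2%:R ^+ j by rewrite exprn_gt0.
have [j0 Pj0|noP] := pickP (fun j : 'I_n => P j); last first.
  by rewrite big1// => j _; have := noP j; rewrite /P => ->.
have exP : exists j, P j by exists j0.
pose m := ex_minn exP.
have [Pm minm] : P m /\ forall j, P j -> (m <= j)%N by rewrite /m; case: ex_minnP.
have bound j : P j -> (m <= j < m + 3)%N.
  move=> Pj; rewrite (minm _ Pj)/=; rewrite ltnNge; apply/negP => mj.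
  have /andP[h1 _] := Pm; have /andP[_ h2] := Pj.
  have : A / 2%:R ^+ j <= A / 2%:R ^+ (m + 3).
    by rewrite ler_wpM2l ?(ltW A0)// lef_pV2 ?posrE// ler_eXn2l ?ltr1n.
  have -> : A / 2%:R ^+ (m + 3) = A / 2%:R ^+ m / 8.
    by rewrite exprD invfM mulrA; congr (_ / _); rewrite -natrX.
  lra.
apply: le_trans (_ : \sum_(j < n) (m <= j < m + 3)%N%:R <= _).
  apply: ler_sum => j _; rewrite -/(P j).
  by case: (boolP (P j)) => // /bound->.
rewrite -natr_sum (ler_nat _ _ 3).
suff -> : \sum_(j < n) ((m <= j < m + 3)%N : nat) = minn (n - m) 3 by exact: geq_minr.
elim: n {j0 Pj0 exP m Pm minm bound} (m) => [|n IHn] m'; first by rewrite big_ord0; lia.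
by rewrite big_ord_recr /= IHn; case: (boolP (m' <= n < m' + 3)%N); lia.
Qed.

Lemma dyadic_exists (A c : R) n : c < 2 * A -> A / 2%:R ^+ n <= c ->
  exists2 j, (j <= n)%N & A / 2%:R ^+ j <= c < 2 * (A / 2%:R ^+ j).
Proof.
move=> cA; elim: n => [|n IHn] cn.
  by exists 0%N => //; move: cn; rewrite expr0 divr1 => ->.
have [c'|c'] := leP (A / 2%:R ^+ n) c.
  by have [j jn jP] := IHn c'; exists j => //; exact: leqW.
exists n.+1 => //; rewrite cn/=.
by have -> : 2 * (A / 2%:R ^+ n.+1) = A / 2%:R ^+ n
  by rewrite exprS; field; rewrite expf_neq0.
Qed.

End Dyadic.

Section SamplingTotal.
Variables (R : realType) (K : finType) (J g : nat) (par : K -> K).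
Variables (c c1 z : K -> R) (M : R).
Hypotheses (c1_bounds : forall v, 0 <= c1 v <= c v).
Hypotheses (z_le : forall v, `|z v| <= c v) (sumc : \sum_v c v <= M).
Hypotheses (c_int : forall v, c v = 0 \/ 1 <= c v) (M0 : 0 < M).
Hypothesis MJ : M * 2%:R ^+ g <= 2%:R ^+ J.

Let gam : R := (2%:R ^+ g)^-1.
Let p2_gt0 k : (0 : R) < 2%:R ^+ k. Proof. by rewrite exprn_gt0. Qed.
Let gam0 : 0 < gam. Proof. by rewrite invr_gt0. Qed.
Let gam1 : gam <= 1. Proof. by rewrite invf_le1// exprn_ege1// ler1n. Qed.

Definition estimate2 j1 j2 (o : labels K J) : R :=
  2%:R ^+ (j1 + j2) * estimate par c c1 z M j1 j2 gam o.

Definition estimate_sum (o : labels K J) : R :=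
  \sum_(j1 < J.+1) \sum_(j2 < J.+1) estimate2 j1 j2 o.

Let pc_ge v : c v <= pc par c (par v).
Proof.
rewrite /pc (bigD1 v)//= lerDl sumr_ge0// => v' _.
by have /andP[h1 h2] := c1_bounds v'; exact: le_trans h2.
Qed.

Let pc_le u : pc par c u <= M.
Proof.
apply: le_trans sumc; rewrite /pc big_mkcond; apply: ler_sum => v _.
by case: ifP => // _; have /andP[h1 h2] := c1_bounds v; exact: le_trans h2.
Qed.

Let cellmix_ge0' v : 0 <= cellmix par c c1 v.
Proof.
have fr (a b : R) : 0 <= a <= b -> 0 <= a / b <= 1.
  move=> /andP[a0 ab]; have b0 := le_trans a0 ab; rewrite divr_ge0//=.
  have [->|bn0] := eqVneq b 0; first by rewrite invr0 mulr0.
  by rewrite ler_pdivrMr ?mul1r// lt_neqAle eq_sym bn0.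
apply: mix_ge0; apply: fr => //; rewrite sumr_ge0 => [|v' _]; last first.
  by have /andP[] := c1_bounds v'.
by apply: ler_sum => v' _; have /andP[] := c1_bounds v'.
Qed.

Let Ex_estimate_sum : Ex estimate_sum = \sum_(j1 < J.+1) \sum_(j2 < J.+1)
  2%:R ^+ (j1 + j2) * Ex (estimate (J := J) par c c1 z M j1 j2 gam).
Proof.
rewrite /estimate_sum Ex_sum; apply: eq_bigr => j1 _.
by rewrite Ex_sum; apply: eq_bigr => j2 _; rewrite ExZ.
Qed.

Lemma estimate_sum_ge0 o : 0 <= estimate_sum o.
Proof.
apply: sumr_ge0 => j1 _; apply: sumr_ge0 => j2 _.
by rewrite mulr_ge0 ?(ltW (p2_gt0 _))//; exact: estimate_ge0.
Qed.

Lemma estimate_sum_le o :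
  estimate_sum o <= J.+1%:R ^+ 2 * (4 * M * (2%:R ^+ g) ^+ 2).
Proof.
have -> : J.+1%:R ^+ 2 * (4 * M * (2%:R ^+ g) ^+ 2) =
    \sum_(j1 < J.+1) \sum_(j2 < J.+1) (4 * M * (2%:R ^+ g) ^+ 2) :> R.
  by rewrite !sumr_const !card_ord -mulrnA -[RHS]mulr_natl natrM expr2.
apply: ler_sum => j1 _; apply: ler_sum => j2 _.
rewrite /estimate2.
apply: le_trans (ler_wpM2l (ltW (p2_gt0 _)) (@estimate_le R K J par c c1 z M
  c1_bounds z_le j1 j2 gam gam0 M0 o)) _.
rewrite le_eqVlt; apply/orP; left; apply/eqP; rewrite /lev2 /gam exprD.
by field; rewrite !gt_eqF.
Qed.

Lemma Ex_estimate_sum_le : Ex estimate_sum <=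
  \sum_v `|z v| * (9 * cellmix par c c1 v) +
  12 * J.+1%:R ^+ 2 * gam * \sum_v `|z v|.
Proof.
rewrite Ex_estimate_sum.
apply: le_trans (_ : \sum_(j1 < J.+1) \sum_(j2 < J.+1) \sum_v `|z v| *
  ((wide par c M j1 j2 gam v)%:R * cellmix par c c1 v + 12 * gam) <= _).
  apply: ler_sum => j1 _; apply: ler_sum => j2 _.
  by apply: Ex_estimate_le => //; rewrite -ltnS.
rewrite (eq_bigr (fun j1 : 'I_J.+1 => \sum_v \sum_(j2 < J.+1) `|z v| *
  ((wide par c M j1 j2 gam v)%:R * cellmix par c c1 v + 12 * gam))); last first.
  by move=> j1 _; rewrite exchange_big.
rewrite exchange_big /= mulr_sumr -big_split; apply: ler_sum => v _ /=.
have mix0 := cellmix_ge0' v.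
have -> : \sum_(j1 < J.+1) \sum_(j2 < J.+1) `|z v| *
    ((wide par c M j1 j2 gam v)%:R * cellmix par c c1 v + 12 * gam) =
    `|z v| * ((\sum_(j1 < J.+1) \sum_(j2 < J.+1) (wide par c M j1 j2 gam v)%:R)
      * cellmix par c c1 v + J.+1%:R ^+ 2 * (12 * gam)).
  have -> : J.+1%:R ^+ 2 * (12 * gam) =
      \sum_(j1 < J.+1) \sum_(j2 < J.+1) 12 * gam :> R.
    by rewrite !sumr_const !card_ord -mulrnA -[RHS]mulr_natl natrM expr2.
  rewrite mulr_suml -big_split mulr_sumr; apply: eq_bigr => j1 _ /=.
  by rewrite mulr_suml -big_split mulr_sumr.
have count9 : \sum_(j1 < J.+1) \sum_(j2 < J.+1) (wide par c M j1 j2 gam v)%:R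
    <= 9 :> R.
  pose A := M / gam.
  have A0 : 0 < A by rewrite divr_gt0.
  have l1E (j1 : 'I_J.+1) : lev1 M j1 gam = A / 2%:R ^+ j1.
    by rewrite /lev1 mulrAC.
  have l2E (j1 j2 : 'I_J.+1) : lev2 M j1 j2 gam = (lev1 M j1 gam / gam) / 2%:R ^+ j2.
    by rewrite /lev2 /lev1; field; rewrite ?gt_eqF.
  apply: le_trans (_ : \sum_(j1 < J.+1) ((A / 2%:R ^+ j1 / 2 <= pc par c (par v))
    && (pc par c (par v) < 4 * (A / 2%:R ^+ j1)))%R%:R * 3 <= _).
    apply: ler_sum => j1 _; rewrite /wide -l1E.
    case: (_ && _); last by rewrite mul0r big1.
    rewrite mul1r; under eq_bigr => j2 _ do rewrite l2E.
    by apply: dyadic_count; rewrite l1E !divr_gt0.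
  rewrite -mulr_suml; have := dyadic_count (pc par c (par v)) J.+1 A0; lra.
have h := ler_wpM2r mix0 count9.
rewrite -[X in _ <= _ + X]mulrC -mulrDr ler_wpM2l//.
by apply: le_trans (lerD h (lexx _)) _; lra.
Qed.

Lemma Ex_estimate_sum_ge :
  \sum_v `|z v| * cellmix par c c1 v -
  7 * J.+1%:R ^+ 2 * gam * \sum_v `|z v| <= Ex estimate_sum.
Proof.
rewrite Ex_estimate_sum.
apply: le_trans (_ : \sum_(j1 < J.+1) \sum_(j2 < J.+1)
  (\sum_(v | target par c M j1 j2 gam v) `|z v| * cellmix par c c1 v
   - 7 * gam * \sum_v `|z v|) <= _); last first.
  apply: ler_sum => j1 _; apply: ler_sum => j2 _.
  by apply: Ex_estimate_ge => //; rewrite -ltnS.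
rewrite (eq_bigr (fun j1 : 'I_J.+1 => \sum_(j2 < J.+1)
   \sum_(v | target par c M j1 j2 gam v) `|z v| * cellmix par c c1 v
   - \sum_(j2 < J.+1) 7 * gam * \sum_v `|z v|)); last first.
  by move=> j1 _; rewrite sumrB.
rewrite sumrB.
have -> : \sum_(j1 < J.+1) \sum_(j2 < J.+1) 7 * gam * \sum_v `|z v| =
    7 * J.+1%:R ^+ 2 * gam * \sum_v `|z v|.
  rewrite !sumr_const !card_ord -mulrnA -[LHS]mulr_natl natrM expr2; ring.
rewrite lerD2r.
rewrite (eq_bigr (fun j1 : 'I_J.+1 => \sum_v \sum_(j2 < J.+1)
   (target par c M j1 j2 gam v)%:R * (`|z v| * cellmix par c c1 v))); last first.
  move=> j1 _; rewrite exchange_big /=; apply: eq_bigr => j2 _.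
  by rewrite big_mkcond; apply: eq_bigr => v _; case: (target _ _ _ _ _ _ _);
     rewrite ?mul1r ?mul0r.
rewrite exchange_big /=; apply: ler_sum => v _.
have t0 : 0 <= `|z v| * cellmix par c c1 v by rewrite mulr_ge0// cellmix_ge0'.
have tt0 j1 j2 : 0 <= (target par c M j1 j2 gam v)%:R * (`|z v| * cellmix par c c1 v).
  by rewrite mulr_ge0.
have [c0|cv1] := c_int v.
  have -> : `|z v| = 0 by apply/le_anti; rewrite normr_ge0 andbT -c0 z_le.
  by rewrite !mul0r sumr_ge0// => j1 _; rewrite sumr_ge0// => j2 _; rewrite mulr0.
(* A nonempty cell has at least one point and M / gam <= 2^J, so the dyadic ranges reach down to 1,
   first for the parent and then for the cell: the cell is a target for some pair of rates. *)
pose A := M / gam.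
have A0 : 0 < A by rewrite divr_gt0.
have AM : M <= A by rewrite ler_pdivlMr// ler_piMr// ltW.
have AJ : A / 2%:R ^+ J <= 1 by rewrite ler_pdivrMr// mul1r /A invrK.
have pM := pc_le (par v); have p1 := le_trans cv1 (pc_ge v).
have [||j1 j1J j1P] := @dyadic_exists R A (pc par c (par v)) J; [lra|lra|].
pose A2 := (A / 2%:R ^+ j1) / gam.
have A1M : A / 2%:R ^+ j1 <= M by have /andP[h _] := j1P; exact: le_trans h pM.
have A10 : 0 < A / 2%:R ^+ j1 by rewrite divr_gt0.
have A2ge : A / 2%:R ^+ j1 <= A2 by rewrite ler_pdivlMr// ler_piMr// ltW.
have A2J : A2 / 2%:R ^+ J <= 1.
  by apply: le_trans AJ; rewrite !ler_wpM2r// invr_ge0 ltW.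
have [||j2 j2J j2P] := @dyadic_exists R A2 (c v) J.
  by have := pc_ge v; have /andP[_ h] := j1P; lra.
  by lra.
have l1E : lev1 M j1 gam = A / 2%:R ^+ j1 by rewrite /lev1 mulrAC.
have l2E : lev2 M j1 j2 gam = A2 / 2%:R ^+ j2.
  by rewrite /A2 /A /lev2; field; rewrite ?gt_eqF.
rewrite -ltnS in j1J; rewrite -ltnS in j2J.
rewrite (bigD1 (Ordinal j1J))//= (bigD1 (Ordinal j2J))//=.
rewrite /target l1E l2E j1P j2P mul1r -addrA lerDl addr_ge0//.
  by rewrite sumr_ge0// => j _; rewrite mulr_ge0.
by rewrite sumr_ge0// => i _; rewrite sumr_ge0// => j _; rewrite mulr_ge0.
Qed.

End SamplingTotal.

(** * The estimate of one copy *)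

Section Copy.
Variables (R : realType) (d T f J g : nat) (s t : seq (cube d)).

Implicit Type w : {ffun 'I_d -> 'I_(2 ^ T)}.

Let e := f.+2.
Let X := s ++ t.
Let M : R := (size X)%:R.

(** One draw of labels and bits serves all levels and rates. Only the mean and the range of a copy
    are used later, so no independence between levels is needed. *)
Definition copy : finType :=
  ({ffun 'I_d -> 'I_(2 ^ T)} * (bits_space d T e * labels (cube d) J))%type.

Definition bitcnt w (o : bits_space d T e) k v : R :=
  \sum_(x <- X | lkey w k x == v) (hbit o k x)%:R.

Definition signed_disc w k v : R :=
  cellcnt (lkey w k) s v - cellcnt (lkey w k) t v.

Definition copy_level w o k (l : labels (cube d) J) : R :=
  estimate_sum g (lkey w k.+1) (cellcnt (lkey w k) X) (bitcnt w o k)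
    (signed_disc w k) M l.

Definition copy_estimate (om : copy) : R :=
  \sum_(k < T.+1) 2%:R ^+ (k + e) * copy_level om.1 om.2.1 k om.2.2.

Let sX : {subset s <= X}. Proof. by move=> x; rewrite mem_cat => ->. Qed.
Let tX : {subset t <= X}. Proof. by move=> x; rewrite mem_cat orbC => ->. Qed.

Let bit_bounds w o k v : 0 <= bitcnt w o k v <= cellcnt (lkey w k) X v.
Proof.
rewrite sumr_ge0//= cellcntE; apply: ler_sum => x _.
by rewrite lern1 leq_b1.
Qed.

Let z_bounds w k v : `|signed_disc w k v| <= cellcnt (lkey w k) X v.
Proof.
rewrite (le_trans (ler_normB _ _))// !ger0_norm ?cellcnt_ge0//.
by rewrite cellcnt_cat.
Qed.

Let sum_cnt w k : \sum_v cellcnt (lkey w k) X v <= M.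
Proof.
have := @sum_by_key R (cube d) (lkey w k) X (fun=> 1).
under [X in _ = X -> _]eq_bigr => v _ do rewrite mulr1.
move=> <-; rewrite big_const_seq count_predT iter_addr_0.
by rewrite /M.
Qed.

Let cnt_int w k v : cellcnt (lkey w k) X v = 0 :> R \/ 1 <= cellcnt (lkey w k) X v :> R.
Proof.
rewrite /cellcnt; case: (count _ _) => [|m]; [by left|right].
by rewrite (ler_nat _ 1).
Qed.

Lemma pc_cellcnt w k (F : cube d -> R) u :
  pc (lkey w k.+1) (fun v => \sum_(x <- X | lkey w k x == v) F x) u =
  \sum_(x <- X | lkey w k.+1 x == u) F x.
Proof.
rewrite /pc (exchange_big_dep (fun x => lkey w k.+1 x == u))/=; last first.
  by move=> v x /eqP <- /eqP <-; rewrite lkeyK.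
apply: eq_bigr => x xu; rewrite (big_pred1 (lkey w k x))// => v.
rewrite andbC /= [RHS]eq_sym; case: eqP => //= <-.
by rewrite lkeyK.
Qed.

(** The indicator that two bits differ is affine in each of them, so its double average is
    determined by the fractions of bit 1 in the cell and in its parent, which linear counters
    supply. *)
Lemma cellmix_edge w o k x : x \in X ->
  cellmix (lkey w k.+1) (cellcnt (lkey w k) X) (bitcnt w o k) (lkey w k x) =
  edge_weight X (lkey w) (fun x y => (hbit o k x != hbit o k y)%:R) k (lkey w k x).
Proof.
move=> xX; rewrite /cellmix /pc1 -[\sum_(v | _) bitcnt w o k v]/(pc _ _ _).
have pcE : pc (lkey w k.+1) (cellcnt (lkey w k) X) (lkey w k.+1 (lkey w k x)) =
    cellcnt (lkey w k.+1) X (lkey w k.+1 x) :> R.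
  have := pc_cellcnt w k (fun=> 1) (lkey w k.+1 x).
  rewrite -cellcntE lkeyK// => <-; rewrite /pc.
  by apply: eq_bigr => v _; rewrite cellcntE.
rewrite pcE (pc_cellcnt w k (fun x => (hbit o k x)%:R)) lkeyK//.
rewrite /edge_weight lkeyK//.
pose be := cellavg X (lkey w k.+1) (lkey w k.+1 x) (fun y => (hbit o k y)%:R) : R.
pose a := cellavg X (lkey w k) (lkey w k x) (fun y => (hbit o k y)%:R) : R.
have -> : (fun x0 => cellavg X (lkey w k.+1) (lkey w k.+1 x)
    (fun y => (hbit o k x0 != hbit o k y)%:R)) =
    (fun x0 => be + (1 - 2 * be) * (hbit o k x0)%:R) :> (_ -> R).
  apply/funext => x0.
  have -> : (fun y => (hbit o k x0 != hbit o k y)%:R) =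
    (fun y => (hbit o k x0)%:R + (1 - 2 * (hbit o k x0)%:R) * (hbit o k y)%:R) :> (_ -> R).
    by apply/funext => y; case: (hbit o k x0) (hbit o k y) => [] [] /=; lra.
  rewrite cellavgD cellavgZ -/be cellavg_cst//; lra.
rewrite -[LHS]/(mix a be) cellavgD (cellavgZ _ _ _ (1 - 2 * be)) cellavg_cst//.
by rewrite -/a /mix; ring.
Qed.

Let disc_cellmix w o k v :
  `|signed_disc w k v| * cellmix (lkey w k.+1) (cellcnt (lkey w k) X) (bitcnt w o k) v =
  disc (lkey w k) s t v *
  edge_weight X (lkey w) (fun x y => (hbit o k x != hbit o k y)%:R) k v.
Proof.
have [/hasP[x xX /eqP<-]|/hasPn nX] := boolP (has (fun x => lkey w k x == v) X).
  by rewrite cellmix_edge.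
by rewrite -/(disc _ _ _ _) (disc_eq0 _ sX tX nX) !mul0r.
Qed.

Let gam : R := (2%:R ^+ g)^-1.

Lemma Ex_copy_level_le w o k : (0 < size X)%N ->
  Ex (copy_level w o k) <=
  9 * level_cost X (lkey w) (fun x y => (hbit o k x != hbit o k y)%:R) s t k
  + 12 * J.+1%:R ^+ 2 * gam * \sum_v disc (lkey w k) s t v.
Proof.
move=> X0; have M0 : 0 < M by rewrite ltr0n.
apply: le_trans (Ex_estimate_sum_le J g (lkey w k.+1) (signed_disc w k)
  (bit_bounds w o k) (sum_cnt w k) M0) _.
rewrite lerD2r /level_cost mulr_sumr; apply: ler_sum => v _.
by rewrite mulrCA disc_cellmix.
Qed.

Lemma Ex_copy_level_ge w o k : (0 < size X)%N -> M * 2%:R ^+ g <= 2%:R ^+ J ->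
  level_cost X (lkey w) (fun x y => (hbit o k x != hbit o k y)%:R) s t k
  - 7 * J.+1%:R ^+ 2 * gam * \sum_v disc (lkey w k) s t v <=
  Ex (copy_level w o k).
Proof.
move=> X0 MJ; have M0 : 0 < M by rewrite ltr0n.
apply: le_trans (Ex_estimate_sum_ge (lkey w k.+1) (bit_bounds w o k) (z_bounds w k)
  (sum_cnt w k) (cnt_int w k) M0 MJ).
rewrite lerD2r /level_cost; apply: ler_sum => v _.
by rewrite disc_cellmix.
Qed.

Lemma copy_estimate_ge0 om : 0 <= copy_estimate om.
Proof.
apply: sumr_ge0 => k _; rewrite mulr_ge0 ?exprn_ge0//.
exact: estimate_sum_ge0.
Qed.

Lemma copy_estimate_le om : (0 < size X)%N ->
  copy_estimate om <= T.+1%:R * 2%:R ^+ (T + e) *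
    (J.+1%:R ^+ 2 * (4 * M * (2%:R ^+ g) ^+ 2)).
Proof.
move=> X0; have M0 : 0 < M by rewrite ltr0n.
apply: le_trans (_ : \sum_(k < T.+1) 2%:R ^+ (T + e) *
    (J.+1%:R ^+ 2 * (4 * M * (2%:R ^+ g) ^+ 2)) <= _); last first.
  by rewrite sumr_const card_ord -[leLHS]mulr_natl mulrA.
apply: ler_sum => k _; apply: ler_pM.
- exact: exprn_ge0.
- exact: estimate_sum_ge0.
- by rewrite ler_eXn2l ?ltr1n// leq_add2r -ltnS.
- exact: estimate_sum_le.
Qed.

Lemma Ex_copy_estimate : Ex copy_estimate = Ex (fun w => \sum_(k < T.+1)
  2%:R ^+ (k + e) * Ex (fun o => Ex (copy_level w o k))).
Proof.
rewrite (Ex_pair (fun w (ol : bits_space d T e * labels (cube d) J) =>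
  \sum_(k < T.+1) 2%:R ^+ (k + e) * copy_level w ol.1 k ol.2)).
apply: eq_Ex => w; rewrite Ex_sum; apply: eq_bigr => k _.
by rewrite ExZ (Ex_pair (fun o l => copy_level w o k l)).
Qed.

Let bits_gt0 : (0 < #|bits_space d T e|)%N.
Proof. by rewrite card_prod !card_ffun card_ord card_bool muln_gt0 !expn_gt0. Qed.

Lemma Ex_level_cost_bit w k : (k <= T)%N ->
  2%:R ^+ (k + e) * Ex (fun o : bits_space d T e =>
    level_cost X (lkey w) (fun x y => (hbit o k x != hbit o k y)%:R) s t k) =
  level_cost X (lkey w) (surrogate R f k) s t k.
Proof.
move=> kT; rewrite -ExZ /level_cost.
transitivity (\sum_v disc (lkey w k) s t v * (2%:R ^+ (k + e) *
  Ex (fun o : bits_space d T e => edge_weight X (lkey w)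
    (fun x y => (hbit o k x != hbit o k y)%:R) k v)) : R).
  rewrite ExZ Ex_sum mulr_sumr; apply: eq_bigr => v _.
  by rewrite ExZ mulrCA.
apply: eq_bigr => v _; rewrite Ex_edge_weight -edge_weightZ.
congr (_ * edge_weight _ _ _ _ _); apply/funext => x; apply/funext => y.
by rewrite Ex_hbit.
Qed.

Let SD w k : R := \sum_v disc (lkey w k) s t v.

Let noise (c : R) : R := Ex (fun w => \sum_(k < T.+1)
  2%:R ^+ (k + e) * (c * J.+1%:R ^+ 2 * gam * SD w k)).

Lemma Ex_copy_le : (0 < size X)%N ->
  Ex copy_estimate <=
  9 * Ex (fun w => \sum_(k < T.+1) level_cost X (lkey w) (surrogate R f k) s t k)
  + noise 12.
Proof.
move=> X0; rewrite Ex_copy_estimate -ExZ -ExD; apply: le_Ex => w.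
rewrite mulr_sumr -big_split; apply: ler_sum => k _ /=.
apply: le_trans (ler_wpM2l _ (le_Ex (fun o => Ex_copy_level_le w o k X0))) _.
  exact: exprn_ge0.
by rewrite ExD ExZ Ex_cst// mulrDr mulrCA Ex_level_cost_bit// -ltnS.
Qed.

Lemma Ex_copy_ge : (0 < size X)%N -> M * 2%:R ^+ g <= 2%:R ^+ J ->
  Ex (fun w => \sum_(k < T.+1) level_cost X (lkey w) (surrogate R f k) s t k)
  - noise 7 <= Ex copy_estimate.
Proof.
move=> X0 MJ; rewrite Ex_copy_estimate -ExB; apply: le_Ex => w.
rewrite -sumrB; apply: ler_sum => k _ /=.
apply: le_trans (ler_wpM2l _ (le_Ex (fun o => Ex_copy_level_ge w o k X0 MJ))).
  by rewrite ExB Ex_cst// mulrBr Ex_level_cost_bit// -ltnS.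
exact: exprn_ge0.
Qed.

Variable D : R.
Hypothesis size_st : size s = size t.
Hypothesis D_attained : exists2 t', perm_eq t' t &
  \sum_(p <- zip s t') ham R p.1 p.2 = D.
Hypothesis D_min : forall t', perm_eq t' t -> D <= \sum_(p <- zip s t') ham R p.1 p.2.

Lemma level_cost_perm (key : nat -> cube d -> cube d) (F : cube d -> cube d -> R) t' k :
  perm_eq t' t -> level_cost X key F s t' k = level_cost X key F s t k.
Proof.
move=> pt; apply: eq_bigr => v _; congr (_ * _).
by rewrite /disc (cellcnt_perm _ _ _ pt).
Qed.

Let D_ge0 : 0 <= D.
Proof. by case: D_attained => t' _ <-; rewrite sumr_ge0. Qed.

(** By [Ex_disc] the expected surplus of level [k], weighted by 2^k, is at most 2 D, so every level
    contributes the same bound. *)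
Let noise_le c : 0 <= c -> noise c <=
  2 * c * J.+1%:R ^+ 2 * T.+1%:R * 2%:R ^+ e / 2%:R ^+ g * D.
Proof.
move=> c0; have [t' pt tD] := D_attained.
have st' : size s = size t' by rewrite size_st (perm_size pt).
rewrite /noise Ex_sum.
have -> : 2 * c * J.+1%:R ^+ 2 * T.+1%:R * 2%:R ^+ e / 2%:R ^+ g * D =
    \sum_(k < T.+1) 2%:R ^+ e * (c * J.+1%:R ^+ 2 * gam) * (2 * D) :> R.
  by rewrite sumr_const card_ord -[RHS]mulr_natl /gam; ring.
apply: ler_sum => k _.
have := @Ex_disc R d T k s t'; rewrite -ltnS => /(_ (ltn_ord k) st').
have -> : \sum_(p <- zip s t') (hamming p.1 p.2)%:R = D by [].
have -> : Ex (fun w : {ffun 'I_d -> 'I_(2 ^ T)} => \sum_v disc (lkey w k) s t' v)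
    = Ex (fun w => SD w k) :> R.
  by apply: eq_Ex => w; apply: eq_bigr => v _; rewrite /disc (cellcnt_perm _ _ _ pt).
move=> h; rewrite ExZ ExZ exprD.
have -> : 2%:R ^+ k * 2%:R ^+ e * (c * J.+1%:R ^+ 2 * gam * Ex (fun w => SD w k)) =
  2%:R ^+ e * (c * J.+1%:R ^+ 2 * gam) * (2%:R ^+ k * Ex (fun w => SD w k)) by ring.
rewrite ler_wpM2l// mulr_ge0 ?exprn_ge0// !mulr_ge0 ?exprn_ge0//.
by rewrite invr_ge0 exprn_ge0.
Qed.

Variable b : nat.
Hypotheses (dT : (d <= 2 ^ T)%N) (X0 : (0 < size X)%N).
Hypotheses (lnb : 4 * ln M <= (2 ^+ b : R)) (lnf : 4 * ln M <= (2 ^+ f : R)).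
Hypothesis f256 : 256 <= (2 ^+ f : R).
Hypothesis MJ : M * 2%:R ^+ g <= 2%:R ^+ J.
Hypothesis noise_small :
  24 * J.+1%:R ^+ 2 * T.+1%:R * 2%:R ^+ f.+2 * 16 <= (2%:R ^+ g : R).

Definition distortion : R := 2 * (4 * (16 + (8 + 20 * b%:R) * ln M) + 1).

Lemma surrogate_cost_le :
  Ex (fun w => \sum_(k < T.+1) level_cost X (lkey w) (surrogate R f k) s t k) <=
  distortion * D.
Proof.
have [t' pt tD] := D_attained.
have st' : size s = size t' by rewrite size_st (perm_size pt).
have t'X : {subset t' <= X} by move=> x; rewrite (perm_mem pt) => /tX.
have := Ex_tree_ham dT X0 lnb sX t'X st' (leqnn _).
rewrite tD; apply: le_trans; apply: le_Ex => w; apply: ler_sum => k _.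
rewrite level_cost_perm//; apply: le_level_cost => x y; exact: surrogate_le.
Qed.

Lemma tree_cost_ge : D <=
  Ex (fun w : {ffun 'I_d -> 'I_(2 ^ T)} =>
    \sum_(k < T.+1) level_cost X (lkey w) (@ham R d) s t k).
Proof.
have tree_gt0 : (0 < #|{ffun 'I_d -> 'I_(2 ^ T)}|)%N.
  by rewrite card_ffun card_ord !expn_gt0.
rewrite -[leLHS](Ex_cst D tree_gt0); apply: le_Ex => w.
have [|||||||t' pt h] := @tree_transport R (cube d) (@ham R d) _ _ _ _ X T.+1 (lkey w)
  _ _ _ s t sX tX size_st.
- exact: ham_ge0.
- by move=> x; rewrite /ham hammingxx.
- by move=> x y; rewrite /ham hammingC.
- by move=> y x z; rewrite /ham -natrD ler_nat hamming_triangle.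
- by move=> k l x; exact: lkeyK.
- by move=> x y; exact: lkey_top.
- exact: lkey0.
by apply: le_trans (D_min pt) _; rewrite big_mkord in h.
Qed.

(** For every tree the Hamming cost is at most four times the surrogate cost plus the far cost. In
    expectation the far cost is at most 128 / 2^f * D <= D / 2, which leaves D / 8. *)
Lemma surrogate_cost_ge : D / 8 <=
  Ex (fun w => \sum_(k < T.+1) level_cost X (lkey w) (surrogate R f k) s t k).
Proof.
have [t' pt tD] := D_attained.
have st' : size s = size t' by rewrite size_st (perm_size pt).
have t'X : {subset t' <= X} by move=> x; rewrite (perm_mem pt) => /tX.
have := Ex_tree_far dT X0 lnb lnf sX t'X st' (leqnn _); rewrite tD.
have F0 : (0 : R) < 2 ^+ f by rewrite exprn_gt0.
have : 128 / 2 ^+ f * D <= 2^-1 * D.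
  by rewrite ler_wpM2r// ler_pdivrMr//; move: f256; lra.
have := tree_cost_ge.
set E1 := Ex _; set E2 := Ex _; set E3 := Ex _.
have : E1 <= 4 * E3 + E2.
  rewrite -ExZ -ExD; apply: le_Ex => w.
  rewrite mulr_sumr -big_split; apply: ler_sum => k _ /=.
  rewrite (level_cost_perm _ _ _ pt) -level_costZ -level_costD.
  by apply: le_level_cost => x y; exact: ham_le_surrogate.
lra.
Qed.

Let noise_coef c : 0 <= c <= 12 ->
  2 * c * J.+1%:R ^+ 2 * T.+1%:R * 2%:R ^+ e / 2%:R ^+ g * D <= D / 16.
Proof.
move=> /andP[c0 c12]; rewrite [leRHS]mulrC ler_wpM2r//.
rewrite ler_pdivrMr ?exprn_gt0// ler_pdivlMl//.
apply: le_trans noise_small; rewrite mulrC ler_wpM2r//.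
have : 0 <= J.+1%:R ^+ 2 * T.+1%:R * 2%:R ^+ e :> R.
  by [].
set Y := J.+1%:R ^+ 2 * _ * _ => Y0.
have -> : 2 * c * J.+1%:R ^+ 2 * T.+1%:R * 2%:R ^+ e = 2 * c * Y.
  by rewrite /Y; ring.
have -> : 24 * J.+1%:R ^+ 2 * T.+1%:R * 2%:R ^+ f.+2 = 24 * Y by rewrite /Y; ring.
by rewrite ler_wpM2r//; lra.
Qed.

Lemma copy_mean_ge : D / 16 <= Ex copy_estimate.
Proof.
have := Ex_copy_ge X0 MJ; have := surrogate_cost_ge.
have := noise_le (c := 7); have := noise_coef (c := 7); lra.
Qed.

Lemma copy_mean_le : Ex copy_estimate <= (9 * distortion + 1) * D.
Proof.
have := Ex_copy_le X0; have := surrogate_cost_le.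
have := noise_le (c := 12); have := noise_coef (c := 12).
by move: D_ge0; lra.
Qed.

End Copy.

(** * Averaging independent copies *)

Section Chebyshev.
Variables (R : realType) (O : finType) (G : O -> R) (m : nat) (Gmax tau : R).
Hypotheses (O0 : (0 < #|O|)%N) (m0 : (0 < m)%N) (tau0 : 0 < tau).
Hypotheses (G0 : forall o, 0 <= G o) (GM : forall o, G o <= Gmax).
Hypothesis many : 3 * Gmax <= 2 * m%:R * tau.

Let mu := Ex G.

Definition mean (W : {ffun 'I_m -> O}) : R := (\sum_i G (W i)) / m%:R.

Let mu_ge0 : 0 <= mu. Proof. exact: Ex_ge0. Qed.

Let m_gt0 : (0 : R) < m%:R. Proof. by rewrite ltr0n. Qed.

Let space_gt0 : (0 < #|{ffun 'I_m -> O}|)%N.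
Proof. by rewrite card_ffun expn_gt0 O0. Qed.

Let dev o := G o - mu.

Let Ex_dev : Ex dev = 0.
Proof. by rewrite ExB Ex_cst// subrr. Qed.

(** As 0 <= G <= Gmax, the second moment is at most Gmax times the mean: the bound is linear in
    [mu]. *)
Let Ex_dev2 : Ex (fun o => dev o * dev o) <= Gmax * mu.
Proof.
rewrite (_ : Ex _ = Ex (fun o => G o * G o) - mu * mu); last first.
  rewrite (eq_Ex (g := fun o => G o * G o - (2 * mu) * G o + mu * mu)).
    by rewrite ExD ExB ExZ Ex_cst// -/mu; ring.
  by move=> o; rewrite /dev; ring.
apply: le_trans (_ : Ex (fun o => G o * G o) <= _).
  by rewrite gerBl mulr_ge0.
by rewrite -ExZ; apply: le_Ex => o; rewrite ler_wpM2r.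
Qed.

Let Ex_mean2 : Ex (fun W => (mean W - mu) * (mean W - mu)) <= Gmax * mu / m%:R.
Proof.
have E W : (mean W - mu) * (mean W - mu) =
    (\sum_i \sum_j dev (W i) * dev (W j)) / m%:R ^+ 2.
  have -> : mean W - mu = (\sum_i dev (W i)) / m%:R.
    rewrite sumrB mulrBl; congr (_ - _).
    by rewrite sumr_const card_ord -[mu *+ _]mulr_natr mulfK ?gt_eqF.
  rewrite expr2 invfM mulrACA mulr_suml; congr (_ * _).
  by apply: eq_bigr => i _; rewrite mulr_sumr.
rewrite (eq_Ex E) ExZr Ex_sum.
rewrite (eq_bigr (fun=> Ex (fun o => dev o * dev o))); last first.
  move=> i _; rewrite Ex_sum (bigD1 i)//= big1 ?addr0.
    by rewrite (Ex_ffun1 i (fun o => dev o * dev o)).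
  by move=> j ji; rewrite (Ex_ffun2 dev dev)// ?Ex_dev ?mul0r// eq_sym.
rewrite sumr_const card_ord -[_ *+ _]mulr_natr expr2 invfM mulrA mulfK ?gt_eqF//.
by rewrite ler_pM2r ?invr_gt0.
Qed.

Definition concentrated W : bool :=
  (mu / 2 - tau <= mean W) && (mean W <= 3 / 2 * mu + tau).

(** The allowed deviation q = mu / 2 + tau satisfies q^2 >= 2 mu tau, so the mean cancels from the
    failure probability Gmax mu / (m q^2), and [m] of order Gmax / tau suffices. *)
Lemma mean_concentrated : 2 / 3 <= Ex (fun W => (concentrated W)%:R) :> R.
Proof.
pose q := mu / 2 + tau.
have q0 : 0 < q by rewrite /q; move: mu_ge0 tau0; lra.
have fail_le W : 1 - (concentrated W)%:R <= (mean W - mu) * (mean W - mu) / (q * q).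
  rewrite ler_pdivlMr ?mulr_gt0// /concentrated.
  have sq0 : 0 <= (mean W - mu) * (mean W - mu) by rewrite -expr2 sqr_ge0.
  case: (boolP (_ && _)) => [_|]; first by rewrite subrr mul0r.
  rewrite subr0 mul1r negb_and -!ltNge => /orP[h|h].
    have : q * q <= (mu - mean W) * (mu - mean W).
      by rewrite ler_pM ?(ltW q0)// /q; lra.
    lra.
  by rewrite ler_pM ?(ltW q0)// /q; lra.
have := le_Ex fail_le; rewrite ExB Ex_cst// ExZr.
have : Gmax * mu / m%:R / (q * q) <= 1 / 3.
  rewrite ler_pdivrMr ?mulr_gt0// ler_pdivrMr//.
  have amgm : 2 * (mu * tau) <= q * q.
    have := sqr_ge0 (mu / 2 - tau); rewrite expr2 /q; lra.
  have mun := many.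
  have h1 : 3 * Gmax * mu <= 2 * m%:R * tau * mu by rewrite ler_wpM2r.
  have h2 : m%:R * (2 * (mu * tau)) <= m%:R * (q * q) by rewrite ler_wpM2l.
  lra.
have : Ex (fun W => (mean W - mu) * (mean W - mu)) / (q * q) <=
    Gmax * mu / m%:R / (q * q).
  by rewrite ler_wpM2r// invr_ge0 ltW// mulr_gt0.
lra.
Qed.

End Chebyshev.

Section BigMin.
Variables (R : realType) (I : eqType) (F : I -> R).

Lemma bigmin_attained x0 (r : seq I) : exists2 x, x \in x0 :: r &
  \big[Num.min/F x0]_(x <- r) F x = F x.
Proof.
elim: r => [|y r [x xr E]]; first by exists x0; rewrite ?mem_head// big_nil.
rewrite big_cons E; case: (leP (F y) (F x)) => _.
  by exists y; rewrite ?in_cons ?eqxx ?orbT.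
by exists x => //; move: xr; rewrite !in_cons => /orP[->|->]; rewrite ?orbT.
Qed.

Lemma bigmin_le_mem x0 (r : seq I) x : x \in r ->
  \big[Num.min/F x0]_(x <- r) F x <= F x.
Proof.
elim: r => // y r IHr; rewrite in_cons big_cons ge_min => /orP[/eqP->|/IHr->].
  by rewrite lexx.
by rewrite orbT.
Qed.

End BigMin.

Section EMDProps.

Variables (R : realType) (d : nat) (A B : {mset cube d}).

Lemma matching_cost_ham (s t : seq (cube d)) :
  matching_cost R s t = \sum_(p <- zip s t) ham R p.1 p.2.
Proof. by apply: eq_bigr => p _; rewrite l1distE. Qed.

Lemma EMD_attained : exists2 t, perm_eq t B &
  \sum_(p <- zip A t) ham R p.1 p.2 = EMD R A B.
Proof.
have [t tB E] := bigmin_attained (fun t => matching_cost R A t) B (permutations B).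
exists t; last by rewrite -matching_cost_ham -E.
by move: tB; rewrite in_cons mem_permutations => /orP[/eqP->|//].
Qed.

Lemma EMD_min t : perm_eq t B -> EMD R A B <= \sum_(p <- zip A t) ham R p.1 p.2.
Proof.
move=> tB; rewrite -matching_cost_ham.
by apply: (bigmin_le_mem (fun t => matching_cost R A t)); rewrite mem_permutations.
Qed.

End EMDProps.

Section UniformNat.
Variable R : realType.
Local Open Scope ereal_scope.

Definition counting_upto (N : nat) := msum (fun i : nat => \d_i : {measure set nat -> \bar R}) N.

Definition uniform_nat (N : nat) : probability nat R :=
  mnormalize (counting_upto N) (\d_0%N : probability nat R).

Lemma uniform_nat_ge (N : nat) (P : pred nat) (E : set nat) : (0 < N)%N ->
  (forall i, (i < N)%N -> P i -> E i) ->
  (((\sum_(i < N) (P i)%:R) / N%:R)%R)%:E <= uniform_nat N E.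
Proof.
move=> N0 PE.
have cntE (U : set nat) : counting_upto N U = (\sum_(i < N) \1_U (i : nat))%:E.
  by rewrite /counting_upto /msum /= -sumEFin; apply: eq_bigr => i _; rewrite diracE.
have totE : counting_upto N [set: nat]%classic = (N%:R)%:E.
  rewrite cntE (eq_bigr (fun=> 1%R)) ?sumr_const ?card_ord// => i _.
  by rewrite indicT.
rewrite /uniform_nat /= /mnormalize /=.
case: ifPn => [/orP[]|_].
- by rewrite -[X in X == _]/(counting_upto N [set: nat]%classic) totE eqe pnatr_eq0 eqn0Ngt N0.
- by rewrite -[X in X == _]/(counting_upto N [set: nat]%classic) totE.
rewrite -[X in X * _]/(counting_upto N E) cntE.
rewrite -[X in fine X]/(counting_upto N [set: nat]%classic) totE /=.
rewrite -EFinM lee_fin.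
rewrite ler_wpM2r ?invr_ge0//; apply: ler_sum => i _.
rewrite indicE; case: (boolP (P i)) => [Pi|_]; last by rewrite ler0n.
by rewrite mem_set//; exact: PE.
Qed.

End UniformNat.

(** * Linear counters *)

Section FiniteSketch.
Variables (R : realType) (d : nat) (O I : finType) (om0 : O).
Variables (cA cB : O -> I -> cube d -> int) (dec : (I -> int) -> R).
Implicit Types (A B : {mset cube d}).

Definition coef_mx (c : O -> I -> cube d -> int) om : 'M[int]_(#|I|, #|cube d|) :=
  \matrix_(i, j) c om (enum_val i) (enum_val j).

Definition counters_mx om : 'M[int]_(#|I|, freq_dim d) :=
  row_mx (coef_mx cA om) (coef_mx cB om).

(* The finite probability space O is encoded in nat, discretely measured. *)
Definition outcome (w : nat) : O := nth om0 (enum O) w.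

Lemma counters_mx_measurable S :
  measurable ((fun w : nat => counters_mx (outcome w)) @^-1` [set S]).
Proof. by []. Qed.

Definition counter_sketch : linear_sketch R d :=
  LinearSketch (uniform_nat R #|O|) counters_mx_measurable
    (fun _ v => dec (fun i => v (enum_rank i) ord0)).

Definition counter om A B i : int :=
  \sum_(x <- (A : seq (cube d))) cA om i x + \sum_(x <- (B : seq (cube d))) cB om i x.

Lemma coef_mxE (c : O -> I -> cube d -> int) om A i :
  (coef_mx c om *m \col_j (A (enum_val j))%:Z) (enum_rank i) ord0 =
  \sum_(x <- (A : seq (cube d))) c om i x.
Proof.
rewrite mxE; under eq_bigr => j _ do rewrite !mxE enum_rankK.
rewrite -(big_enum_val (fun x => c om i x * (A x)%:Z)).
under eq_bigr => x _ do rewrite -count_mem_mset.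
rewrite (eq_bigl xpredT) => [|x]; last by rewrite inE.
transitivity (\sum_x \sum_(y <- (A : seq (cube d)) | y == x) c om i y).
  apply: eq_bigr => x _; rewrite (eq_bigr (fun=> c om i x)); last by move=> y /eqP->.
  by rewrite big_const_seq iter_addr_0 -[RHS]mulr_natr natz.
rewrite (exchange_big_dep xpredT)//=; apply: eq_bigr => y _.
by rewrite (big_pred1 y)// => x; rewrite eq_sym.
Qed.

Lemma counter_stateE w A B i :
  sk_state (sk := counter_sketch) w A B (enum_rank i) ord0 = counter (outcome w) A B i.
Proof.
by rewrite /sk_state /= /freq_vec /counters_mx mul_row_col mxE !coef_mxE.
Qed.

Lemma counter_outputE w A B :
  sk_output (sk := counter_sketch) w A B = dec (counter (outcome w) A B).
Proof.
rewrite /sk_output /=; congr dec; apply/funext => i; exact: counter_stateE.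
Qed.

Lemma counter_sketch_prob A B (good : pred O) (Q : R -> Prop) (p : R) :
  (forall om, good om -> Q (dec (counter om A B))) ->
  p <= Ex (fun om => (good om)%:R) ->
  (p%:E <= sk_prob counter_sketch
     [set w | Q (sk_output (sk := counter_sketch) w A B)])%E.
Proof.
move=> goodQ p_le; apply: le_trans (_ : ((Ex (fun om => (good om)%:R))%:E <= _)%E).
  by rewrite lee_fin.
have O0 : (0 < #|O|)%N by apply/card_gt0P; exists om0.
apply: le_trans (@uniform_nat_ge R #|O| (fun w => good (outcome w)) _ O0 _); last first.
  by move=> w _ gw; have := goodQ _ gw; rewrite -counter_outputE.
rewrite lee_fin /Ex ler_wpM2r ?invr_ge0//.
rewrite (eq_bigl (fun x => x \in O)) => [|x]; last by rewrite inE.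
rewrite (big_enum_val (fun x => (good x)%:R)).
apply: ler_sum => i _; rewrite /outcome.
by rewrite (enum_val_nth om0).
Qed.

Lemma int_bits_le z m : (`|z| <= m)%N -> (int_bits z <= (up_log 2 m.+1).+1)%N.
Proof. by move=> zm; rewrite /int_bits ltnS leq_up_log. Qed.

Lemma counter_sketch_bits w A B n :
  (forall om i x, (`|cA om i x| <= 1)%N) -> (forall om i x, (`|cB om i x| <= 1)%N) ->
  size A = n -> size B = n ->
  (vec_bits (sk_state (sk := counter_sketch) w A B) <=
     #|I| * (up_log 2 (n + n).+1).+1)%N.
Proof.
move=> cA1 cB1 An Bn.
have absD (u v : int) : (`|(u + v)%R| <= `|u| + `|v|)%N.
  by rewrite -lez_nat PoszD !abszE ler_normD.
have sum_le (c : O -> I -> cube d -> int) om i (s : seq (cube d)) :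
    (forall om i x, (`|c om i x| <= 1)%N) ->
    (`|(\sum_(x <- s) c om i x)%R| <= size s)%N.
  move=> c1; elim: s => [|x s IHs]; first by rewrite big_nil.
  rewrite big_cons /= (leq_trans (absD _ _))// -add1n leq_add//; exact: c1.
rewrite /vec_bits; apply: leq_trans (_ : \sum_(r < #|I|) (up_log 2 (n + n).+1).+1 <= _)%N.
  apply: leq_sum => r _; rewrite -(enum_valK r) counter_stateE; apply: int_bits_le.
  have := sum_le cA (outcome w) (enum_val r) A cA1.
  have := sum_le cB (outcome w) (enum_val r) B cB1; rewrite An Bn /counter.
  by move=> hB hA; rewrite (leq_trans (absD _ _))// leq_add.
by rewrite sum_nat_const card_ord.
Qed.

End FiniteSketch.

Section EMDSketch.
Variables (R : realType) (d T f J g n m : nat) (tau : R).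

Let e := f.+2.
Let M : R := (n + n)%:R.
Let gam : R := (2%:R ^+ g)^-1.

Definition samples : finType := {ffun 'I_m -> copy d T f J}.

(* The last component selects one of the counters U, U1, V, V1, Z. *)
Definition rows : finType :=
  ('I_m * ('I_T.+1 * ('I_J.+1 * ('I_J.+1 * 'I_5))))%type.

(** The numbers [c] follow the order U, U1, V, V1, Z: those above 1 are taken after the second
    sampling, and 1 and 3 count only points with bit 1. *)
Definition member (om : copy d T f J) (k j1 j2 : nat) (c : 'I_5) (x : cube d) : bool :=
  let w := om.1 in let o := om.2.1 in let l := om.2.2 in
  [&& keep1 j1 l (lkey w k.+1 (lkey w k x)),
      (1 < c)%N ==> keep (lkey w k.+1) j1 j2 l (lkey w k x) &
      (nat_of_ord c \in [:: 1%N; 3%N]) ==> hbit o k x].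

Definition coefA (W : samples) (i : rows) (x : cube d) : int :=
  (member (W i.1) i.2.1 i.2.2.1 i.2.2.2.1 i.2.2.2.2 x : nat).

Definition coefB (W : samples) (i : rows) (x : cube d) : int :=
  if i.2.2.2.2 == 4%N :> nat then - coefA W i x else coefA W i x.

Lemma coefA_le1 W i x : (`|coefA W i x| <= 1)%N.
Proof. by rewrite /coefA; case: member. Qed.

Lemma coefB_le1 W i x : (`|coefB W i x| <= 1)%N.
Proof. by rewrite /coefB; case: ifP => _; rewrite ?abszN coefA_le1. Qed.

Definition estimate_of (j1 j2 : nat) (U U1 V V1 Z : R) : R :=
  ((lev1 M j1 gam <= U < 4 * lev1 M j1 gam) &&
   (lev2 M j1 j2 gam <= V < 4 * lev2 M j1 j2 gam))%R%:R *
  (`|Z| * mix (V1 / V) (U1 / U)).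

(** A concentrated mean is at least mu / 2 - tau, and mu >= EMD / 16; adding [tau] and multiplying
    by 32 therefore prevents underestimation. *)
Definition decode (v : rows -> int) : R :=
  32 * ((\sum_(i < m) \sum_(k < T.+1) 2%:R ^+ (k + e) *
     \sum_(j1 < J.+1) \sum_(j2 < J.+1) 2%:R ^+ (j1 + j2) *
       let c (q : 'I_5) : R := (v (i, (k, (j1, (j2, q)))))%:~R in
       estimate_of j1 j2 (c (inord 0)) (c (inord 1)) (c (inord 2)) (c (inord 3))
         (c (inord 4))) / m%:R + tau).

Section Decoding.
Variables (A B : {mset cube d}).
Hypotheses (An : size A = n) (Bn : size B = n).

Let X : seq (cube d) := (A : seq (cube d)) ++ B.

Lemma sum_keys (K : finType) (key : K -> K) (s : seq K) (phi F : K -> R) :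
  \sum_v phi v * (\sum_(x <- s | key x == v) F x) = \sum_(x <- s) phi (key x) * F x.
Proof.
under eq_bigr => v _ do rewrite mulr_sumr.
rewrite (exchange_big_dep xpredT)//=; apply: eq_bigr => x _.
by rewrite (big_pred1 (key x))// => v; rewrite eq_sym.
Qed.

Lemma sum_pc (K : finType) (par : K -> K) (c phi : K -> R) :
  \sum_u phi u * pc par c u = \sum_v phi (par v) * c v.
Proof.
rewrite [RHS](partition_big par xpredT)//=; apply: eq_bigr => u _.
by rewrite /pc mulr_sumr; apply: eq_bigr => v /eqP->.
Qed.

Let counterR (W : samples) i : (counter coefA coefB W A B i)%:~R =
  \sum_(x <- (A : seq (cube d))) (coefA W i x)%:~R
  + \sum_(x <- (B : seq (cube d))) (coefB W i x)%:~R :> R.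
Proof. by rewrite /counter rmorphD /= !rmorph_sum. Qed.

Let counter_pos (W : samples) (i : rows) : nat_of_ord i.2.2.2.2 != 4%N ->
  (counter coefA coefB W A B i)%:~R =
  \sum_(x <- X) (member (W i.1) i.2.1 i.2.2.1 i.2.2.2.1 i.2.2.2.2 x)%:R :> R.
Proof.
move=> i4; rewrite counterR big_cat /=; congr (_ + _).
by apply: eq_bigr => x _; rewrite /coefB (negPf i4).
Qed.

Let keep_keep1 (par : cube d -> cube d) j1 j2 (l : labels (cube d) J) v :
  keep par j1 j2 l v = keep1 j1 l (par v) && keep par j1 j2 l v.
Proof. by rewrite /keep andbA andbb. Qed.

Lemma decodeE (W : samples) : decode (counter coefA coefB W A B) =
  32 * (mean (copy_estimate R g A B) W + tau).
Proof.
rewrite /decode /mean /copy_estimate; congr (_ * (_ / _ + _)).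
apply: eq_bigr => i _; apply: eq_bigr => k _; congr (_ * _).
rewrite /copy_level /estimate_sum; apply: eq_bigr => j1 _; apply: eq_bigr => j2 _.
rewrite /estimate2; congr (_ * _).
set w := (W i).1; set o := (W i).2.1; set l := (W i).2.2.
pose key := lkey w k; pose par := lkey w k.+1.
have MX : (size X)%:R = M by rewrite size_cat An Bn.
pose cnt (q : nat) : R := (counter coefA coefB W A B (i, (k, (j1, (j2, inord q)))))%:~R.
have cU : cnt 0%N = Utot par (cellcnt key X) j1 l.
  rewrite /cnt counter_pos /= ?inordK//.
  rewrite /Utot sum_pc; under [RHS]eq_bigr => v _ do rewrite cellcntE.
  rewrite (sum_keys _ _ (fun v => (keep1 j1 l (par v))%:R)).
  by apply: eq_bigr => x _; rewrite /member !inordK//= andbT mulr1.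
have cU1 : cnt 1%N = Utot1 par (bitcnt R A B w o k) j1 l.
  rewrite /cnt counter_pos /= ?inordK//.
  rewrite /Utot1 (sum_pc par (bitcnt R A B w o k)).
  rewrite (sum_keys _ _ (fun v => (keep1 j1 l (par v))%:R)).
  by apply: eq_bigr => x _; rewrite /member !inordK//= -natrM mulnb.
have cV : cnt 2%N = Vtot par (cellcnt key X) j1 j2 l.
  rewrite /cnt counter_pos /= ?inordK//.
  rewrite /Vtot; under [RHS]eq_bigr => v _ do rewrite cellcntE.
  rewrite (sum_keys _ _ (fun v => (keep par j1 j2 l v)%:R)).
  by apply: eq_bigr => x _; rewrite /member !inordK//= andbT -keep_keep1 mulr1.
have cV1 : cnt 3%N = Vtot1 par (bitcnt R A B w o k) j1 j2 l.
  rewrite /cnt counter_pos /= ?inordK//.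
  rewrite /Vtot1 (sum_keys _ _ (fun v => (keep par j1 j2 l v)%:R)).
  by apply: eq_bigr => x _; rewrite /member !inordK//= andbA -keep_keep1 -natrM mulnb.
have cZ : cnt 4%N = Ztot par (signed_disc R A B w k) j1 j2 l.
  have half (s : seq (cube d)) :
      \sum_(x <- s) (keep par j1 j2 l (key x))%:R =
      \sum_v (keep par j1 j2 l v)%:R * cellcnt key s v :> R.
    under [RHS]eq_bigr => v _ do rewrite cellcntE.
    rewrite (sum_keys _ _ (fun v => (keep par j1 j2 l v)%:R)).
    by apply: eq_bigr => x _; rewrite mulr1.
  rewrite /cnt counterR /Ztot /signed_disc.
  under [RHS]eq_bigr => v _ do rewrite mulrBr.
  rewrite sumrB -!half -sumrN; congr (_ + _); apply: eq_bigr => x _;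
    rewrite /coefB /coefA /member /= !inordK//= andbT -keep_keep1//.
  by rewrite rmorphN.
rewrite -/(cnt 0%N) -/(cnt 1%N) -/(cnt 2%N) -/(cnt 3%N) -/(cnt 4%N).
by rewrite cU cU1 cV cV1 cZ /estimate_of /estimate /window MX.
Qed.

End Decoding.
End EMDSketch.

(** * Correctness and choice of the parameters *)

Section Correctness.
Variables (R : realType) (d n T b f g J m : nat) (tau : R).

Let M : R := (n + n)%:R.

Definition dist_factor : R := 2 * (4 * (16 + (8 + 20 * b%:R) * ln M) + 1).

Definition range_bound : R :=
  T.+1%:R * 2%:R ^+ (T + f.+2) * (J.+1%:R ^+ 2 * (4 * M * (2%:R ^+ g) ^+ 2)).

Hypotheses (n0 : (0 < n)%N) (dT : (d <= 2 ^ T)%N).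
Hypotheses (lnb : 4 * ln M <= (2 ^+ b : R)) (lnf : 4 * ln M <= (2 ^+ f : R)).
Hypothesis f256 : 256 <= (2 ^+ f : R).
Hypothesis MJ : M * 2%:R ^+ g <= 2%:R ^+ J.
Hypothesis noise_small :
  24 * J.+1%:R ^+ 2 * T.+1%:R * 2%:R ^+ f.+2 * 16 <= (2%:R ^+ g : R).
Hypotheses (m0 : (0 < m)%N) (tau0 : 0 < tau).
Hypothesis many : 3 * range_bound <= 2 * m%:R * tau.

Definition emd_sketch (om0 : samples d T f J m) : linear_sketch R d :=
  counter_sketch om0 (@coefA d T f J m) (@coefB d T f J m) (@decode R T f J g n m tau).

Lemma sketch_correct (om0 : samples d T f J m) (A B : {mset cube d}) :
  size A = n -> size B = n ->
  ((2 / 3)%:E <= sk_prob (emd_sketch om0)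
    [set w | EMD R A B <= sk_output (sk := emd_sketch om0) w A B /\
       sk_output (sk := emd_sketch om0) w A B <=
       48 * (9 * dist_factor + 1) * EMD R A B + 64 * tau]%R)%E.
Proof.
move=> An Bn.
have MX : (size ((A : seq (cube d)) ++ B))%:R = M by rewrite size_cat An Bn.
have X0 : (0 < size ((A : seq (cube d)) ++ B))%N by rewrite size_cat An addn_gt0 n0.
pose G := copy_estimate R g (A : seq (cube d)) B : copy d T f J -> R.
have copy0 : (0 < #|copy d T f J|)%N.
  by rewrite /copy /bits_space /labels !card_prod !card_ffun !card_ord card_bool !muln_gt0 !expn_gt0.
have G0 om : 0 <= G om by exact: copy_estimate_ge0.
have GM om : G om <= range_bound.
  by have := copy_estimate_le R g om X0; rewrite MX.
have AB : size (A : seq (cube d)) = size (B : seq (cube d)) by rewrite An Bn.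
have D1 := EMD_attained R A B; have D2 := @EMD_min R d A B.
have lo : EMD R A B / 16 <= Ex G.
  by apply: (@copy_mean_ge R d T f J g A B (EMD R A B) AB D1 D2 b) => //; rewrite MX.
have hi : Ex G <= (9 * dist_factor + 1) * EMD R A B.
  have := @copy_mean_le R d T f J g A B (EMD R A B) AB D1 b dT X0.
  by rewrite /distortion MX; apply.
apply: (@counter_sketch_prob R d _ _ om0 _ _ _ A B (concentrated G tau)
  (fun out => EMD R A B <= out /\
     out <= 48 * (9 * dist_factor + 1) * EMD R A B + 64 * tau) (2 / 3)).
  move=> W /andP[h1 h2]; rewrite decodeE// -/G.
  by split; lra.
exact: mean_concentrated many.
Qed.

End Correctness.

(** * Numerical choice of the parameters *)

Section Logarithms.
Variable R : realType.

Lemma plog_ge1 (x : R) : 1 <= plog x.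
Proof. by rewrite /plog le_max lexx. Qed.

Lemma plog_ge_ln (x : R) : ln x <= plog x.
Proof. by rewrite /plog le_max lexx orbT. Qed.

Lemma ln2_bounds : 1 / 2 <= ln (2 : R) <= 1.
Proof.
have h : 0 < (2 : R) by lra.
by have := ln_ge_1BV h; have := ln_sub1 h; lra.
Qed.

Lemma exp_up_log_le n : (0 < n)%N -> (2 ^ up_log 2 n <= 2 * n)%N.
Proof.
case: n => [//|[|n]] _; first by rewrite up_log1.
have n1 : (1 < n.+2)%N by [].
have u0 : (0 < up_log 2 n.+2)%N by rewrite up_log_gt0.
by rewrite -(prednK u0) expnS leq_mul2l /= ltnW// up_log_gtn.
Qed.

Lemma up_log_le_ln n : (0 < n)%N -> (up_log 2 n)%:R <= 1 + 2 * ln n%:R :> R.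
Proof.
move=> n0; have nR : 0 < n%:R :> R by rewrite ltr0n.
have : (2 ^+ up_log 2 n : R) <= 2 * n%:R by rewrite -natrX -natrM ler_nat exp_up_log_le.
rewrite -ler_ln ?posrE ?exprn_gt0 ?mulr_gt0//.
rewrite lnXn// lnM ?posrE// -[X in X <= _]mulr_natr.
have /andP[h1 h2] := ln2_bounds.
case: (posnP (up_log 2 n)) => [->|u0 h].
  have := @ln_ge_1BV R n%:R nR; have : n%:R^-1 <= 1 :> R by rewrite invf_le1// ler1n.
  lra.
have u1 : 1 <= (up_log 2 n)%:R :> R by rewrite ler1n.
have : 0 <= ((up_log 2 n)%:R - 1) * (ln 2 - 1 / 2) :> R by apply: mulr_ge0; lra.
by move: h; lra.
Qed.

Lemma ln_le_up_log n : (0 < n)%N -> ln n%:R <= (up_log 2 n)%:R :> R.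
Proof.
move=> n0; have h : n%:R <= (2 ^+ up_log 2 n : R) by rewrite -natrX ler_nat up_logP.
have : ln n%:R <= ln (2 ^+ up_log 2 n : R) by rewrite ler_ln ?posrE ?exprn_gt0 ?ltr0n.
rewrite lnXn// -[X in _ <= X]mulr_natr => /le_trans; apply.
have /andP[_ h2] := ln2_bounds.
by rewrite ler_piMl.
Qed.

End Logarithms.

Section Constants.
Variables (R : realType) (d n : nat).
Hypotheses (n0 : (0 < n)%N) (d0 : (0 < d)%N).

(** The parameters are exponents of powers of 2. [loglogM] makes 2^b at least 4 ln (2 n), and
    [width] yields one quantity P = 2^width that dominates the logarithms of n and d together. *)
Definition logM : nat := up_log 2 (n + n).
Definition depth : nat := up_log 2 d.
Definition loglogM : nat := up_log 2 (4 * logM).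
Definition width : nat := up_log 2 (logM + depth + 2).
(** The noise condition has degree 4 in P: two factors from the squared number of rates, one from
    the depth, one from the rate of the bits. The term 40 absorbs the constants. *)
Definition precision : nat := 40 + 4 * width.
Definition levels : nat := precision + logM.

Let P : R := 2 ^+ width.
Let M : R := (n + n)%:R.
Let L1 : R := plog n%:R.
Let L2 : R := plog L1.
Let Ld : R := plog d%:R.

Let l0 : (0 < logM)%N.
Proof. by rewrite up_log_gt0 /= addnn -[1%N]/(0.*2.+1) -(doubleS 0) ?leq_double ?ltn_Sdouble. Qed.

Lemma ln_points : ln M <= 2 * L1.
Proof.
have -> : M = 2 * n%:R by rewrite /M natrD; lra.
rewrite lnM ?posrE ?ltr0n//; have /andP[_ h2] := ln2_bounds R.
have := plog_ge1 (n%:R : R); have := plog_ge_ln (n%:R : R).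
by rewrite -/L1; lra.
Qed.

Lemma logM_le : logM%:R <= 5 * L1.
Proof.
have : (0 < n + n)%N by rewrite addn_gt0 n0.
move=> /(up_log_le_ln R); rewrite -/logM -/M.
by have := ln_points; have := plog_ge1 (n%:R : R); rewrite -/L1; lra.
Qed.

Lemma depth_le : depth%:R <= 3 * Ld.
Proof.
have := up_log_le_ln R d0; rewrite -/depth.
by have := plog_ge1 (d%:R : R); have := plog_ge_ln (d%:R : R); rewrite -/Ld; lra.
Qed.

Lemma width_le : P <= 2 ^+ 4 * (L1 + Ld).
Proof.
have h : (0 < logM + depth + 2)%N by rewrite addn_gt0 orbT.
have := exp_up_log_le h; rewrite -/width -(@ler_nat R) natrX -/P natrM !natrD.
have := logM_le; have := depth_le.
have := plog_ge1 (d%:R : R); have := plog_ge1 (n%:R : R); rewrite -/Ld -/L1.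
lra.
Qed.

Lemma width_ge : logM%:R + depth%:R + 2 <= P.
Proof. by rewrite -!natrD /P -natrX ler_nat up_logP. Qed.

Let P3 : 3 <= P.
Proof.
have : 1 <= logM%:R :> R by rewrite ler1n.
by have := width_ge; have : 0 <= depth%:R :> R by []; lra.
Qed.

Lemma levels_le : levels.+1%:R <= 2 ^+ 6 * P.
Proof.
have wP : width%:R <= P by rewrite /P -natrX ler_nat ltnW// ltn_expl.
have -> : levels.+1 = (41 + 4 * width + logM)%N by [].
rewrite (natrD _ (_ + _)%N) (natrD _ 41) natrM.
have := width_ge; have : 0 <= depth%:R :> R by [].
move: P3 wP; lra.
Qed.

Lemma loglogM_exp : 4 * logM%:R <= (2 ^+ loglogM : R) <= 8 * logM%:R.
Proof.
have h : (0 < 4 * logM)%N by rewrite muln_gt0.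
apply/andP; split.
  by rewrite -natrX -natrM ler_nat up_logP.
have := exp_up_log_le h; rewrite -/loglogM -(@ler_nat R) natrX !natrM; lra.
Qed.

Lemma loglogM_le : loglogM%:R <= 41 * L2.
Proof.
have h : (0 < 4 * logM)%N by rewrite muln_gt0.
have L11 : 1 <= L1 by exact: plog_ge1.
have L10 : 0 < L1 by lra.
have := up_log_le_ln R h; rewrite -/loglogM.
have : ln (4 * logM)%:R <= ln (20 * L1).
  rewrite ler_ln ?posrE ?ltr0n// ?mulr_gt0//.
  by rewrite natrM; have := logM_le; lra.
have t20 : 0 < (20 : R) by lra.
rewrite lnM ?posrE//.
have := ln_sub1 t20; have := plog_ge1 L1; have := plog_ge_ln L1; rewrite -/L2; lra.
Qed.

Lemma ln_points_le : 4 * ln M <= (2 ^+ loglogM : R).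
Proof.
have : (0 < n + n)%N by rewrite addn_gt0 n0.
move=> /(ln_le_up_log R); rewrite -/logM -/M.
by have /andP[] := loglogM_exp; lra.
Qed.

Lemma dist_factor_le : 48 * (9 * dist_factor R n loglogM + 1) <= 8000 * 1000 * L1 * L2.
Proof.
have lnM0 : 0 <= ln M.
  by rewrite ln_ge0// /M natrD; have : 1 <= n%:R :> R by [rewrite ler1n]; lra.
have b0 : 0 <= loglogM%:R :> R by [].
have := loglogM_le; have := ln_points; have := plog_ge1 L1; have := plog_ge1 (n%:R : R).
rewrite -/L1 -/L2 /dist_factor -/M => h1 h2 h3 h4.
have h5 : (8 + 20 * loglogM%:R) * ln M <= (828 * L2) * (2 * L1).
  by apply: ler_pM => //; lra.
have h6 : 1 <= L1 * L2 by rewrite -[1]mulr1 ler_pM.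
have h7 : 828 * L2 * (2 * L1) = 1656 * (L1 * L2) by ring.
have -> : 8000 * 1000 * L1 * L2 = 8000 * 1000 * (L1 * L2) by ring.
lra.
Qed.

Lemma fine_exp : 2 ^+ (loglogM + 8).+2 <= 2 ^+ 13 * P.
Proof.
rewrite -!addnS exprD.
have -> : 2 ^+ 13 = 8 * 2 ^+ 10 :> R by ring.
have /andP[_ h] := loglogM_exp; have h2 : 0 <= depth%:R :> R by [].
have e10 : 0 < 2 ^+ 10 :> R by exact: exprn_gt0.
rewrite [leRHS]mulrAC ler_pM2r//.
by have := width_ge; lra.
Qed.

Lemma precision_exp : 2 ^+ precision = 2 ^+ 40 * P ^+ 4 :> R.
Proof. by rewrite exprD mulnC exprM. Qed.

Let P0 : 0 < P. Proof. exact: exprn_gt0. Qed.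

Let depthS_le : depth.+1%:R <= P.
Proof.
have : 1 <= logM%:R :> R by rewrite ler1n.
by rewrite -natr1; have := width_ge; lra.
Qed.

Lemma noise_le : 24 * levels.+1%:R ^+ 2 * depth.+1%:R * 2 ^+ (loglogM + 8).+2 * 16
  <= (2 ^+ precision : R).
Proof.
rewrite precision_exp.
apply: le_trans (_ : 24 * (2 ^+ 6 * P) ^+ 2 * P * (2 ^+ 13 * P) * 16 <= _).
  rewrite ler_pM2r//; apply: ler_pM => //.
  - apply: ler_pM => //.
    by rewrite ler_pM2l// lerXn2r ?nnegrE ?mulr_ge0// ?(ltW P0)// ?levels_le// exprn_ge0.
  - exact: fine_exp.
have -> : 24 * (2 ^+ 6 * P) ^+ 2 * P * (2 ^+ 13 * P) * 16 = 24 * 16 * 2 ^+ 25 * P ^+ 4 by ring.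
rewrite ler_pM2r ?exprn_gt0//.
have -> : 2 ^+ 40 = 2 ^+ 15 * 2 ^+ 25 :> R by rewrite -exprD.
rewrite ler_pM2r ?exprn_gt0//.
by have -> : 2 ^+ 15 = 512 * 64 :> R by [ring]; lra.
Qed.

Definition range : R := range_bound R n depth (loglogM + 8) precision levels.

(** Degree 12 in P: 1 from the depth, 1 from the rate of the bits, 2 from the pairs of rates and 8
    from the squared precision. The power 2^depth supplies the factor d. *)
Lemma range_le : range <= 2 ^+ 109 * P ^+ 12 * (n%:R * d%:R).
Proof.
have dep : 2 ^+ depth <= 2 * d%:R :> R.
  by rewrite -natrX -natrM ler_nat exp_up_log_le.
rewrite /range /range_bound -/M exprD precision_exp.
have -> : M = 2 * n%:R by rewrite /M natrD; lra.
apply: le_trans (_ : P * (2 * d%:R * (2 ^+ 13 * P)) *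
  ((2 ^+ 6 * P) ^+ 2 * (4 * (2 * n%:R) * (2 ^+ 40 * P ^+ 4) ^+ 2)) <= _); last first.
  by rewrite le_eqVlt; apply/orP; left; apply/eqP; ring.
apply: ler_pM.
- by [].
- by apply: mulr_ge0; [exact: sqr_ge0 | apply: mulr_ge0; last exact: sqr_ge0].
- apply: ler_pM => //.
  by apply: ler_pM => //; rewrite ?exprn_ge0// fine_exp.
- rewrite ler_pM2r; last by rewrite !mulr_gt0 ?exprn_gt0 ?mulr_gt0 ?exprn_gt0 ?ltr0n.
  by rewrite lerXn2r ?nnegrE ?mulr_ge0// ?exprn_ge0 ?(ltW P0) ?levels_le.
Qed.

Variable eps : R.
Hypothesis eps01 : 0 < eps < 1.

Let eps0 : 0 < eps. Proof. by case/andP: eps01. Qed.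

(** The decoded value has additive error 64 tau, which is to be eps n d. *)
Definition slack : R := eps * n%:R * d%:R / 64.

Definition copies : nat := (Num.truncn (3 / 2 * range / slack)).+1.

Lemma slack_gt0 : 0 < slack.
Proof. by rewrite divr_gt0// !mulr_gt0 ?ltr0n. Qed.

Let range_ge0 : 0 <= range / slack.
Proof.
apply: divr_ge0 (ltW slack_gt0); rewrite /range /range_bound.
by apply: mulr_ge0; [|apply: mulr_ge0; last apply: mulr_ge0; rewrite ?sqr_ge0].
Qed.

Lemma copies_many : 3 * range <= 2 * copies%:R * slack.
Proof.
have := ltW (truncnS_gt (3 / 2 * range / slack)).
rewrite -/copies ler_pdivrMr ?slack_gt0//; lra.
Qed.

Lemma copies_le : copies%:R <= 2 ^+ 117 * P ^+ 12 / eps.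
Proof.
have /andP[_ e1] := eps01.
have x0 : 0 <= 3 / 2 * range / slack by rewrite -mulrA mulr_ge0.
have h : (Num.truncn (3 / 2 * range / slack))%:R <= 3 / 2 * range / slack.
  by rewrite truncn_le.
rewrite /copies -natr1.
have nd0 : 0 < n%:R * d%:R :> R by rewrite mulr_gt0 ?ltr0n.
have r1 : range / slack <= 64 * 2 ^+ 109 * P ^+ 12 / eps.
  rewrite ler_pdivrMr ?slack_gt0//.
  apply: le_trans range_le _; rewrite le_eqVlt /slack; apply/orP; left; apply/eqP.
  by field; rewrite gt_eqF.
have one : 1 <= 2 ^+ 116 * P ^+ 12 / eps.
  rewrite ler_pdivlMr// mul1r (le_trans (ltW e1))//.
  by rewrite -[1]mulr1 ler_pM// exprn_ege1//; move: P3; lra.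
have -> : 2 ^+ 117 * P ^+ 12 / eps = 2 ^+ 116 * P ^+ 12 / eps + 2 ^+ 116 * P ^+ 12 / eps by ring.
apply: lerD => //; apply: le_trans h _.
set q := 2 ^+ 109 * P ^+ 12 / eps.
have q0 : 0 <= q by rewrite /q divr_ge0 ?(ltW eps0)// mulr_ge0 ?exprn_ge0 ?(ltW P0).
have r2 : range / slack <= 64 * q.
  by apply: le_trans r1 _; rewrite le_eqVlt /q; apply/orP; left; apply/eqP; ring.
have -> : 2 ^+ 116 * P ^+ 12 / eps = 128 * q by rewrite /q; ring.
by rewrite -[leLHS]mulrA; lra.
Qed.

Let bits_entry : (up_log 2 (n + n).+1).+1%:R <= P.
Proof.
have : (up_log 2 (n + n).+1 <= logM.+1)%N.
  apply: up_log_min => //; rewrite expnS mul2n -addnn.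
  apply: leq_ltn_trans (_ : (2 ^ logM < _)%N); first exact: up_logP.
  by rewrite -[ltnLHS]addn0 ltn_add2l expn_gt0.
rewrite -ltnS -(@ler_nat R) => /le_trans; apply.
by rewrite -addn2 natrD; have := width_ge; have : 0 <= depth%:R :> R by []; lra.
Qed.

(** Degree 16 in P: 12 from the number of copies, 1 from the levels of the tree, 2 from the pairs of
    rates, 1 from the bits of an entry. *)
Lemma rows_bits_le :
  (#|rows depth levels copies| * (up_log 2 (n + n).+1).+1)%:R <=
    2 ^+ 196 / eps * (L1 + Ld) ^+ 16.
Proof.
have L0 : 0 <= L1 + Ld.
  by have := plog_ge1 (d%:R : R); have := plog_ge1 (n%:R : R); rewrite -/Ld -/L1; lra.
rewrite /rows !card_prod !card_ord !natrM.
have lv := levels_le.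
have lv2 : levels.+1%:R * (levels.+1%:R * 5) <= 2 ^+ 6 * P * (2 ^+ 6 * P * 5).
  by apply: ler_pM => //; rewrite ler_pM2r.
have r1 : depth.+1%:R * (levels.+1%:R * (levels.+1%:R * 5)) <= P * (2 ^+ 6 * P * (2 ^+ 6 * P * 5)).
  by apply: ler_pM => //.
have r2 : copies%:R * (depth.+1%:R * (levels.+1%:R * (levels.+1%:R * 5))) <=
   2 ^+ 117 * P ^+ 12 / eps * (P * (2 ^+ 6 * P * (2 ^+ 6 * P * 5))).
  by apply: ler_pM => //; exact: copies_le.
apply: le_trans (ler_pM _ _ r2 bits_entry) _ => //.
have -> : 2 ^+ 117 * P ^+ 12 / eps * (P * (2 ^+ 6 * P * (2 ^+ 6 * P * 5))) * P =
  5 * 2 ^+ 129 / eps * P ^+ 16 by ring.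
(* The exponent 196 is 3 + 129 + 4 * 16. *)
apply: le_trans (_ : 8 * 2 ^+ 129 / eps * (2 ^+ 4 * (L1 + Ld)) ^+ 16 <= _); last first.
  by rewrite le_eqVlt; apply/orP; left; apply/eqP; ring.
apply: ler_pM => //.
- by rewrite divr_ge0// ltW.
- by rewrite exprn_ge0// ltW.
- by rewrite ler_pM2r ?invr_gt0// ler_pM2r ?exprn_gt0//; lra.
- by rewrite lerXn2r ?nnegrE ?mulr_ge0// ?(ltW P0)// width_le.
Qed.

End Constants.

Lemma EMD_ge0 (R : realType) d (A B : {mset cube d}) : 0 <= EMD R A B.
Proof. by have [t _ <-] := EMD_attained R A B; apply: sumr_ge0. Qed.

Lemma EMD_degenerate (R : realType) d (A B : {mset cube d}) n :
  size A = n -> n = 0%N \/ d = 0%N -> EMD R A B = 0.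
Proof.
move=> An nd; have [t _ <-] := EMD_attained R A B.
case: nd => [n0|d0].
  have := An; rewrite n0 => /size0nil->; case: t => [|? ?]; exact: big_nil.
apply: big1 => p _; apply/eqP; rewrite pnatr_eq0 -leqn0.
by rewrite -[leqRHS]d0 hamming_le.
Qed.

Theorem theorem6p1 (R : realType) :
  exists c k c' k' : nat,
  forall (d n : nat) (eps : R), 0 < eps < 1 ->
  exists sk : linear_sketch R d,
    (forall (w : sk_space sk) (A B : {mset cube d}),
       size A = n -> size B = n ->
       (vec_bits (sk_state w A B))%:R
         <= c%:R / eps * (plog n%:R + plog d%:R) ^+ k) /\
    (forall A B : {mset cube d},
       size A = n -> size B = n ->
       ((2%:R / 3%:R)%:E <=
          sk_prob sk
            [set w | (EMD R A B <= sk_output w A B)%R /\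
                     (sk_output w A B <=
                        c'%:R * plog n%:R * plog (plog n%:R) ^+ k' * EMD R A B
                        + eps * n%:R * d%:R)%R])%E).
Proof.
have [c cP] : exists c : nat, 2 ^+ 196 <= c%:R :> R.
  by exists (Num.truncn (2 ^+ 196 : R)).+1; rewrite ltW// truncnS_gt.
have [c' c'P] : exists c : nat, 8000 * 1000 <= c%:R :> R.
  by exists (Num.truncn (8000 * 1000 : R)).+1; rewrite ltW// truncnS_gt.
exists c, 16%N, c', 1%N => d n eps eps01.
have /andP[eps0 _] := eps01.
have pn := plog_ge1 (n%:R : R); have pd := plog_ge1 (d%:R : R).
have ppn := plog_ge1 (plog (n%:R : R)).
(* For n = 0 or d = 0 the distance is 0, and a sketch without rows that outputs 0 suffices; the
   parameters of the main case need both positive. *)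
have [/andP[n0 d0]|nd] := boolP ((0 < n) && (0 < d))%N; last first.
  have deg : n = 0%N \/ d = 0%N by move: nd; case: (n) => [|?]; [left | case: (d); first right].
  pose sk : linear_sketch R d :=
    @counter_sketch R d unit void tt (fun _ _ _ => 0) (fun _ _ _ => 0) (fun=> 0).
  exists sk; split=> [w A B An Bn|A B An Bn].
    have := @counter_sketch_bits R d unit void tt (fun _ _ _ => 0) (fun _ _ _ => 0) (fun=> 0)
      w A B n (fun _ _ _ => leq0n _) (fun _ _ _ => leq0n _) An Bn.
    rewrite card_void mul0n leqn0 => /eqP->.
    by rewrite mulr_ge0 ?divr_ge0 ?(ltW eps0)// exprn_ge0//; lra.
  apply: (@counter_sketch_prob R d _ _ _ _ _ _ A B xpredT
    (fun out => EMD R A B <= out /\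
       out <= c'%:R * plog n%:R * plog (plog n%:R) ^+ 1 * EMD R A B + eps * n%:R * d%:R)).
    move=> _ _; rewrite (EMD_degenerate R B An deg) mulr0 add0r; split=> //.
    by rewrite !mulr_ge0// ltW.
  by rewrite Ex_cst ?card_unit// -[true%:R]/(1 : R); lra.
have : (0 < #|samples d (depth d) (loglogM n + 8) (levels d n) (copies d n eps)|)%N.
  rewrite /samples /copy /bits_space /labels !(card_prod, card_ffun, card_ord, card_bool).
  by rewrite !(expn_gt0, muln_gt0).
move=> /card_gt0P[om0 _].
exists (@emd_sketch R d n _ _ (precision d n) _ _ (slack d n eps) om0).
split=> [w A B An Bn|A B An Bn].
  have := @counter_sketch_bits R d _ _ om0 _ _ _ w A B n
    (@coefA_le1 _ _ _ _ _) (@coefB_le1 _ _ _ _ _) An Bn.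
  rewrite -(@ler_nat R) => /le_trans; apply.
  apply: le_trans (rows_bits_le n0 d0 eps01) _.
  apply: ler_pM => //; last by rewrite ler_pM2r ?invr_gt0.
    by rewrite divr_ge0// ltW.
  by rewrite exprn_ge0//; lra.
have dT : (d <= 2 ^ depth d)%N by rewrite up_logP.
have lnb := @ln_points_le R n n0.
(* The shift by 8 gives 2^f >= 256, which keeps the far part below half of the distance. *)
have b8 : (2 ^+ (loglogM n + 8) : R) = 256 * 2 ^+ loglogM n by rewrite exprD; ring.
have l1 : 1 <= (2 ^+ loglogM n : R) by rewrite exprn_ege1//; lra.
have lnf : 4 * ln (n + n)%:R <= (2 ^+ (loglogM n + 8) : R) by rewrite b8; lra.
have f256 : 256 <= (2 ^+ (loglogM n + 8) : R) by rewrite b8; lra.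
have MJ : (n + n)%:R * 2%:R ^+ precision d n <= 2%:R ^+ levels d n :> R.
  by rewrite /levels exprD [leRHS]mulrC ler_pM2r ?exprn_gt0// -natrX ler_nat up_logP.
have := @sketch_correct R d n (depth d) (loglogM n) (loglogM n + 8) (precision d n)
  (levels d n) (copies d n eps) (slack d n eps) n0 dT lnb lnf f256 MJ
  (noise_le R d n0) (ltn0Sn _) (slack_gt0 n0 d0 eps01) (copies_many n0 d0 eps01) om0 A B An Bn.
move=> /le_trans; apply; apply: le_measure => //.
- by rewrite inE.
- by rewrite inE.
move=> w [lo hi]; split=> //; apply: le_trans hi _.
have -> : 64 * slack d n eps = eps * n%:R * d%:R by rewrite /slack; field.
rewrite lerD2r expr1 ler_wpM2r ?EMD_ge0//.
apply: le_trans (dist_factor_le R n0) _.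
by rewrite !ler_pM2r// (lt_le_trans ltr01).
Qed.
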